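(* Let $(\mathcal S,\mathbb M,\eta,g)$ be a $G$-graded marked surface, $G=\{1,g\}$, let $(\gamma,\mathfrak f)$ be a simple graded loop with $g$-stable image and $g\gamma$ homotopic to $\gamma^{-1}$, let $P,Q$ be the two fixed points of $g$ on $\gamma$, and let $\mathbb S$ be a $G$-invariant full system of graded arcs adapted to $\gamma$. Then in the category $H^0(\mathrm{Tw}\mathcal A_{\mathbb S}*G)_+$, for all signs $\epsilon_P,\epsilon_Q,\epsilon_P',\epsilon_Q'\in\{\pm1\}$ and $\ell\in\mathbb Z$, $$\dim_K\mathrm{Hom}(B_{\mathbb S}^{\epsilon_P,\epsilon_Q},B_{\mathbb S}^{\epsilon_P',\epsilon_Q'}[\ell])=\begin{cases}1&\text{if }\ell=0,\ \epsilon_P=\epsilon_P'\text{ and }\epsilon_Q=\epsilon_Q',\\1&\text{if }\ell=1,\ \epsilon_P=-\epsilon_P'\text{ and }\epsilon_Q=-\epsilon_Q',\\0&\text{otherwise.}\end{cases}$$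
   Context: $K$ is an algebraically closed field of characteristic $\neq2$; $G=\{1,g\}$ has order two. Surfaces. A $G$-graded marked surface $(\mathcal S,\mathbb M,\eta,g)$: a smooth compact connected oriented surface $\mathcal S$ with nonempty boundary, a nonempty finite set $\mathbb M$ of pairwise disjoint closed segments of $\partial\mathcal S$ (no boundary component is completely marked, but unmarked boundary components are allowed), a line field $\eta$ (section of $\mathbb P(T\mathcal S)$), and an orientation-preserving automorphism $g$ of order two with $g(\mathbb M)=\mathbb M$, $g^*\eta=\eta$ and finitely many fixed points. Arcs are non-contractible immersions $[0,1]\to\mathcal S$ with endpoints in $\mathbb M$, transverse to the boundary, with interior in the interior of $\mathcal S$, up to orientation and isotopy with endpoints in $\mathbb M$. The line field $\eta$ trivializes $\mathbb P(T\mathcal S)\cong\mathcal S\times\mathbb R/\mathbb Z$ (preserving orientation, $\eta\mapsto0$); a grading on a curve $\gamma$ is a homotopy class of homotopies from $\gamma^*\eta$ to $\dot\gamma$, equivalently a continuous lift $\theta_\gamma$ of $\dot\gamma$ to $\mathbb R$ (periodic for loops). A graded loop is a primitive immersed loop in the interior, not bounding an immersed teardrop, with a grading. The index at a transverse intersection point is $\mathrm{ind}(\gamma,\gamma')=\lceil\theta_\gamma-\theta_{\gamma'}\rceil$ evaluated at this point. An $\mathbb M$-segment from $X_i$ to $X_j$ is an embedded segment in $\mathbb M$, oriented opposite to the boundary orientation, from an endpoint of $X_i$ to an endpoint of $X_j$; its degree is $|a|=\mathrm{ind}(X_i,a)-\mathrm{ind}(X_j,a)$ for any grading of $a$; write $\|a\|=|a|-1$.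 Fukaya category. A full system of graded arcs $\mathbb S$ is a finite collection of pairwise disjoint non-isotopic simple graded arcs containing all boundary arcs (simple arcs isotopic to a boundary segment with endpoints in $\mathbb M$ and interior disjoint from $\mathbb M$) and cutting $\mathcal S$ into discs or annuli with one unmarked boundary component; it is $G$-invariant if $g$ permutes its graded arcs. $\mathcal A_{\mathbb S}$ is the strictly unital $A_\infty$-category with objects the arcs of $\mathbb S$; morphisms $X_i\to X_j$ have basis the $\mathbb M$-segments (and $1$ if $i=j$); $\mu^1=0$; $\mu^2(b,a)=(-1)^{|a|}ba$ if $a$ followed by $b$ is an $\mathbb M$-segment $ba$, and $0$ otherwise; if $n\ge3$ and $(X_{i_1},a_1,\dots,X_{i_n},a_n)$ enclose a disc ($a_j:X_{i_j}\to X_{i_{j+1}}$, indices cyclic) then $\mu^n(a_n,\dots,a_1b)=(-1)^{|b|}b$ and $\mu^n(ba_n,\dots,a_1)=b$ for $b$ an $\mathbb M$-segment or identity; other operations vanish. Twisted complexes follow Seidel's conventions: $X[m]=K[m]\otimes X$, $s^m:K[d]\to K[d+m]$ is the canonical map of degree $-m$, and $\mu^n(\phi_n\otimes a_n,\dots,\phi_1\otimes a_1)=(-1)^{\sum_{i<j}|\phi_i|\|a_j\|}\phi_n\cdots\phi_1\otimes\mu^n(a_n,\dots,a_1)$. Skew-group category. $G$ acts strictly on $\mathcal A=\mathcal A_{\mathbb S}$ and $\mathrm{Tw}\mathcal A$. $(\mathrm{Tw}\mathcal A)*G$ has objects $\{X\}$, morphisms $\bigoplus_{h\in G}\mathrm{Hom}(hX,Y)$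 (written $a\otimes h$), and $\mu^n(a_n\otimes h_n,\dots,a_1\otimes h_1)=\mu^n(a_n,h_na_{n-1},\dots,h_n\cdots h_2a_1)\otimes h_n\cdots h_1$. $H^0(\mathrm{Tw}\mathcal A*G)_+$ is the idempotent completion of $H^0((\mathrm{Tw}\mathcal A)*G)$, canonically equivalent to that of the triangulated category $H^0\mathrm{Tw}(\mathcal A*G)$; objects are pairs ($\{X\}$, idempotent). Adapted system and double tagged objects. $\mathbb S$ is adapted to $\gamma$ if it contains arcs $X=gX$, $Y=gY$, $Z$, $gZ$ such that $Z$, $gZ$ (and $\mathbb M$-segments) bound an annulus with core $\gamma$; cut along $X$ it is a rectangle with left and right sides $X$, top $Z$, bottom $gZ$; $Y$ is the diagonal from top left to bottom right; $\gamma$ runs horizontally from left to right, crossing $X$ at $P$ and $Y$ at $Q$. The corner $\mathbb M$-segments are $c:X\to Y$, $ga:Y\to Z$ (top left), $gc:X\to Y$, $a:Y\to gZ$ (bottom right), $gb:Z\to X$ (top right), $b:gZ\to X$ (bottom left). With $p=\mathrm{ind}_P(\gamma,X)$ and $q=\mathrm{ind}_Q(\gamma,Y)$ (so $q=p+|c|$), for $\lambda\in K^*$ let $B_\lambda$ be the twisted complex $X[p]\to Y[q-1]$ with differential $s^{\|c\|}\otimes(\lambda(-1)^{\|c\|}c+gc)$. For $\epsilon_P,\epsilon_Q\in\{\pm1\}$ and $\lambda=\epsilon_P\epsilon_Q$, $$B_{\mathbb S}^{\epsilon_P,\epsilon_Q}=\Big(\{B_\lambda\},\,1_X\otimes\tfrac{1+\epsilon_P(-1)^pg}2+1_Y\otimes\tfrac{1+\epsilon_Q(-1)^{q-1}g}2\Big).$$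 *)

(* Defs.v *)
From HB Require Import structures.
From mathcomp Require Import all_boot all_order all_algebra.
From mathcomp Require Import all_classical all_reals all_analysis.
Set Implicit Arguments.
Unset Strict Implicit.
Unset Printing Implicit Defensive.
Import Order.TTheory GRing.Theory Num.Theory.
Import numFieldNormedType.Exports.
Local Open Scope classical_set_scope.
Local Open Scope ring_scope.

Section Plane.
Variable R : realType.
Local Notation plane := (R * R)%type.

Definition unitI : set R := [set t | 0 <= t <= 1].
Definition halfplane : set plane := [set z | 0 <= z.2].
Definition unit_disc : set plane := [set z | z.1 ^+ 2 + z.2 ^+ 2 <= 1].

(* R/Z is identified with the unit circle *)
Definition circ (t : R) : plane := (cos (2 * pi * t), sin (2 * pi * t)).

Fixpoint Cn (n : nat) (f : plane -> plane) (U : set plane) : Prop :=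
  (forall z, U z -> {for z, continuous f}) /\
  (if n is m.+1 then
     [/\ forall z, U z -> derivable f z (1, 0) /\ derivable f z (0, 1),
         Cn m (fun z => 'D_(1, 0) f z) U & Cn m (fun z => 'D_(0, 1) f z) U]
   else True).

Definition smooth2 (f : plane -> plane) (z : plane) : Prop :=
  exists U, open_nbhs z U /\ forall n, Cn n f U.

Definition smooth1 (f : R -> plane) (t : R) : Prop :=
  \forall s \near t, forall n, derivable (derive1n n f) s 1.

Definition jacobian (f : plane -> plane) (z : plane) : R :=
  let u : plane := 'D_(1, 0) f z in let v : plane := 'D_(0, 1) f z in
  u.1 * v.2 - u.2 * v.1.

Definition collinear (u v : plane) : Prop := u.1 * v.2 = u.2 * v.1.

Definition locally_injective (T : Type) (A : set plane) (u : plane -> T) :=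
  forall z, A z -> exists U, nbhs z U /\
    forall w w', U w -> A w -> U w' -> A w' -> u w = u w' -> w = w'.

End Plane.

Definition homeomorphic_sets (T U : topologicalType) (A : set T) (B : set U) :=
  exists (f : T -> U) (h : U -> T),
    [/\ {within A, continuous f}, {within B, continuous h},
        forall x, A x -> B (f x) /\ h (f x) = x &
        forall y, B y -> A (h y) /\ f (h y) = y].

(* An atlas of charts to the upper half plane with its standard orientation. *)
Record atlas (R : realType) := Atlas {
  pts : topologicalType;
  cidx : Type;
  dom : cidx -> set pts;
  chart : cidx -> pts -> R * R }.

Section Surface.
Variables (R : realType) (S : atlas R).
Local Notation plane := (R * R)%type.
Local Notation T := (pts S).

(* [*_rep ... f]: f is a C^oo extension to a full neighbourhood in R or R^2 of
   the coordinate expression of a map from S, an interval I, or a subset O of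
   R^2; at points where the source has boundary the extension is not unique,
   but its first derivatives at the base point are. *)
Definition map_rep (F : T -> T) (a b : cidx S) (x : T) (f : plane -> plane) :=
  [/\ dom a x, dom b (F x), smooth2 f (chart a x) &
    \forall y \near x, dom b (F y) /\ chart b (F y) = f (chart a y)].

Definition curve_rep (I : set R) (c : R -> T) (t : R) (a : cidx S)
    (f : R -> plane) :=
  [/\ I t, dom a (c t), smooth1 f t &
    \forall s \near t, I s -> dom a (c s) /\ chart a (c s) = f s].

Definition region_rep (O : set plane) (r : plane -> T) (z : plane)
    (a : cidx S) (f : plane -> plane) :=
  [/\ O z, dom a (r z), smooth2 f z &
    \forall w \near z, O w -> dom a (r w) /\ chart a (r w) = f w].

Definition oriented_smooth (F : T -> T) :=
  forall a b x, dom a x -> dom b (F x) ->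
    exists f, map_rep F a b x f /\ 0 < jacobian f (chart a x).

Definition boundary : set T :=
  [set x | exists a, dom a x /\ (chart a x).2 = 0].
Definition minterior : set T := ~` boundary.

Definition is_surface : Prop :=
  [/\ hausdorff_space T, compact [set: T], connected [set: T] &
      boundary !=set0] /\
  [/\ forall a : cidx S, open (dom a),
      forall x : T, exists a, dom a x,
      forall (a : cidx S) x y, dom a x -> dom a y -> chart a x = chart a y -> x = y,
      forall a : cidx S, {within dom a, continuous (chart a)} &
      forall a (V : set T), open V -> V `<=` dom a ->
        exists O : set plane, open O /\ chart a @` V = O `&` @halfplane R] /\
  oriented_smooth idfun.

Definition is_velocity (I : set R) (c : R -> T) (t : R) (a : cidx S)
    (v : plane) :=
  exists f, curve_rep I c t a f /\ v = derive1 f t.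

Definition immersed_curve (I : set R) (c : R -> T) :=
  forall t a, I t -> dom a (c t) ->
    exists f, curve_rep I c t a f /\ derive1 f t != 0 :> plane.

(* equality of smooth arcs up to reparametrisation, possibly reversing the
   orientation *)
Definition same_arc (c d : R -> T) := exists r : R -> R,
  [/\ forall t, derivable r t 1, continuous (derive1 r),
      forall t, unitI t -> derive1 r t != 0,
      r @` @unitI R = @unitI R & forall t, unitI t -> c t = d (r t)].

(* c is a smoothly reparametrised, positively oriented piece of d *)
Definition subarc (c d : R -> T) := exists r : R -> R,
  [/\ forall t, derivable r t 1, continuous (derive1 r),
      forall t, unitI t -> 0 < derive1 r t,
      r @` @unitI R `<=` @unitI R & forall t, unitI t -> c t = d (r t)].

(* a line in a chart is represented by a spanning vector *)
Definition line_field (eta : cidx S -> T -> plane) :=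
  (forall a x, dom a x -> exists f : plane -> plane,
    [/\ smooth2 f (chart a x), f (chart a x) != 0 &
      \forall y \near x, eta a y != 0 /\ collinear (eta a y) (f (chart a y))])
  /\ (forall a b x f, map_rep idfun a b x f ->
        collinear (eta b x) ('D_(eta a x) f (chart a x))).

(* The orientation-preserving trivialisation P(TS) = S x R/Z with eta |-> 0:
   [tau a x v] is the image, in the unit circle, of the line spanned by the
   tangent vector with coordinates v in the chart a. The function h is the lift
   of an orientation-preserving homeomorphism P(T_x S) -> R/Z. *)
Definition trivialization (eta : cidx S -> T -> plane)
    (tau : cidx S -> T -> plane -> plane) :=
  [/\ forall a b x f v, map_rep idfun a b x f -> v != 0 ->
        tau b x ('D_v f (chart a x)) = tau a x v,
      forall a x, dom a x -> exists h : R -> R,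
        [/\ continuous h, {homo h : s t / s < t}, forall s, h (s + 1) = h s + 1
          & forall k s, k != 0 ->
              tau a x (k * cos (pi * s), k * sin (pi * s)) = circ (h s)],
      forall a, {within [set z : T * plane | dom a z.1 /\ z.2 != 0],
                  continuous (fun z => tau a z.1 z.2)} &
      forall a x, dom a x -> tau a x (eta a x) = circ 0].

(* a grading of an immersed curve, as a lift of its direction to R *)
Definition is_grading (tau : cidx S -> T -> plane -> plane) (I : set R)
    (c : R -> T) (theta : R -> R) :=
  {within I, continuous theta} /\
  forall t a v, is_velocity I c t a v -> tau a (c t) v = circ (theta t).

End Surface.

(* The marked segments are parametrised by [mseg k] on [0, 1], against the
   boundary orientation (which is the positive first axis in a chart). *)
Record gms_data (R : realType) := GmsData {
  surf :> atlas R;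
  nM : nat;
  mseg : 'I_nM -> R -> pts surf;
  eta : cidx surf -> pts surf -> R * R;
  tau : cidx surf -> pts surf -> R * R -> R * R;
  invg : pts surf -> pts surf }.

Section Gms.
Variables (R : realType) (S : gms_data R).
Local Notation plane := (R * R)%type.
Local Notation T := (pts S).
Local Notation g := (@invg R S).

Definition marked : set T := [set x | exists k t, unitI t /\ mseg k t = x].

Definition marked_segments : Prop :=
  [/\ (0 < nM S)%N,
      forall k t, unitI t -> boundary (mseg k t : T),
      forall (k : 'I_(nM S)) t a, unitI t -> dom a (mseg k t) ->
        exists f : R -> plane, curve_rep (@unitI R) (mseg k) t a f /\
          (derive1 f t : plane).1 < 0,
      forall (k l : 'I_(nM S)) s t, unitI s -> unitI t ->
        mseg k s = mseg l t -> k = l /\ s = t &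
      forall x : T, boundary x ->
        ~ (connected_component (@boundary R S) x `<=` marked)].

Definition is_gms : Prop :=
  [/\ is_surface S, marked_segments, line_field (@eta R S),
      trivialization (@eta R S) (@tau R S) &
      [/\ oriented_smooth g,
          forall x, g (g x) = x,
          finite_set [set x | g x = x],
          forall k, exists l, g @` (mseg k @` @unitI R) = mseg l @` @unitI R &
          forall a b x f, map_rep g a b x f ->
            collinear (eta b (g x)) ('D_(eta a x) f (chart a x))] /\
      (exists x, g x <> x)].

Definition in_square : set plane := [set z | unitI z.1 /\ unitI z.2].

Definition contractible_arc (c : R -> T) := exists H : R -> R -> T,
  [/\ {within in_square, continuous (fun z => H z.1 z.2)},
      forall s, unitI s -> marked (H s 0) /\ marked (H s 1),
      forall t, unitI t -> H 0 t = c t &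
      forall t, unitI t -> H 1 t = H 1 0].

Definition simple_curve (c : R -> T) :=
  forall s t, unitI s -> unitI t -> c s = c t -> s = t.

Definition is_arc (c : R -> T) :=
  [/\ immersed_curve (@unitI R) c,
      marked (c 0) /\ marked (c 1),
      forall t a v, t = 0 \/ t = 1 -> is_velocity (@unitI R) c t a v ->
        v.2 != 0,
      forall t, 0 < t < 1 -> minterior (c t) &
      ~ contractible_arc c].

(* Used for simple arcs, up to orientation. The intermediate curves are only
   continuous and may touch the boundary, so that boundary segments are allowed
   as ends of the isotopy. *)
Definition isotopic (c d : R -> T) := exists H : R -> R -> T,
  [/\ {within in_square, continuous (fun z => H z.1 z.2)},
      forall s, unitI s -> [/\ simple_curve (H s), marked (H s 0) &
                               marked (H s 1)],
      forall t, unitI t -> H 0 t = c t &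
      (forall t, unitI t -> H 1 t = d t) \/
      (forall t, unitI t -> H 1 t = d (1 - t))].

Definition boundary_arc (c : R -> T) :=
  [/\ is_arc c, simple_curve c & exists d : R -> T,
    [/\ {within @unitI R, continuous d}, simple_curve d,
        forall t, unitI t -> boundary (d t),
        marked (d 0) /\ marked (d 1) &
        forall t, 0 < t < 1 -> ~ marked (d t)] /\ isotopic c d].

(* loops are curves of period 1 *)
Definition loop (c : R -> T) := continuous c /\ forall t, c (t + 1) = c t.

Definition freely_homotopic (c d : R -> T) := exists H : R -> R -> T,
  [/\ {within [set z : plane | unitI z.1], continuous (fun z => H z.1 z.2)},
      forall s t, unitI s -> H s (t + 1) = H s t,
      forall t, H 0 t = c t & forall t, H 1 t = d t].

(* For n >= 2 and d constant this also excludes contractible loops. *)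
Definition primitive_loop (c : R -> T) :=
  ~ exists n (d : R -> T), [/\ (2 <= n)%N, loop d &
      freely_homotopic c (fun t => d (n%:R * t))].

(* an immersed disc whose boundary is a piece of c closing up at one corner;
   the convexity of the corner is not imposed, since a simple loop has none *)
Definition bounds_teardrop (c : R -> T) := exists s t (u : plane -> T),
  [/\ s < t, {within @unit_disc R, continuous u},
      locally_injective (@unit_disc R) u &
      forall r, unitI r -> u (circ r) = c (s + r * (t - s))].

Definition graded_loop (c : R -> T) (theta : R -> R) :=
  [/\ loop c, immersed_curve [set: R] c, forall t, @minterior R S (c t),
      primitive_loop c & ~ bounds_teardrop c] /\
  is_grading (@tau R S) [set: R] c theta /\
  (forall t, theta (t + 1) = theta t).

Definition simple_loop (c : R -> T) :=
  forall s t, c s = c t -> exists z : int, t - s = z%:~R.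

Definition ind (th th' : R) : int := Num.ceil (th - th').

End Gms.

(* The endpoint [arc i b%:R] is [mseg (acomp i b) (apos i b)]; [arcg] gives the
   gradings of the arcs, [msegg] a grading of each marked segment, used to
   compute the degrees (which do not depend on it); [gI] is the permutation of
   the arcs induced by g. *)
Record arcs_data (R : realType) (S : gms_data R) := ArcsData {
  aidx : finType;
  arc : aidx -> R -> pts S;
  arcg : aidx -> R -> R;
  acomp : aidx -> bool -> 'I_(nM S);
  apos : aidx -> bool -> R;
  msegg : 'I_(nM S) -> R -> R;
  gI : aidx -> aidx }.

Section System.
Variables (R : realType) (S : gms_data R) (D : arcs_data S).
Local Notation plane := (R * R)%type.
Local Notation T := (pts S).
Local Notation I := (aidx D).

Definition arcs_complement : set T :=
  [set x | forall (i : I) t, unitI t -> arc i t <> x].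

(* for the piece of S, cut along the arcs, which contains x *)
Definition disc_or_annulus (x : T) :=
  let C := connected_component arcs_complement x in
  let Co := C `&` @minterior R S in
  homeomorphic_sets Co [set: plane] \/
  (homeomorphic_sets Co [set z : plane | z != 0] /\
   exists b, boundary b /\
     connected_component (@boundary R S) b `<=` C `\` @marked R S).

Definition full_system : Prop :=
  [/\ forall i : I, is_arc (arc i) /\
        is_grading (@tau R S) (@unitI R) (arc i) (arcg i),
      forall (i : I) (b : bool), unitI (apos i b) /\
        arc i b%:R = mseg (acomp i b) (apos i b),
      forall k, is_grading (@tau R S) (@unitI R) (mseg k) (msegg D k),
      forall (i j : I) s t, unitI s -> unitI t -> arc i s = arc j t ->
        i = j /\ s = t &
      forall i j : I, i <> j -> ~ isotopic (arc i) (arc j)] /\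
  (forall c : R -> T, boundary_arc c -> exists i : I, isotopic c (arc i)) /\
  (forall x, arcs_complement x -> disc_or_annulus x).

(* As g preserves eta, the map R/Z = P(T_x S) -> P(T_gx S) = R/Z induced by g
   has a lift to R fixing every integer, which transports gradings: the grading transported by g from arc i is the lift of
   the direction of arc (gI i) with the same integral part as the grading of
   arc i. *)
Definition invariant_system : Prop :=
  forall i : I, same_arc (fun t => invg (arc i t)) (arc (gI i)) /\
    forall s t, unitI s -> unitI t -> invg (arc i s) = arc (gI i) t ->
      Num.floor (arcg i s) = Num.floor (arcg (gI i) t).

(* an end of an arc; (i, b) stands for the point [arc i b%:R] *)
Definition arc_end := (I * bool)%type.
Definition ecomp (e : arc_end) := acomp e.1 e.2.
Definition epos (e : arc_end) := apos e.1 e.2.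

(* Since [mseg] runs against the boundary orientation and distinct ends are
   distinct points, there is at most one M-segment between two ends. *)
Definition segment :=
  {s : arc_end * arc_end | (ecomp s.1 == ecomp s.2) && (epos s.1 < epos s.2)}.

Definition seg_src (a : segment) : arc_end := (val a).1.
Definition seg_tgt (a : segment) : arc_end := (val a).2.

Definition end_index (e : arc_end) : int :=
  ind (arcg e.1 e.2%:R) (msegg D (ecomp e) (epos e)).

Definition seg_deg (a : segment) : int :=
  end_index (seg_src a) - end_index (seg_tgt a).

Definition gend (e : arc_end) : arc_end :=
  (gI e.1, `[< invg (arc e.1 e.2%:R) = arc (gI e.1) 1 >]).

(* (gend s.1, gend s.2) always bounds an M-segment when g(M) = M *)
Definition gseg (a : segment) : segment :=
  insubd a (gend (seg_src a), gend (seg_tgt a)).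

(* [inl i] is the identity of the arc i *)
Definition bmor := (I + segment)%type.
Definition bsrc (a : bmor) : I :=
  match a with inl i => i | inr s => (seg_src s).1 end.
Definition btgt (a : bmor) : I :=
  match a with inl i => i | inr s => (seg_tgt s).1 end.
Definition bdeg (a : bmor) : int :=
  match a with inl _ => 0 | inr s => seg_deg s end.
Definition bg (a : bmor) : bmor :=
  match a with inl i => inl (gI i) | inr s => inr (gseg s) end.

(* the product ba: a followed by b *)
Definition bcomp (b a : bmor) : option bmor :=
  match a, b with
  | inl i, _ => if bsrc b == i then Some b else None
  | _, inl j => if btgt a == j then Some a else None
  | inr s, inr t =>
      if seg_tgt s == seg_src t
      then omap inr (insub (seg_src s, seg_tgt t) : option segment)
      else None
  end.

(* The disc is immersed, as discs need not be minimal. Its boundary circle is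
   cut into 2n pieces, mapped alternately to the M-segment w j and to the arc
   at the target of w j. *)
Definition encloses_disc (n : nat) (w : 'I_n -> segment) : Prop :=
  [/\ (3 <= n)%N,
      forall j, seg_src (w (ordS j)) =
                ((seg_tgt (w j)).1, ~~ (seg_tgt (w j)).2) &
      exists u : plane -> T,
        [/\ {within @unit_disc R, continuous u},
            locally_injective (@unit_disc R) u,
            forall (j : 'I_n) r, unitI r ->
              u (circ ((2 * j%:R + r) / (2 * n%:R))) =
              mseg (ecomp (seg_src (w j)))
                (epos (seg_src (w j)) +
                 r * (epos (seg_tgt (w j)) - epos (seg_src (w j)))) &
            forall (j : 'I_n) r, unitI r ->
              u (circ ((2 * j%:R + 1 + r) / (2 * n%:R))) =
              arc (seg_tgt (w j)).1
                (if (seg_tgt (w j)).2 then 1 - r else r)]].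

(* Sequences of inputs are listed in order of composition: [:: a_1; ..; a_n] *)
Definition disc_sequence (s : seq bmor) : Prop :=
  exists n (w : 'I_n -> segment),
    encloses_disc w /\ s = [seq inr (w j) | j <- enum 'I_n].

(* s = (a_1 b, a_2, .., a_n) *)
Definition disc_head (s : seq bmor) (b : bmor) : Prop :=
  exists a x r, [/\ disc_sequence (a :: r), bcomp a b = Some x & s = x :: r].

(* s = (a_1, .., a_(n-1), b a_n) *)
Definition disc_last (s : seq bmor) (b : bmor) : Prop :=
  exists a x r, [/\ disc_sequence (rcons r a), bcomp b a = Some x &
                    s = rcons r x].

End System.

(* The data of an A-infinity category with finitely many objects and a finite
   basis of morphisms, and of a strict action of G = {1, g} permuting the
   basis; [mu] gives the operations on basis elements. *)

Record ainf (K : fieldType) := Ainf {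
  obj : finType;
  mor : finType;
  src : mor -> obj;
  tgt : mor -> obj;
  deg : mor -> int;
  one : obj -> mor;
  mu : seq mor -> {ffun mor -> K^o};
  gobj : obj -> obj;
  gmor : mor -> mor }.

Section FukayaCategory.
Variables (K : fieldType) (R : realType) (S : gms_data R) (D : arcs_data S).

Definition fuk_mu (s : seq (bmor D)) : {ffun bmor D -> K^o} :=
  match s with
  | [::] | [:: _] => 0
  | [:: a; b] => [ffun x => if bcomp b a == Some x then (-1) ^ bdeg a else 0]
  | _ => [ffun b => if `[< disc_head s b >] then (-1) ^ bdeg b
                    else if `[< disc_last s b >] then 1 else 0]
  end.

Definition fuk : ainf K :=
  @Ainf K (aidx D) (bmor D) (@bsrc R S D) (@btgt R S D) (@bdeg R S D)
    (fun i => inl i) fuk_mu (@gI R S D) (@bg R S D).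

End FukayaCategory.

Section Twisted.
Variables (K : fieldType) (A : ainf K).
Local Notation vect := {ffun mor A -> K^o}.

(* The entry a of [tdelta E] (or of a morphism) at (k, l, a) stands for
   s^m (x) a, with m the difference of the shifts. *)
Record tw := Tw {
  rk : nat;
  tob : 'I_rk -> obj A;
  tsh : 'I_rk -> int;
  tdelta : {ffun 'I_rk * 'I_rk * mor A -> K^o} }.

Definition hom (E F : tw) := {ffun 'I_(rk E) * 'I_(rk F) * mor A -> K^o}.

Inductive chain : tw -> tw -> Type :=
| cnil E : chain E E
| ccons E F H (x : hom E F) (c : chain F H) : chain E H.

Fixpoint ccat E F H (c : chain E F) : chain F H -> chain E H :=
  match c in chain E F return chain F H -> chain E H with
  | cnil _ => fun d => d
  | ccons _ _ _ x c' => fun d => ccons x (ccat c' d)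
  end.

Fixpoint delta_chain (E : tw) (r : nat) : chain E E :=
  if r is r'.+1 then @ccons E E E (tdelta E) (delta_chain E r') else cnil E.

(* sum over i < j of |phi_i| ||a_j||, for w = [:: (|phi_1|, a_1); ...] *)
Fixpoint koszul (w : seq (int * mor A)) : int :=
  if w is x :: w' then x.1 * (\sum_(y <- w') (deg y.2 - 1)) + koszul w' else 0.

(* the operations of the additive enlargement; w accumulates the tensor factors
   already read *)
Fixpoint mu_word E F (c : chain E F) :
    'I_(rk E) -> 'I_(rk F) -> seq (int * mor A) -> vect :=
  match c in chain E F
    return 'I_(rk E) -> 'I_(rk F) -> seq (int * mor A) -> vect with
  | cnil _ => fun k l w =>
      if k == l then (-1) ^ koszul w *: mu [seq y.2 | y <- w] else 0
  | ccons E F H x c' => fun k l w =>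
      \sum_(k' < rk F) \sum_(a : mor A)
        x (k, k', a) *: mu_word c' k' l (rcons w (- (tsh k' - tsh k), a))
  end.

Definition mu_sum E F (c : chain E F) : hom E F :=
  [ffun t => mu_word c t.1.1 t.1.2 [::] t.2].

(* all insertions of differentials; delta^r = 0 for r >= rk E *)
Fixpoint insertions E F (c : chain E F) : seq (chain E F) :=
  match c in chain E F return seq (chain E F) with
  | cnil E => [seq delta_chain E r | r <- iota 0 (rk E)]
  | ccons E _ _ x c' =>
      [seq ccat (delta_chain E r) (ccons x d)
         | r <- iota 0 (rk E), d <- insertions c']
  end.

Definition mu_tw E F (c : chain E F) : hom E F :=
  \sum_(d <- insertions c) mu_sum d.

Definition is_twisted (E : tw) : Prop :=
  (forall k l a, tdelta E (k, l, a) != 0 ->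
    [/\ (k < l)%N, src a = tob k, tgt a = tob l &
        deg a - (tsh l - tsh k) = 1]) /\
  mu_tw (cnil E) = 0.

Definition tw_shift (m : int) (E : tw) : tw :=
  @Tw (rk E) (@tob E) (fun k => tsh k + m) (tdelta E).

(* G = {1, g} is bool, with g = true and product (+) *)

Definition act_hom (n m : nat) (h : bool)
    (x : {ffun 'I_n * 'I_m * mor A -> K^o}) :
    {ffun 'I_n * 'I_m * mor A -> K^o} :=
  if h then [ffun t => \sum_(b | gmor b == t.2) x (t.1, b)] else x.

Definition act_obj (h : bool) (i : obj A) := if h then gobj i else i.

Definition act_tw (h : bool) (E : tw) : tw :=
  @Tw (rk E) (fun k => act_obj h (tob k)) (@tsh E) (act_hom h (tdelta E)).

Definition skew_basis (E F : tw) : finType :=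
  (bool * ('I_(rk E) * 'I_(rk F) * mor A))%type.
Definition skew_hom (E F : tw) := {ffun skew_basis E F -> K^o}.

(* the a_h in the sum of the a_h (x) h *)
Definition skew_part E F (h : bool) (x : skew_hom E F) : hom (act_tw h E) F :=
  [ffun t => x (h, t)].

Definition skew_mu1 E F (x : skew_hom E F) : skew_hom E F :=
  [ffun t : skew_basis E F =>
     mu_tw (ccons (skew_part t.1 x) (cnil F)) t.2].

Definition skew_mu2 E F H (y : skew_hom F H) (x : skew_hom E F) :
    skew_hom E H :=
  [ffun t : skew_basis E H =>
   \sum_(k : bool) \sum_(h : bool | k (+) h == t.1)
     mu_tw (@ccons (act_tw k (act_tw h E)) (act_tw k F) H
              (act_hom k (skew_part h x)) (ccons (skew_part k y) (cnil H)))
       t.2].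

Definition skew_delta E F (t : skew_basis E F) : skew_hom E F :=
  [ffun u => (u == t)%:R].

(* t is a basis element of Hom(hE, F) for some h, of degree m *)
Definition skew_degb E F (m : int) (t : skew_basis E F) : bool :=
  let: (h, (k, l, a)) := t in
  [&& src a == act_obj h (tob k), tgt a == tob l &
      deg a - (tsh l - tsh k) == m].

Definition skew_homog E F (m : int) : {vspace skew_hom E F} :=
  <<[seq skew_delta t | t <- enum (@skew_degb E F m)]>>%VS.

Definition cocycles E F : {vspace skew_hom E F} :=
  (skew_homog E F 0 :&: lker (linfun (@skew_mu1 E F)))%VS.
Definition coboundaries E F : {vspace skew_hom E F} :=
  (linfun (@skew_mu1 E F) @: skew_homog E F (-1))%VS.

(* The composition of H^0 is induced by [skew_mu2]: the sign (-1)^|a| relating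
   them is trivial in degree 0. *)
Record kar := Kar { kar_tw : tw; kar_idem : skew_hom kar_tw kar_tw }.

Definition is_kar (X : kar) : Prop :=
  [/\ is_twisted (kar_tw X),
      kar_idem X \in cocycles (kar_tw X) (kar_tw X) &
      skew_mu2 (kar_idem X) (kar_idem X) - kar_idem X
        \in coboundaries (kar_tw X) (kar_tw X)].

Definition kar_shift (m : int) (X : kar) : kar :=
  @Kar (tw_shift m (kar_tw X)) (kar_idem X).

(* Hom(X, Y) = f o H^0 o e is the image of
   x |-> f o x o e from cocycles to cocycles modulo coboundaries *)
Definition kar_proj (X Y : kar) (x : skew_hom (kar_tw X) (kar_tw Y)) :
    skew_hom (kar_tw X) (kar_tw Y) :=
  skew_mu2 (kar_idem Y) (skew_mu2 x (kar_idem X)).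

Definition kar_hom_dim (X Y : kar) : nat :=
  let B := coboundaries (kar_tw X) (kar_tw Y) in
  (\dim ((linfun (@kar_proj X Y) @: cocycles (kar_tw X) (kar_tw Y)) + B)%VS
   - \dim B)%N.

End Twisted.

(* The annulus cut along X, as the image under [rect] of a rectangle whose four
   corners are cut off by the M-segments. *)
Definition octagon (R : realType) : set (R * R) :=
  [set z | [/\ `|z.1| <= 2, `|z.2| <= 2 & `|z.1| + `|z.2| <= 3]].

(* P = loop(tP) = arc iX sP, Q = loop(tQ) = arc iY sQ; cseg is the M-segment c *)
Record adapted_data (R : realType) (S : gms_data R) (D : arcs_data S) :=
  AdaptedData {
  iX : aidx D; iY : aidx D; iZ : aidx D;
  rect : R * R -> pts S;
  tP : R; sP : R; tQ : R; sQ : R;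
  cseg : segment D }.

Section Adapted.
Variables (R : realType) (S : gms_data R) (D : arcs_data S).
Variables (c : R -> pts S) (theta : R -> R) (P Q : pts S) (ad : adapted_data D).
Local Notation plane := (R * R)%type.
Local Notation r := (rect ad).

(* X is the left and the right side, Y the diagonal, Z the top, gZ the bottom;
   the corner M-segments (c then ga, gb, gc then a, b) are listed clockwise from
   the top left. *)
Definition adapted : Prop :=
  [/\ [/\ gI (iX ad) = iX ad, gI (iY ad) = iY ad,
          forall z a, @octagon R z -> dom a (r z) ->
            exists f, region_rep (@octagon R) r z a f /\ 0 < jacobian f z,
          forall y, `|y| <= 1 -> r (-2, y) = r (2, y) &
          forall z w, @octagon R z -> @octagon R w -> r z = r w ->
            z = w \/ [/\ z.2 = w.2, `|z.1| = 2 & w.1 = - z.1]],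
      [/\ same_arc (arc (iX ad)) (fun t => r (-2, 2 * t - 1)),
          same_arc (arc (iY ad)) (fun t => r (3 * t - 3 / 2, 3 / 2 - 3 * t)),
          same_arc (arc (iZ ad)) (fun t => r (2 * t - 1, 2)) &
          same_arc (arc (gI (iZ ad))) (fun t => r (2 * t - 1, -2))],
      [/\ exists k, subarc (fun t => r (t - 2, t + 1)) (mseg k),
          exists k, subarc (fun t => r (t + 1, 2 - t)) (mseg k),
          exists k, subarc (fun t => r (2 - t, -1 - t)) (mseg k) &
          exists k, subarc (fun t => r (-1 - t, t - 2)) (mseg k)],
      exists rho : R -> R,
        [/\ forall x, derivable rho x 1, continuous (derive1 rho),
            forall x, `|x| <= 2 -> 0 < derive1 rho x, rho 2 = rho (-2) + 1 &
            forall x, `|x| <= 2 -> c (rho x) = r (x, 0)] &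
      [/\ P = r (-2, 0) /\ Q = r (0, 0),
          [/\ unitI (sP ad), c (tP ad) = P & arc (iX ad) (sP ad) = P],
          [/\ unitI (sQ ad), c (tQ ad) = Q & arc (iY ad) (sQ ad) = Q],
          (seg_src (cseg ad)).1 = iX ad /\ (seg_tgt (cseg ad)).1 = iY ad &
          arc (iX ad) (seg_src (cseg ad)).2%:R = r (-2, 1) /\
          arc (iY ad) (seg_tgt (cseg ad)).2%:R = r (- (3 / 2), 3 / 2)]].

Definition indP : int := ind (theta (tP ad)) (arcg (iX ad) (sP ad)).
Definition indQ : int := ind (theta (tQ ad)) (arcg (iY ad) (sQ ad)).

Variable K : fieldType.
Local Notation A := (fuk K D).
Local Notation mc := (inr (cseg ad) : mor A).

(* X[p] -> Y[q-1] with differential s^||c|| (x) (lam (-1)^||c|| c + gc) *)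
Definition B_lam (lam : K) : tw A :=
  @Tw K A 2
    (fun k => if k == ord0 then iX ad else iY ad)
    (fun k => if k == ord0 then indP else indQ - 1)
    [ffun t : 'I_2 * 'I_2 * mor A => if (t.1.1 == ord0) && (t.1.2 == ord_max) then
                 lam * (-1) ^ (deg mc - 1) * (t.2 == mc)%:R +
                 (t.2 == gmor mc)%:R
               else 0].

(* 1_X (x) (1 + eP (-1)^p g)/2 + 1_Y (x) (1 + eQ (-1)^(q-1) g)/2 *)
Definition idem_coef (eP eQ : int) (h : bool) (k l : 'I_2) (a : mor A) : K :=
  if (k == l) && (a == @one K A (if k == ord0 then iX ad else iY ad))
  then (if h then (if k == ord0 then eP%:~R * (-1) ^ indP
                   else eQ%:~R * (-1) ^ (indQ - 1))
        else 1) / 2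
  else 0.

Definition B_eps (eP eQ : int) : kar A :=
  @Kar K A (B_lam (eP * eQ)%:~R)
    [ffun t : bool * ('I_2 * 'I_2 * mor A) =>
       idem_coef eP eQ t.1 t.2.1.1 t.2.1.2 t.2.2].

End Adapted.

(* Main.v *)
Require Import Defs.
From HB Require Import structures.
From mathcomp Require Import all_boot all_order all_algebra.
From mathcomp Require Import all_classical all_reals all_analysis.
From mathcomp Require Import zify ring lra.
Import Order.TTheory GRing.Theory Num.Theory.
Import numFieldNormedType.Exports.
Local Open Scope classical_set_scope.
Local Open Scope ring_scope.
Set Implicit Arguments.
Unset Strict Implicit.
Unset Printing Implicit Defensive.

(** In the Fukaya category, the arcs X and Y span a Kronecker category: apart
    from the identities, the only morphisms between them are two arrows from X
    to Y, c and gc, which g exchanges and which have the same degree q - p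
    ([corner_kronecker]). Count the segments among the inputs of an operation.
    An operation with at least three inputs goes around a disc and needs two
    segments ([fuk_mu_long]), whereas a path of matrix entries between complexes
    of the form X -> Y contains at most one ([mu_word_long]). Hence only products
    with identities survive ([mu_tw1], [mu_tw2]), and a morphism of the skew-group
    category between two such complexes is a family, indexed by h in G, of
    multiples u_h of 1_X, v_h of 1_Y and of combinations w_h of c and gc
    ([homog_selt]).

    In degree 0, a cocycle is a pair (u, v) that intertwines the differentials.
    It vanishes if the two parameters lambda are different, and otherwise u
    determines v. The idempotents retain the part of u on which g acts by the
    ratio of the signs at P, so that only the multiples of the identity remain
    if the signs agree, and nothing if they do not. In degree 1, every w is a
    cocycle. All of them are coboundaries if the parameters are different, and
    otherwise w is a coboundary if and only if a linear form vanishes on w_h for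
    h = 1 and h = g. Of this two-dimensional quotient, the idempotents retain a
    line if both signs change, and nothing if none does ([kkar_hom_dim]).

    The geometric part shows that c and gc have degree q - p and that no other
    segment joins the ends of X and Y. The cut annulus is parametrised by an
    octagon, over which the directions (1, 0), (1, 1), (0, 1) and (-1, 1) of the
    loop, of the corner segments, of X and of Y have continuous lifts
    th_0 < th_1 < th_2 < th_3 < th_0 + 1 ([direction_lifts]); the inequalities
    hold because the trivialization of the projectivised tangent bundle preserves
    the orientation. Each grading differs from the lift of its direction by a
    constant integer ([curve_lift]), so that all indices are differences of such
    integers, up to an explicit 0 or 1, and the equalities |c| = q - p = |gc|
    drop out ([corner_degrees]). Finally, an increasing involution of an interval
    is the identity, and g has finitely many fixed points and permutes the marked
    segments with their directions. Hence g exchanges the ends of X and of Y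
    ([swap_ends]) and carries the marked segment of c to another one
    ([components_neq]): the four ends lie in pairs on two marked segments, which
    leaves room for c and gc only ([segments_between]). *)

(** * Linearity of the operations *)

Section Linearity.
Variables (K : fieldType) (A : ainf K).

(** The position in the chain is arbitrary because [mu_tw] inserts differentials
    on both sides. *)
Lemma mu_word_linear (E F G H : tw A) (c1 : chain E F) (c2 : chain G H) (r : K)
    (x y : Defs.hom F G) k l w :
  mu_word (ccat c1 (ccons (r *: x + y) c2)) k l w =
  r *: mu_word (ccat c1 (ccons x c2)) k l w + mu_word (ccat c1 (ccons y c2)) k l w.
Proof.
elim: c1 x y k w => [{}E|{}E F' {}F z c1 IH] x y k w /=.
  rewrite scaler_sumr -big_split /=; apply: eq_bigr => k' _.
  rewrite scaler_sumr -big_split /=; apply: eq_bigr => a _.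
  by rewrite !ffunE scalerDl scalerA.
rewrite scaler_sumr -big_split /=; apply: eq_bigr => k' _.
rewrite scaler_sumr -big_split /=; apply: eq_bigr => a _.
by rewrite IH scalerDr !scalerA mulrC.
Qed.

Lemma mu_sum_linear (E F G H : tw A) (c1 : chain E F) (c2 : chain G H) (r : K)
    (x y : Defs.hom F G) :
  mu_sum (ccat c1 (ccons (r *: x + y) c2)) =
  r *: mu_sum (ccat c1 (ccons x c2)) + mu_sum (ccat c1 (ccons y c2)).
Proof. by apply/ffunP => t; rewrite !ffunE mu_word_linear !ffunE. Qed.

Lemma mu_tw_cons (E F H : tw A) (x : Defs.hom E F) (c : chain F H) :
  mu_tw (ccons x c) = \sum_(r <- iota 0 (rk E)) \sum_(d <- insertions c)
     mu_sum (ccat (delta_chain E r) (ccons x d)).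
Proof. by rewrite /mu_tw /= big_allpairs_dep. Qed.

Lemma mu_tw_linear_head (E F H : tw A) (c : chain F H) (r : K) (x y : Defs.hom E F) :
  mu_tw (ccons (r *: x + y) c) = r *: mu_tw (ccons x c) + mu_tw (ccons y c).
Proof.
rewrite !mu_tw_cons scaler_sumr -big_split /=; apply: eq_bigr => i _.
rewrite scaler_sumr -big_split /=; apply: eq_bigr => d _.
exact: mu_sum_linear.
Qed.

Lemma ccatA (E F G H : tw A) (c1 : chain E F) (c2 : chain F G) (c3 : chain G H) :
  ccat (ccat c1 c2) c3 = ccat c1 (ccat c2 c3).
Proof. by elim: c1 c2 => //= ? ? ? x c IH c2; rewrite IH. Qed.

Lemma mu_tw_linear_next (E F G H : tw A) (z : Defs.hom E F) (c : chain G H) (r : K)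
    (x y : Defs.hom F G) :
  mu_tw (ccons z (ccons (r *: x + y) c)) =
  r *: mu_tw (ccons z (ccons x c)) + mu_tw (ccons z (ccons y c)).
Proof.
rewrite !mu_tw_cons scaler_sumr -big_split /=; apply: eq_bigr => i _.
rewrite !big_allpairs_dep /= scaler_sumr -big_split /=; apply: eq_bigr => j _.
rewrite scaler_sumr -big_split /=; apply: eq_bigr => d _.
have H1 (u : Defs.hom F G) : ccat (delta_chain E i) (ccons z (ccat (delta_chain F j) (ccons u d)))
  = ccat (ccat (delta_chain E i) (ccons z (delta_chain F j))) (ccons u d).
  by rewrite ccatA.
by rewrite !H1 mu_sum_linear.
Qed.

Lemma skew_part_linear (E F : tw A) h : linear (@skew_part K A E F h).
Proof. by move=> r x y; apply/ffunP => t; rewrite !ffunE. Qed.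

Lemma act_hom_linear n m h : linear (@act_hom K A n m h).
Proof.
move=> r x y; apply/ffunP => t; case: h; rewrite !ffunE //= scaler_sumr -big_split.
by apply: eq_bigr => b _; rewrite !ffunE.
Qed.

Lemma skew_mu1_linear (E F : tw A) : linear (@skew_mu1 K A E F).
Proof.
move=> r x y; apply/ffunP => t; rewrite !ffunE.
by rewrite skew_part_linear mu_tw_linear_head !ffunE.
Qed.

Lemma skew_mu2_linearl (E F H : tw A) (x : skew_hom E F) :
  linear (fun y : skew_hom F H => skew_mu2 y x).
Proof.
move=> r y y'; apply/ffunP => t; rewrite !ffunE scaler_sumr -big_split /=.
apply: eq_bigr => k _; rewrite scaler_sumr -big_split /=; apply: eq_bigr => h _.
by rewrite skew_part_linear mu_tw_linear_next !ffunE.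
Qed.

Lemma skew_mu2_linearr (E F H : tw A) (y : skew_hom F H) :
  linear (fun x : skew_hom E F => skew_mu2 y x).
Proof.
move=> r x x'; apply/ffunP => t; rewrite !ffunE scaler_sumr -big_split /=.
apply: eq_bigr => k _; rewrite scaler_sumr -big_split /=; apply: eq_bigr => h _.
by rewrite skew_part_linear act_hom_linear mu_tw_linear_head !ffunE.
Qed.

Lemma kar_proj_linear (X Y : kar A) : linear (@kar_proj K A X Y).
Proof.
by move=> r x y; rewrite /kar_proj skew_mu2_linearl skew_mu2_linearr.
Qed.

HB.instance Definition _ (E F : tw A) :=
  GRing.isLinear.Build K (skew_hom E F) (skew_hom E F) *:%R (@skew_mu1 K A E F)
    (@skew_mu1_linear E F).
HB.instance Definition _ (X Y : kar A) :=
  GRing.isLinear.Build K (skew_hom (kar_tw X) (kar_tw Y))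
    (skew_hom (kar_tw X) (kar_tw Y)) *:%R (@kar_proj K A X Y)
    (@kar_proj_linear X Y).

End Linearity.

(** * Operations between two-term complexes over a Kronecker category *)

Section Words.
Variables (K : fieldType) (A : ainf K) (weight : mor A -> nat).

(** For a weight that counts the segments: an operation with at least three
    inputs needs at least two of them. *)
Definition short_mu : Prop := forall s : seq (mor A),
  (3 <= size s)%N -> (\sum_(a <- s) weight a <= 1)%N -> mu s = 0.

Hypothesis Hmu : short_mu.

(** Bounds the weight of a path of matrix entries by the height it climbs. *)
Definition upper n m (x : {ffun 'I_n * 'I_m * mor A -> K^o}) : Prop :=
  forall k l a, x (k, l, a) != 0 -> (k + weight a <= l)%N.

Fixpoint upper_chain (E F : tw A) (c : chain E F) : Prop :=
  match c with
  | cnil _ => True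
  | ccons _ _ _ x c' => upper x /\ upper_chain c'
  end.

Fixpoint chain_size (E F : tw A) (c : chain E F) : nat :=
  match c with cnil _ => 0 | ccons _ _ _ _ c' => (chain_size c').+1 end.

(** A path of matrix entries that ends in a complex with two terms has weight at
    most one. *)
Lemma mu_word_long (E F : tw A) (c : chain E F) (k : 'I_(rk E)) (l : 'I_(rk F))
    (w : seq (int * mor A)) :
  (rk F <= 2)%N -> upper_chain c -> (\sum_(y <- w) weight y.2 <= k)%N ->
  (3 <= size w + chain_size c)%N -> mu_word c k l w = 0.
Proof.
elim: c k l w => [{}E|{}E G {}F x c IH] k l w rkF /=.
  move=> _ wk sw; case: eqP => // _.
  rewrite addn0 in sw.
  have -> : mu [seq y.2 | y <- w] = 0; last by rewrite scaler0.
  apply: Hmu; rewrite ?size_map // big_map.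
  apply: leq_trans wk _.
  by move: (ltn_ord k); lia.
move=> [xup cup] wk sw; apply: big1 => k' _; apply: big1 => a _.
have [->|x0] := eqVneq (x (k, k', a)) 0; first by rewrite scale0r.
rewrite IH ?scaler0 //; last by rewrite size_rcons addSnnS.
rewrite -cats1 big_cat /= big_seq1 /=.
by apply: leq_trans (xup _ _ _ x0); rewrite leq_add2r.
Qed.

Lemma mu_sum_long (E F : tw A) (c : chain E F) :
  (rk F <= 2)%N -> upper_chain c -> (3 <= chain_size c)%N -> mu_sum c = 0.
Proof.
move=> rkF cup c3; apply/ffunP => t; rewrite ffunE mu_word_long ?big_nil //.
by rewrite !ffunE.
Qed.
End Words.

(** The Kronecker quiver with vertices X and Y, fixed by the group, and arrows
    [c] and [gmor c], exchanged by the group. The arrows are enumerated by a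
    boolean so that both are treated by the same lemmas. *)
Record kronecker (K : fieldType) (A : ainf K) (X Y : obj A) (c : mor A) (d : int)
    (weight : mor A -> nat) : Prop := Kronecker {
  kron_neq : X <> Y;
  kron_gX : gobj X = X;
  kron_gY : gobj Y = Y;
  kron_arr : c <> gmor c;
  kron_gg : gmor (gmor c) = c;
  kron_g1X : gmor (Defs.one X) = Defs.one X;
  kron_g1Y : gmor (Defs.one Y) = Defs.one Y;
  kron_1X : src (Defs.one X) = X /\ tgt (Defs.one X) = X;
  kron_1Y : src (Defs.one Y) = Y /\ tgt (Defs.one Y) = Y;
  kron_c : forall b : bool, src (iter b (@gmor K A) c) = X /\ tgt (iter b (@gmor K A) c) = Y;
  kron_XX : forall a, src a = X -> tgt a = X -> a = Defs.one X;
  kron_YY : forall a, src a = Y -> tgt a = Y -> a = Defs.one Y;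
  kron_XY : forall a, src a = X -> tgt a = Y -> a = c \/ a = gmor c;
  kron_YX : forall a, src a = Y -> tgt a <> X;
  kron_deg1X : deg (Defs.one X) = 0;
  kron_deg1Y : deg (Defs.one Y) = 0;
  kron_degc : forall b : bool, deg (iter b (@gmor K A) c) = d;
  kron_w1X : weight (Defs.one X) = 0%N;
  kron_w1Y : weight (Defs.one Y) = 0%N;
  kron_wc : forall b : bool, weight (iter b (@gmor K A) c) = 1%N;
  kron_mu0 : @mu K A [::] = 0;
  kron_mu1 : forall a : mor A, mu [:: a] = 0;
  kron_mu11X : forall a, mu [:: Defs.one X; Defs.one X] a = (a == Defs.one X)%:R;
  kron_mu11Y : forall a, mu [:: Defs.one Y; Defs.one Y] a = (a == Defs.one Y)%:R;
  kron_mu1c : forall (b : bool) a, mu [:: Defs.one X; iter b (@gmor K A) c] a = (a == iter b (@gmor K A) c)%:R;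
  kron_muc1 : forall (b : bool) a, mu [:: iter b (@gmor K A) c; Defs.one Y] a =
     (-1) ^ d * (a == iter b (@gmor K A) c)%:R;
  kron_long : short_mu weight }.

Section Kron.
Variables (K : fieldType) (A : ainf K) (X Y : obj A) (c : mor A) (d : int)
    (weight : mor A -> nat) (HK : kronecker X Y c d weight).
Local Notation vect := {ffun 'I_2 * 'I_2 * mor A -> K^o}.
Local Notation arr b := (iter (nat_of_bool b) (@gmor K A) c).

(** The argument of [w] is the group element that carries [c] to the arrow: the
    group then acts on [w] by translations ([act_hom_elt]). *)
Definition elt (u v : K) (w : bool -> K) : vect :=
  [ffun t : 'I_2 * 'I_2 * mor A =>
     if t.1.1 == ord0 then
       if t.1.2 == ord0 then u * (t.2 == Defs.one X)%:R
       else w false * (t.2 == c)%:R + w true * (t.2 == gmor c)%:R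
     else if t.1.2 == ord0 then 0 else v * (t.2 == Defs.one Y)%:R].

Lemma ord2P (k : 'I_2) : k = ord0 \/ k = ord_max.
Proof. by case: k => [[|[|k]] Hk] //; [left|right]; apply/val_inj. Qed.

Lemma upper_elt u v w : upper weight (elt u v w).
Proof.
move=> k l a; rewrite ffunE /=.
have [->|->] := ord2P k; have [->|->] := ord2P l; rewrite /= ?eqxx //.
- by have [->|] := eqVneq a (Defs.one X); rewrite ?(kron_w1X HK) ?mulr0 ?eqxx.
- have [->|_] := eqVneq a c; first by rewrite (kron_wc HK false).
  have [->|_] := eqVneq a (gmor c); first by rewrite (kron_wc HK true).
  by rewrite !mulr0 addr0 eqxx.
- by have [->|] := eqVneq a (Defs.one Y); rewrite ?(kron_w1Y HK) ?mulr0 ?eqxx.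
Qed.

Lemma sum_delta (V : lmodType K) (a0 : mor A) (r : K) (f : mor A -> V) :
  \sum_a (r * (a == a0)%:R) *: f a = r *: f a0.
Proof.
rewrite (bigD1 a0) //= eqxx mulr1 big1 ?addr0 // => a /negbTE ->.
by rewrite mulr0 scale0r.
Qed.

Lemma sum_elt0 (V : lmodType K) u v w (f : 'I_2 -> mor A -> V) :
  \sum_(k < 2) \sum_a elt u v w (ord0, k, a) *: f k a =
  u *: f ord0 (Defs.one X) + (w false *: f ord_max (arr false) + w true *: f ord_max (arr true)).
Proof.
rewrite big_ord_recl big_ord_recl big_ord0 addr0; congr (_ + _).
  by rewrite -(sum_delta (Defs.one X) u (f ord0)); apply: eq_bigr => a _; rewrite ffunE.
have -> : lift ord0 ord0 = ord_max :> 'I_2 by apply/val_inj.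
rewrite -(sum_delta (arr false)) -(sum_delta (arr true)) -big_split /=.
by apply: eq_bigr => a _; rewrite ffunE /= scalerDl.
Qed.

Lemma sum_elt1 (V : lmodType K) u v w (f : 'I_2 -> mor A -> V) :
  \sum_(k < 2) \sum_a elt u v w (ord_max, k, a) *: f k a = v *: f ord_max (Defs.one Y).
Proof.
rewrite big_ord_recl big_ord_recl big_ord0 addr0.
rewrite big1 ?add0r; last by move=> a _; rewrite ffunE /= scale0r.
have -> : lift ord0 ord0 = ord_max :> 'I_2 by apply/val_inj.
by rewrite -(sum_delta (Defs.one Y) v (f ord_max)); apply: eq_bigr => a _; rewrite ffunE.
Qed.

Lemma mu_sum1 (E F : tw A) (x : Defs.hom E F) : mu_sum (ccons x (cnil F)) = 0.
Proof.
apply/ffunP => t; rewrite !ffunE /=; rewrite big1 ?ffunE // => k _.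
rewrite big1 // => a _; case: eqP => _; last by rewrite scaler0.
by rewrite /= (kron_mu1 HK) !scaler0.
Qed.

(** No two arrows are composable, so each term has an identity as a factor. The
    signs are the Koszul signs of the shifts, times the sign of [mu] if the first
    factor is an arrow. *)
Lemma mu_sum2 (oE oF oH : 'I_2 -> obj A) (e f h : 'I_2 -> int) dE dF dH u v w u' v' w' :
  mu_sum (@ccons K A (Tw oE e dE) (Tw oF f dF) (Tw oH h dH) (elt u v w)
         (@ccons K A (Tw oF f dF) (Tw oH h dH) (Tw oH h dH) (elt u' v' w') (cnil _))) =
  elt (u * u' * (-1) ^ (f ord0 - e ord0))
      (v * v' * (-1) ^ (f ord_max - e ord_max))
      (fun b => u * w' b * (-1) ^ (- (f ord0 - e ord0) * (d - 1)) +
                w b * v' * (-1) ^ (f ord_max - e ord0 + d)).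
Proof.
apply/ffunP => [[[k l] a]]; rewrite [LHS]ffunE /=.
have [->|->] := ord2P k; last first.
  rewrite sum_elt1 sum_elt1.
  have [->|->] := ord2P l; rewrite [RHS]ffunE /=; first by rewrite !scaler0 ffunE.
  rewrite !ffunE /= (kron_mu11Y HK) /= !big_cons !big_nil (kron_deg1Y HK).
  rewrite /GRing.scale /= !mulr0 !addr0 sub0r mulrN1 opprK.
  by ring.
rewrite sum_elt0 sum_elt0 !sum_elt1.
have [->|->] := ord2P l; rewrite [RHS]ffunE /=.
  rewrite !scaler0 !addr0 !ffunE /= (kron_mu11X HK) !big_cons !big_nil (kron_deg1X HK).
  by rewrite /GRing.scale /= !mulr0 !addr0 sub0r mulrN1 opprK; ring.
rewrite !scaler0 add0r !ffunE /=.
rewrite (kron_mu1c HK false) (kron_mu1c HK true) (kron_muc1 HK false) (kron_muc1 HK true).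
rewrite !big_cons !big_nil (kron_deg1Y HK) (kron_degc HK true) (kron_degc HK false).
rewrite /GRing.scale /= !mulr0 !addr0 sub0r mulrN1 opprK.
rewrite !expfzDr ?oppr_eq0 ?oner_eq0 //.
by ring.
Qed.
End Kron.

Section Kron.
Variables (K : fieldType) (A : ainf K) (X Y : obj A) (c : mor A) (d : int)
    (weight : mor A -> nat) (HK : kronecker X Y c d weight).
Local Notation arr b := (iter (nat_of_bool b) (@gmor K A) c).
Local Notation elt := (@elt K A X Y c).

Lemma eltD u v w u' v' w' :
  elt u v w + elt u' v' w' = elt (u + u') (v + v') (fun b => w b + w' b).
Proof.
apply/ffunP => t; rewrite !ffunE; case: ifP => _; case: ifP => _; ring.
Qed.

Lemma eq_elt u v w u' v' w' :
  u = u' -> v = v' -> w =1 w' -> elt u v w = elt u' v' w'.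
Proof.
by move=> -> -> E; apply/ffunP => t; rewrite !ffunE !E.
Qed.

Lemma sum_gmor (a0 a : mor A) (r : K) :
  \sum_(b | gmor b == a) r * (b == a0)%:R = r * (a == gmor a0)%:R.
Proof.
rewrite big_mkcond (bigD1 a0) //= eqxx big1 ?addr0 => [|b /negbTE ->].
  by rewrite eq_sym; case: eqP; rewrite ?mulr0 ?mulr1.
by rewrite mulr0; case: ifP.
Qed.

Lemma act_hom_elt h u v w :
  act_hom h (elt u v w) = elt u v (fun b => w (b (+) h)).
Proof.
case: h; last by apply: eq_elt => // b; rewrite addbF.
apply/ffunP => -[[k l] a]; rewrite ffunE /= [RHS]ffunE /=.
under eq_bigr do rewrite ffunE /=.
case: ifP => _; case: ifP => _.
- by rewrite sum_gmor (kron_g1X HK).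
- by rewrite big_split /= !sum_gmor (kron_gg HK) addrC.
- by rewrite big1.
- by rewrite sum_gmor (kron_g1Y HK).
Qed.

(** The differential can be inserted on one side only: with both insertions the
    word is too long. *)
Lemma mu_tw1 (oE oF : 'I_2 -> obj A) (e f : 'I_2 -> int) dE dF wE wF u v w :
  dE = elt 0 0 wE -> dF = elt 0 0 wF ->
  mu_tw (@ccons K A (Tw oE e dE) (Tw oF f dF) _ (elt u v w) (cnil _)) =
  elt 0 0 (fun b => u * wF b * (-1) ^ (- (f ord0 - e ord0) * (d - 1)) +
                    wE b * v * (-1) ^ (e ord_max - e ord0 + d)).
Proof.
move=> -> ->; rewrite mu_tw_cons /= !big_cons !big_nil /= ?big_cons ?big_nil.
rewrite (mu_sum1 HK) (mu_sum2 HK) (mu_sum2 HK) (mu_sum_long (kron_long HK)) //=; last first.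
  by split; [exact: upper_elt HK _ _ _|split; [exact: upper_elt HK _ _ _|split=> //; exact: upper_elt HK _ _ _]].
rewrite !addr0 add0r eltD.
by apply: eq_elt => [||b]; rewrite !(mul0r, mulr0, addr0, add0r).
Qed.

Lemma mu_tw2 (oE oF oH : 'I_2 -> obj A) (e f h : 'I_2 -> int) dE dF dH wE wF wH u v w u' v' w' :
  dE = elt 0 0 wE -> dF = elt 0 0 wF -> dH = elt 0 0 wH ->
  mu_tw (@ccons K A (Tw oE e dE) (Tw oF f dF) (Tw oH h dH) (elt u v w)
         (@ccons K A (Tw oF f dF) (Tw oH h dH) (Tw oH h dH) (elt u' v' w') (cnil _))) =
  elt (u * u' * (-1) ^ (f ord0 - e ord0))
      (v * v' * (-1) ^ (f ord_max - e ord_max))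
      (fun b => u * w' b * (-1) ^ (- (f ord0 - e ord0) * (d - 1)) +
                w b * v' * (-1) ^ (f ord_max - e ord0 + d)).
Proof.
move=> -> -> ->; rewrite mu_tw_cons /= !big_cons !big_nil /= ?big_cons ?big_nil.
apply: etrans (mu_sum2 HK oE oF oH e f h _ _ _ u v w u' v' w').
have up x y z : upper weight (elt x y z) by move=> k l a; apply: (upper_elt HK).
have addr_0 (a b : Defs.hom (Tw oE e (elt 0 0 wE)) (Tw oH h (elt 0 0 wH))) : a = 0 -> b = 0 -> a + b = 0.
  by move=> -> ->; rewrite addr0.
rewrite -[RHS]addr0 -!addrA; congr (_ + _).
repeat refine (addr_0 _ _ _ _).
all: first [reflexivity | apply: (mu_sum_long (kron_long HK)) => //=].
all: by repeat match goal with |- _ /\ _ => split end; try exact: up.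
Qed.

Definition selt (u v : bool -> K) (w : bool -> bool -> K) :
    {ffun bool * ('I_2 * 'I_2 * mor A) -> K^o} :=
  [ffun t => elt (u t.1) (v t.1) (w t.1) t.2].

Definition ktw (e : 'I_2 -> int) w :=
  @Tw K A 2 (fun k => if k == ord0 then X else Y) e (elt 0 0 w).

Lemma eq_selt u v w u' v' w' :
  u =1 u' -> v =1 v' -> w =2 w' -> selt u v w = selt u' v' w'.
Proof.
move=> E1 E2 E3; apply/ffunP => t; rewrite !ffunE.
by rewrite E1 E2 !E3.
Qed.

Lemma skew_part_selt e wE f wF h u v w :
  @skew_part K A (ktw e wE) (ktw f wF) h (selt u v w) = elt (u h) (v h) (w h).
Proof. by apply/ffunP => t; rewrite !ffunE. Qed.

Lemma skew_mu1_selt e wE f wF u v w :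
  @skew_mu1 K A (ktw e wE) (ktw f wF) (selt u v w) =
  selt (fun=> 0) (fun=> 0) (fun h b =>
    u h * wF b * (-1) ^ (- (f ord0 - e ord0) * (d - 1)) +
    wE (b (+) h) * v h * (-1) ^ (e ord_max - e ord0 + d)).
Proof.
apply/ffunP => -[h t]; rewrite [LHS]ffunE [RHS]ffunE.
rewrite skew_part_selt.
rewrite (@mu_tw1 _ _ _ _ _ _ (fun b => wE (b (+) h)) wF) //.
exact: act_hom_elt.
Qed.

Lemma skew_mu2_selt e wE f wF g wH u v w u' v' w' :
  @skew_mu2 K A (ktw e wE) (ktw f wF) (ktw g wH)
     (selt u' v' w') (selt u v w) =
  selt (fun t => \sum_(k : bool) u (k (+) t) * u' k * (-1) ^ (f ord0 - e ord0))
       (fun t => \sum_(k : bool) v (k (+) t) * v' k * (-1) ^ (f ord_max - e ord_max))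
       (fun t b => \sum_(k : bool)
          (u (k (+) t) * w' k b * (-1) ^ (- (f ord0 - e ord0) * (d - 1)) +
           w (k (+) t) (b (+) k) * v' k * (-1) ^ (f ord_max - e ord0 + d))).
Proof.
apply/ffunP => -[h t]; rewrite [LHS]ffunE [RHS]ffunE /=.
have E k : \sum_(h0 : bool | k (+) h0 == h)
     mu_tw (@ccons K A (act_tw k (act_tw h0 (ktw e wE))) (act_tw k (ktw f wF)) (ktw g wH)
              (act_hom k (@skew_part K A (ktw e wE) (ktw f wF) h0 (selt u v w))) (ccons (@skew_part K A (ktw f wF) (ktw g wH) k (selt u' v' w')) (cnil (ktw g wH))))
       t =
   elt (u (k (+) h) * u' k * (-1) ^ (f ord0 - e ord0))
       (v (k (+) h) * v' k * (-1) ^ (f ord_max - e ord_max))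
       (fun b => 
          (u (k (+) h) * w' k b * (-1) ^ (- (f ord0 - e ord0) * (d - 1)) +
           w (k (+) h) (b (+) k) * v' k * (-1) ^ (f ord_max - e ord0 + d))) t.
  rewrite (bigD1 (k (+) h)) ?addbA ?addbb //= big1 ?addr0; last first.
    by move=> h0 /andP[/eqP <-]; rewrite addbA addbb eqxx.
  rewrite !skew_part_selt act_hom_elt.
  rewrite (@mu_tw2 _ _ _ _ _ _ _ _ _ (fun b => wE (b (+) k (+) (k (+) h))) (fun b => wF (b (+) k)) wH) //.
    by rewrite /= !act_hom_elt.
  exact: act_hom_elt.
under eq_bigr do rewrite E.
rewrite [LHS]big_bool /=.
set a := elt _ _ _; set b := elt _ _ _.
have -> : a t + b t = (a + b) t by rewrite !ffunE.
by rewrite eltD; congr (fun_of_fin _ t); apply: eq_elt => [||b']; rewrite big_bool.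
Qed.

End Kron.

(** * Morphisms of given degree *)

Section Homog.
Variables (K : fieldType) (A : ainf K).

(** A span of basis vectors consists of the vectors supported on this part of the
    basis. *)
Lemma mem_skew_homog (E F : tw A) m (x : skew_hom E F) :
  x \in skew_homog E F m <-> (forall t, x t != 0 -> skew_degb m t).
Proof.
split=> [xm t|Hx].
  pose out (y : skew_hom E F) : skew_hom E F :=
    [ffun t => if skew_degb m t then 0 else y t].
  have out_lin : linear out.
    by move=> r y z; apply/ffunP => u; rewrite !ffunE; case: ifP; rewrite ?scaler0 ?addr0.
  pose outM := GRing.isLinear.Build K (skew_hom E F) (skew_hom E F) *:%R out out_lin.
  pose outL : {linear skew_hom E F -> skew_hom E F} := HB.pack out outM.
  have sub : (skew_homog E F m <= lker (linfun outL))%VS.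
    apply/span_subvP => y /mapP[u]; rewrite mem_enum => um ->.
    rewrite memv_ker lfunE /=; apply/eqP/ffunP => v; rewrite !ffunE.
    by case: ifPn => // vm; case: eqP => // vu; rewrite vu [skew_degb _ _]um in vm.
  have := subvP sub _ xm; rewrite memv_ker lfunE /= => /eqP/ffunP/(_ t).
  by rewrite !ffunE; case: ifP => // _ ->; rewrite eqxx.
have -> : x = \sum_(t : skew_basis E F) (x t : K) *: skew_delta t.
  apply/ffunP => t; rewrite sum_ffunE (bigD1 t) //= big1 ?addr0.
    by rewrite !ffunE eqxx /GRing.scale /= mulr1.
  by move=> u ut; rewrite !ffunE eq_sym (negbTE ut) /GRing.scale /= mulr0.
apply: rpred_sum => t _.
have [->|xt] := eqVneq (x t) 0; first by rewrite scale0r rpred0.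
apply: rpredZ; apply: memv_span; apply: map_f; rewrite mem_enum; exact: Hx.
Qed.
End Homog.

Section Kron.
Variables (K : fieldType) (A : ainf K) (X Y : obj A) (c : mor A) (d : int)
    (weight : mor A -> nat) (HK : kronecker X Y c d weight).
Local Notation arr b := (iter (nat_of_bool b) (@gmor K A) c).
Local Notation elt := (@elt K A X Y c).
Local Notation selt := (@selt K A X Y c).
Local Notation ktw := (@ktw K A X Y c).

Lemma act_obj_ktw e w h k : act_obj h (tob (t := ktw e w) k) = if k == ord0 then X else Y.
Proof.
by rewrite /act_obj /=; case: h => //; case: ifP; rewrite ?(kron_gX HK) ?(kron_gY HK).
Qed.

(** Sources and targets exclude all other matrix entries, and the degree decides
    which of u, v, w may be nonzero. *)
Lemma homog_selt e wE f wF m (x : skew_hom (ktw e wE) (ktw f wF)) :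
  x \in skew_homog (ktw e wE) (ktw f wF) m ->
  exists u v w, [/\ x = selt u v w,
    (m != - (f ord0 - e ord0) -> u =1 fun=> 0),
    (m != - (f ord_max - e ord_max) -> v =1 fun=> 0) &
    (m != d - (f ord_max - e ord0) -> w =2 fun _ _ => 0)].
Proof.
move=> /mem_skew_homog Hx.
exists (fun h => x (h, (ord0, ord0, Defs.one X))), (fun h => x (h, (ord_max, ord_max, Defs.one Y))),
  (fun h b => x (h, (ord0, ord_max, arr b))).
have x0 t : ~~ skew_degb m t -> x t = 0 by move=> Ht; apply/eqP; apply: contraNT Ht; exact: Hx.
split; last 3 first.
- move=> Hm h; apply: x0; rewrite /skew_degb (kron_deg1X HK) sub0r.
  by rewrite /= (eq_sym _ m) (negbTE Hm) !andbF.
- move=> Hm h; apply: x0; rewrite /skew_degb (kron_deg1Y HK) sub0r.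
  by rewrite /= (eq_sym _ m) (negbTE Hm) !andbF.
- move=> Hm h b; apply: x0; rewrite /skew_degb (kron_degc HK).
  by rewrite /= (eq_sym _ m) (negbTE Hm) !andbF.
apply/ffunP => -[h [[k l] a]]; rewrite !ffunE /=.
have XY := kron_neq HK.
have [->|->] := ord2P k; have [->|->] := ord2P l; rewrite /= ?eqxx.
- have [->|ne] := eqVneq a (Defs.one X); first by rewrite mulr1.
  rewrite mulr0; apply: x0; apply/negP; rewrite /skew_degb act_obj_ktw /= => /and3P[/eqP s /eqP t _].
  by rewrite (kron_XX HK s t) eqxx in ne.
- have cg := kron_arr HK.
  have [->|ne] := eqVneq a c.
    by rewrite mulr1 (_ : (c == gmor c) = false) ?mulr0 ?addr0 //; apply/eqP.
  have [->|ne'] := eqVneq a (gmor c); first by rewrite mulr0 add0r mulr1.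
  rewrite !mulr0 addr0; apply: x0; apply/negP; rewrite /skew_degb act_obj_ktw /= => /and3P[/eqP s /eqP t _].
  by case: (kron_XY HK s t) => E; rewrite E eqxx in ne ne'.
- apply: x0; apply/negP; rewrite /skew_degb act_obj_ktw /= => /and3P[/eqP s /eqP t _].
  exact: (kron_YX HK s t).
- have [->|ne] := eqVneq a (Defs.one Y); first by rewrite mulr1.
  rewrite mulr0; apply: x0; apply/negP; rewrite /skew_degb act_obj_ktw /= => /and3P[/eqP s /eqP t _].
  by rewrite (kron_YY HK s t) eqxx in ne.
Qed.

Lemma selt_homog e wE f wF m u v w :
  (m = - (f ord0 - e ord0) \/ u =1 (fun=> 0)) ->
  (m = - (f ord_max - e ord_max) \/ v =1 fun=> 0) ->
  (m = d - (f ord_max - e ord0) \/ w =2 fun _ _ => 0) ->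
  selt u v w \in skew_homog (ktw e wE) (ktw f wF) m.
Proof.
move=> Hu Hv Hw; apply/mem_skew_homog => -[h [[k l] a]].
rewrite /skew_degb act_obj_ktw /= !ffunE /=.
have [->|->] := ord2P k; have [->|->] := ord2P l; rewrite /= ?eqxx //.
- case: (eqVneq a (Defs.one X)) => [->|_]; last by rewrite mulr0 eqxx.
  case: Hu => [->|->]; last by rewrite mul0r eqxx.
  by rewrite (kron_deg1X HK) sub0r (kron_1X HK).1 (kron_1X HK).2 !eqxx.
- case: Hw => [->|E]; last by rewrite !E !mul0r addr0 eqxx.
  have [sc tc] := kron_c HK false; have [sg tg] := kron_c HK true.
  case: (eqVneq a c) => [->|_].
    by rewrite [src _]sc [tgt _]tc (kron_degc HK false) !eqxx.
  case: (eqVneq a (gmor c)) => [->|_]; last by rewrite !mulr0 addr0 eqxx.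
  by rewrite [src _]sg [tgt _]tg (kron_degc HK true) !eqxx.
- case: (eqVneq a (Defs.one Y)) => [->|_]; last by rewrite mulr0 eqxx.
  case: Hv => [->|->]; last by rewrite mul0r eqxx.
  by rewrite (kron_deg1Y HK) sub0r (kron_1Y HK).1 (kron_1Y HK).2 !eqxx.
Qed.

(** The Maurer-Cartan equation for two terms reduces to the vanishing of [mu] on
    words of length at most one. *)
Lemma ktw_twisted e w : e ord_max - e ord0 = d - 1 -> is_twisted (ktw e w).
Proof.
move=> He; split=> [k l a|].
  rewrite ffunE /=.
  have [->|->] := ord2P k; have [->|->] := ord2P l; rewrite /= ?mul0r ?eqxx //.
  have [sc tc] := kron_c HK false; have [sg tg] := kron_c HK true.
  case: (eqVneq a c) => [->|_].
    by rewrite He (kron_degc HK false); split=> //; rewrite opprB addrC subrK.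
  case: (eqVneq a (gmor c)) => [->|_]; last by rewrite !mulr0 addr0 eqxx.
  by rewrite He (kron_degc HK true); split=> //; rewrite opprB addrC subrK.
rewrite /mu_tw /= big_cons big_seq1 (mu_sum1 HK) addr0.
apply/ffunP => t; rewrite !ffunE /=; case: eqP => _; last by rewrite ffunE.
by rewrite (kron_mu0 HK) scaler0 ffunE.
Qed.

End Kron.

(** * Morphisms between the direct summands *)

Section HomDim.
Variables (K : fieldType) (A : ainf K).

Lemma dim_image_eq0 (U V : kar A) :
  (forall x, x \in cocycles (kar_tw U) (kar_tw V) ->
     kar_proj x \in coboundaries (kar_tw U) (kar_tw V)) ->
  kar_hom_dim U V = 0%N.
Proof.
move=> H; rewrite /kar_hom_dim.
set B := coboundaries _ _; set W := (_ @: _)%VS.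
suff /addv_idPr -> : (W <= B)%VS by rewrite subnn.
by apply/subvP => _ /memv_imgP[x xc ->]; rewrite lfunE /=; apply: H.
Qed.

Lemma dim_image_eq1 (U V : kar A) (x0 : skew_hom (kar_tw U) (kar_tw V)) :
  x0 \in cocycles (kar_tw U) (kar_tw V) ->
  kar_proj x0 \notin coboundaries (kar_tw U) (kar_tw V) ->
  (forall x, x \in cocycles (kar_tw U) (kar_tw V) ->
     exists r : K, kar_proj (x - r *: x0)
         \in coboundaries (kar_tw U) (kar_tw V)) ->
  kar_hom_dim U V = 1%N.
Proof.
move=> c0 nB H; rewrite /kar_hom_dim.
pose p := linfun (@kar_proj K A U V); rewrite -/p.
have pE x : p x = kar_proj x by rewrite lfunE.
set B := coboundaries _ _; set W := (_ @: _)%VS.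
have -> : (W + B = <[p x0]> + B)%VS.
  apply/eqP; rewrite eqEsubv !subv_add !addvSr !andbT; apply/andP; split.
    apply/subvP => _ /memv_imgP[x xc ->].
    have [r Hr] := H _ xc.
    have -> : p x = r *: p x0 + p (x - r *: x0) by rewrite linearB linearZ addrC subrK.
    by rewrite memv_add ?memvZ ?memv_line // pE.
  by apply: subv_trans (addvSl _ _); rewrite -memvE memv_img.
have pB : p x0 \notin B by rewrite pE.
rewrite dimv_disjoint_sum ?dim_vline.
  have -> : p x0 != 0 by apply: contraNneq pB => ->; rewrite rpred0.
  by rewrite addnK.
apply/eqP; rewrite -subv0; apply/subvP => y; rewrite memv_cap => /andP[/vlineP[r ->] rB].
have [->|r0] := eqVneq r 0; first by rewrite scale0r mem0v.
by case/negP: pB; rewrite -(scalerK r0 (p x0)) memvZ.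
Qed.

End HomDim.

Section Kron.
Variables (K : fieldType) (A : ainf K) (X Y : obj A) (c : mor A) (d : int)
    (weight : mor A -> nat) (HK : kronecker X Y c d weight).
Hypothesis two0 : 2%:R != 0 :> K.
Variables (e : 'I_2 -> int) (He : e ord_max - e ord0 = d - 1).
Local Notation arr b := (iter (nat_of_bool b) (@gmor K A) c).
Local Notation elt := (@elt K A X Y c).
Local Notation selt := (@selt K A X Y c).
Local Notation ktw := (@ktw K A X Y c).

(** The coefficients of [al c + gc]. *)
Definition arrows_coef (al : K) (b : bool) : K := if b then 1 else al.
(** The coefficients of the idempotent [(1 + s g) / 2] of the group algebra. *)
Definition half_char (s : K) (h : bool) : K := (if h then s else 1) / 2%:R.
Local Notation is_sign s := (s = 1 \/ s = -1).

(** The double tagged object with its signs absorbed: [s] stands for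
    eps_P (-1)^p and [t] for eps_Q (-1)^(q - 1) ([B_epsE]). *)
Definition kkar (s t : K) : kar A :=
  @Kar K A (ktw e (arrows_coef (s * t))) (selt (half_char s) (half_char t) (fun _ _ => 0)).

Local Notation N1 n := ((-1) ^ (n : int) : K).
Lemma signzD m n : N1 (m + n) = N1 m * N1 n.
Proof. by rewrite expfzDr // oppr_eq0 oner_eq0. Qed.

Lemma signz_sq n : N1 n * N1 n = 1.
Proof. by rewrite -expfzMl mulrNN mulr1 exp1rz. Qed.

Lemma signzN n : N1 (- n) = N1 n.
Proof.
have N0 : N1 n != 0 by rewrite expfz_neq0 // oppr_eq0 oner_eq0.
by apply: (mulIf N0); rewrite signz_sq -signzD addNr expr0z.
Qed.

Lemma skew_mu1_kkar n s t s' t' u v w :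
  @skew_mu1 K A (kar_tw (kkar s t)) (kar_tw (kar_shift n (kkar s' t'))) (selt u v w) =
  selt (fun=> 0) (fun=> 0) (fun h b =>
    u h * arrows_coef (s' * t') b * N1 (n * (d - 1)) - arrows_coef (s * t) (b (+) h) * v h).
Proof.
rewrite -[kar_tw (kar_shift _ _)]/(ktw (fun k => e k + n) (arrows_coef (s' * t'))).
rewrite (skew_mu1_selt HK); apply: eq_selt => // h b.
rewrite (addrC (e ord0)) addrK He; congr (_ + _).
  by rewrite mulNr signzN.
have -> : d - 1 + d = (d + d) - 1 by ring.
by rewrite !signzD signz_sq signzN; ring.
Qed.

(** Composition with the idempotents convolves functions on the group with
    characters: of u only the part of type [s] survives, and only if [s = s'], of
    v the part of type [t], if [t = t'], and of w the part of bidegree [(s, t')]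
    under translations on both sides. *)
Lemma kar_proj_kkar n s t s' t' u v w :
  @kar_proj K A (kkar s t) (kar_shift n (kkar s' t')) (selt u v w) =
  selt (fun h => \sum_(k : bool) (\sum_(j : bool) half_char s (j (+) (k (+) h)) * u j) * half_char s' k * N1 n)
    (fun h => \sum_(k : bool) (\sum_(j : bool) half_char t (j (+) (k (+) h)) * v j) * half_char t' k * N1 n)
    (fun h b => \sum_(k : bool) (\sum_(j : bool) half_char s (j (+) (k (+) h)) * w j (b (+) k)) * half_char t' k
         * N1 (n - 1)).
Proof.
rewrite /kar_proj -[kar_tw (kar_shift _ _)]/(ktw (fun k => e k + n) (arrows_coef (s' * t'))).
rewrite (skew_mu2_selt HK) (skew_mu2_selt HK).
have E1 : e ord0 + n - e ord0 = n by ring.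
have E2 : e ord_max + n - e ord_max = n by ring.
have E3 : e ord_max + n - e ord0 + d = n - 1 + (d + d).
  have -> : e ord_max + n - e ord0 + d = (e ord_max - e ord0) + (n + d) by ring.
  by rewrite He; ring.
have E4 : N1 (e ord_max + n - e ord0 + d) = N1 (n - 1).
  by rewrite E3 (signzD (n - 1)) (signzD d) signz_sq mulr1.
rewrite E1 E2 E4 !subrr !expr0z oppr0 mul0r expr0z.
apply: eq_selt => [h|h|h b]; apply: eq_bigr => k _.
- by congr (_ * _ * _); apply: eq_bigr => j _; rewrite mulr1.
- by congr (_ * _ * _); apply: eq_bigr => j _; rewrite mulr1.
- rewrite mulr0 mul0r add0r; congr (_ * _ * _); apply: eq_bigr => j _.
  by rewrite mul0r mul0r addr0 mulr1.
Qed.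

Lemma selt0 : selt (fun=> 0) (fun=> 0) (fun _ _ => 0) = 0.
Proof.
by apply/ffunP => t; rewrite !ffunE !mul0r addr0; case: ifP; case: ifP.
Qed.

Lemma selt_eq0 u v w :
  u =1 (fun=> 0) -> v =1 (fun=> 0) -> w =2 (fun _ _ => 0) -> selt u v w = 0.
Proof. by move=> Hu Hv Hw; rewrite -selt0; apply: eq_selt. Qed.

Lemma kkar_is_kar s t : is_sign s -> is_sign t -> is_kar (kkar s t).
Proof.
move=> hs ht; split; first exact: (ktw_twisted HK).
- rewrite memv_cap (selt_homog HK) ?subrr; [|by left|by left|by right].
  rewrite memv_ker lfunE /= (skew_mu1_selt HK); apply/eqP.
  rewrite -selt0; apply: eq_selt => // h b.
  rewrite subrr oppr0 mul0r expr0z He (_ : d - 1 + d = (d + d) - 1); last by ring.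
  rewrite !signzD signz_sq signzN /half_char /arrows_coef.
  by case: hs => ->; case: ht => ->; case: h; case: b => /=; ring.
- have -> : skew_mu2 (kar_idem (kkar s t)) (kar_idem (kkar s t)) = kar_idem (kkar s t).
    rewrite (skew_mu2_selt HK) !subrr !expr0z; apply: eq_selt => [h|h|h b].
    + rewrite big_bool /half_char /=.
      by case: hs => ->; case: h => /=; field.
    + rewrite big_bool /half_char /=.
      by case: ht => ->; case: h => /=; field.
    + by rewrite big1 // => k _; rewrite mulr0 !mul0r addr0.
  by rewrite subrr rpred0.
Qed.

Lemma selt_arrE u v w h (b : bool) : selt u v w (h, (ord0, ord_max, arr b)) = w h b.
Proof.
rewrite !ffunE /=; have := kron_arr HK; case: b => /= ne.
  by rewrite eqxx eq_sym (introF eqP ne) mulr0 add0r mulr1.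
by rewrite eqxx (introF eqP ne) mulr0 addr0 mulr1.
Qed.

Section HomDim.
Variables (s t s' t' : K).
Hypotheses (hs : is_sign s) (ht : is_sign t) (hs' : is_sign s') (ht' : is_sign t').
Local Notation U := (kkar s t).
Local Notation V n := (kar_shift n (kkar s' t')).

(** The equation says that the diagonal part intertwines the differentials. *)
Lemma cocycleP n x : x \in cocycles (kar_tw U) (kar_tw (V n)) ->
  exists u v w, [/\ x = selt u v w,
    (n != 0 -> u =1 fun=> 0), (n != 0 -> v =1 fun=> 0), (n != 1 -> w =2 fun _ _ => 0) &
    forall h b, u h * arrows_coef (s' * t') b * N1 (n * (d - 1)) = arrows_coef (s * t) (b (+) h) * v h].
Proof.
rewrite memv_cap => /andP[/(@homog_selt _ _ _ _ _ _ _ HK e _ (fun k => e k + n))[u [v [w [-> Hu Hv Hw]]]] Hk].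
have E1 : - (e ord0 + n - e ord0) = - n by ring.
have E2 : - (e ord_max + n - e ord_max) = - n by ring.
have E3 : d - (e ord_max + n - e ord0) = 1 - n.
  have -> : e ord_max + n - e ord0 = (e ord_max - e ord0) + n by ring.
  by rewrite He; ring.
exists u, v, w; split=> //.
- by move=> n0; apply: Hu; rewrite E1 eq_sym oppr_eq0.
- by move=> n0; apply: Hv; rewrite E2 eq_sym oppr_eq0.
- by move=> n0; apply: Hw; rewrite E3 eq_sym subr_eq0 eq_sym.
move=> h b; move: Hk; rewrite memv_ker lfunE /= (skew_mu1_kkar n s t s' t') => /eqP.
move=> /ffunP/(_ (h, (ord0, ord_max, arr b))); rewrite selt_arrE ffunE.
by move=> /eqP; rewrite subr_eq0 => /eqP.
Qed.

Lemma coboundaryP w : 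
  (exists u v : bool -> K, forall h b, w h b =
    u h * arrows_coef (s' * t') b * N1 (d - 1) - arrows_coef (s * t) (b (+) h) * v h) ->
  selt (fun=> 0) (fun=> 0) w \in coboundaries (kar_tw U) (kar_tw (V 1)).
Proof.
move=> [u [v H]].
have -> : selt (fun=> 0) (fun=> 0) w =
    linfun (@skew_mu1 K A (kar_tw U) (kar_tw (V 1))) (selt u v (fun _ _ => 0)).
  rewrite lfunE /= (skew_mu1_kkar 1 s t s' t').
  by apply: eq_selt => // h b; rewrite H mul1r.
apply: memv_img; apply: (@selt_homog _ _ _ _ _ _ _ HK e _ (fun k => e k + 1)); last by right.
- by left; ring.
- by left; ring.
Qed.

(** Together with [coboundary_chi]: if the parameters [s * t] and [s' * t'] agree,
    the coboundaries are the common kernel of two linear forms, one for each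
    element of the group. *)
Lemma coboundary_arr w : s * t = s' * t' ->
  selt (fun=> 0) (fun=> 0) w \in coboundaries (kar_tw U) (kar_tw (V 1)) ->
  forall h, w h false = s * t * w h true.
Proof.
move=> E /memv_imgP[y /(@homog_selt _ _ _ _ _ _ _ HK e _ (fun k => e k + 1))[u [v [w' [-> _ _ _]]]]].
rewrite lfunE /= (skew_mu1_kkar 1 s t s' t') -E => /ffunP Heq h.
have := Heq (h, (ord0, ord_max, arr false)); have := Heq (h, (ord0, ord_max, arr true)).
rewrite !selt_arrE mul1r /arrows_coef => -> ->.
by case: hs => ->; case: ht => ->; case: h => /=; ring.
Qed.

Lemma hom_dim_other n : n != 0 -> n != 1 -> kar_hom_dim U (V n) = 0%N.
Proof.
move=> n0 n1; apply: dim_image_eq0 => x /cocycleP[u [v [w [-> Hu Hv Hw _]]]].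
have -> : selt u v w = 0 by rewrite -selt0; apply: eq_selt; [exact: Hu|exact: Hv|exact: Hw].
by rewrite linear0 rpred0.
Qed.

(** The parameter is the product of the signs, so if it is unchanged, then either
    none or both of the signs change. *)
Lemma sign_opp : s * t = s' * t' -> s != s' \/ t != t' -> s' = - s /\ t' = - t.
Proof.
have N11 : (-1 == 1 :> K) = false.
  by apply/negbTE; rewrite eq_sym -addr_eq0 -[1 + 1]/(2%:R).
have N12 : (1 == -1 :> K) = false by rewrite eq_sym.
case: hs => ->; case: ht => ->; case: hs' => ->; case: ht' => ->;
  rewrite ?(mulrN1, mulr1, mulrNN, opprK) => E; rewrite ?eqxx ?N11 ?N12 => -[] // _;
  by move/eqP: E; rewrite ?N11 ?N12.
Qed.

(** If the parameters are different, then 0 is the only cocycle; if they agree,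
    then both signs change and the idempotents kill the cocycles. *)
Lemma hom_dim0_ne : s != s' \/ t != t' -> kar_hom_dim U (V 0) = 0%N.
Proof.
move=> ne; apply: dim_image_eq0 => x /cocycleP[u [v [w [-> _ _ Hw H]]]].
rewrite kar_proj_kkar.
have [uf ut E] : [/\ u false = v false, u true = s * t * v true &
    s * t = s' * t' \/ (v false = 0 /\ v true = 0)].
  have := H false true; have := H true true; have := H false false; have := H true false.
  rewrite /arrows_coef /= !mul0r !expr0z !mulr1 !mul1r => + + ut uf; rewrite uf ut.
  have two_eq (z : K) : - z = z -> z = 0.
    move=> /eqP; rewrite eq_sym -addr_eq0 -mulr2n -mulr_natl mulf_eq0 (negbTE two0) /=.
    by move/eqP.
  case: hs => ->; case: ht => ->; case: hs' => ->; case: ht' => ->;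
    rewrite ?(mulrN1, mulN1r, mulNr, mulrN, mulr1, mul1r, opprK) => E1 E2;
    by split=> //; (left; ring) || (right; split; apply: two_eq).
have Hw' := Hw isT.
rewrite selt_eq0 ?rpred0 // => [h|h|h b].
- rewrite !big_bool /= expr0z !mulr1 uf ut /half_char.
  case: E => [E|[-> ->]]; last by case: h => /=; ring.
  have [-> _] := sign_opp E ne.
  by case: hs => ->; case: ht => ->; case: h => /=; ring.
- rewrite !big_bool /= expr0z !mulr1 /half_char.
  case: E => [E|[-> ->]]; last by case: h => /=; ring.
  have [_ ->] := sign_opp E ne.
  by case: ht => ->; case: h => /=; ring.
- rewrite !big_bool /= !Hw'; ring.
Qed.

Lemma seltB u v w u' v' w' : selt u v w - selt u' v' w' =
  selt (fun h => u h - u' h) (fun h => v h - v' h) (fun h b => w h b - w' h b).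
Proof.
by apply/ffunP => x; rewrite !ffunE; case: ifP => _; case: ifP => _; ring.
Qed.

Lemma seltZ (r : K) u v w : r *: selt u v w =
  selt (fun h => r * u h) (fun h => r * v h) (fun h b => r * w h b).
Proof.
by apply/ffunP => x; rewrite !ffunE /GRing.scale /=; case: ifP => _; case: ifP => _; ring.
Qed.

(** The part of u of type [s] is one-dimensional, and u determines v: the
    identity spans the classes. *)
Lemma hom_dim0_eq : s = s' -> t = t' -> kar_hom_dim U (V 0) = 1%N.
Proof.
move=> Es Et.
have proj0 u v w : w =2 (fun _ _ => 0) ->
    kar_proj (X := U) (Y := V 0) (selt u v w) =
    selt (fun h => (u false + s * u true) * half_char s h) (fun h => (v false + t * v true) * half_char t h)
      (fun _ _ => 0).
  move=> Hw; rewrite kar_proj_kkar -Es -Et; apply: eq_selt => [h|h|h b].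
  - rewrite !big_bool /= expr0z !mulr1 /half_char.
    by case: hs => ->; case: h => /=; field.
  - rewrite !big_bool /= expr0z !mulr1 /half_char.
    by case: ht => ->; case: h => /=; field.
  - by rewrite !big_bool /= !Hw /= !(mulr0, mul0r, addr0).
have hid1 (z : K) : is_sign z -> half_char z false + z * half_char z true = 1.
  by rewrite /half_char => -[] -> /=; field.
pose x0 := selt (half_char s) (half_char t) (fun _ _ => 0).
have px0 : kar_proj (X := U) (Y := V 0) x0 = x0.
  by rewrite proj0 //; apply: eq_selt => // h; rewrite hid1 ?mul1r.
apply: (@dim_image_eq1 _ _ U (V 0) x0).
- rewrite memv_cap; apply/andP; split.
    by apply: (@selt_homog _ _ _ _ _ _ _ HK e _ (fun k => e k + 0));
      rewrite ?addr0 ?subrr; [left; rewrite oppr0|left; rewrite oppr0|right].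
  rewrite memv_ker lfunE /= (skew_mu1_kkar 0 s t s' t') selt_eq0 // => h b.
  rewrite mul0r expr0z -Es -Et /half_char /arrows_coef.
  by case: hs => ->; case: ht => ->; case: h; case: b => /=; ring.
- rewrite px0; apply/negP => /memv_imgP[y /(@homog_selt _ _ _ _ _ _ _ HK e _ (fun k => e k + 0))].
  move=> [u [v [w [-> Hu Hv Hw]]]]; rewrite !addr0 !subrr oppr0 in Hu Hv.
  rewrite lfunE /= (skew_mu1_kkar 0 s t s' t').
  rewrite [RHS]selt_eq0 //; last by move=> h b; rewrite Hu // Hv //; ring.
  move=> /ffunP/(_ (false, (ord0, ord0, Defs.one X))); rewrite !ffunE /= eqxx mulr1 /half_char.
  by move/eqP; rewrite mulf_eq0 oner_eq0 invr_eq0 (negbTE two0).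
- move=> x /cocycleP[u [v [w [-> _ _ Hw H]]]].
  exists (u false + s * u true); rewrite linearB linearZ /= px0 proj0; last exact: Hw.
  rewrite seltZ seltB selt_eq0 ?rpred0 // => [h|h|h b]; last by ring.
    by ring.
  have := H false true; have := H true true.
  rewrite /arrows_coef /= !mul0r !expr0z !mulr1 !mul1r => -> ->.
  by case: hs => ->; case: ht => ->; ring.
Qed.

Lemma kar_proj1 w :
  kar_proj (X := U) (Y := V 1) (selt (fun=> 0) (fun=> 0) w) =
  selt (fun=> 0) (fun=> 0) (fun h b => \sum_(k : bool)
     (\sum_(j : bool) half_char s (j (+) (k (+) h)) * w j (b (+) k)) * half_char t' k).
Proof.
rewrite kar_proj_kkar; apply: eq_selt => [h|h|h b].
- by rewrite !big_bool /=; ring.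
- by rewrite !big_bool /=; ring.
- by apply: eq_bigr => k _; rewrite subrr expr0z mulr1.
Qed.

Lemma coboundary_chi w : s * t = s' * t' ->
  (forall h, w h false = s * t * w h true) ->
  selt (fun=> 0) (fun=> 0) w \in coboundaries (kar_tw U) (kar_tw (V 1)).
Proof.
move=> E H; apply: coboundaryP; exists (fun h => w h true * N1 (d - 1)), (fun=> 0) => h b.
rewrite mulr0 subr0 -E.
have -> : w h true * N1 (d - 1) * arrows_coef (s * t) b * N1 (d - 1) =
    w h true * arrows_coef (s * t) b * (N1 (d - 1) * N1 (d - 1)) by ring.
rewrite signz_sq.
by case: b; rewrite /arrows_coef ?H; ring.
Qed.

(** The arrow [c] over the neutral element of the group spans the classes. *)
Lemma hom_dim1_opp : s = - s' -> t = - t' -> kar_hom_dim U (V 1) = 1%N.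
Proof.
move=> Es Et.
have Es' : s' = - s by rewrite Es opprK.
have Et' : t' = - t by rewrite Et opprK.
have E : s * t = s' * t' by rewrite Es' Et' mulrNN.
pose w0 (h b : bool) : K := if h || b then 0 else 1.
apply: (@dim_image_eq1 _ _ U (V 1) (selt (fun=> 0) (fun=> 0) w0)).
- rewrite memv_cap; apply/andP; split.
    apply: (@selt_homog _ _ _ _ _ _ _ HK e _ (fun k => e k + 1)); [by right|by right|left].
    have -> : e ord_max + 1 - e ord0 = (e ord_max - e ord0) + 1 by ring.
    by rewrite He; ring.
  rewrite memv_ker lfunE /= (skew_mu1_kkar 1 s t s' t') selt_eq0 // => h b.
  by ring.
- rewrite kar_proj1; apply/negP => /(coboundary_arr E)/(_ false).
  rewrite !big_bool /= /w0 /half_char Et' /=.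
  move=> H; have : (2%:R : K)^-1 = 0; last by move/eqP; rewrite invr_eq0 (negbTE two0).
  move/eqP: H; rewrite -subr_eq0 => /eqP <-.
  by case: hs => ->; case: ht => ->; field.
- move=> x /cocycleP[u [v [w [-> Hu Hv Hw H]]]].
  (* the character [s] applied to the two forms that cut out the coboundaries *)
  exists ((w false false - s * t * w false true) + s * (w true false - s * t * w true true)).
  have -> : selt u v w = selt (fun=> 0) (fun=> 0) w by apply: eq_selt => // h; [exact: Hu|exact: Hv].
  rewrite seltZ seltB.
  rewrite (_ : selt _ _ _ = selt (fun=> 0) (fun=> 0) (fun h b => w h b -
    (w false false - s * t * w false true + s * (w true false - s * t * w true true)) *
      w0 h b)); last by apply: eq_selt => // h; ring.
  rewrite kar_proj1; apply: coboundary_chi => // h.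
  rewrite !big_bool /= /w0 /half_char Et' /=.
  by case: hs => ->; case: ht => ->; case: h => /=; field.
Qed.

(** If the parameters are different, then every w is a coboundary; if they agree,
    then so do the signs, and the projection of w satisfies the equations of the
    coboundaries. *)
Lemma hom_dim1_other : s != - s' \/ t != - t' -> kar_hom_dim U (V 1) = 0%N.
Proof.
move=> ne; apply: dim_image_eq0 => x /cocycleP[u [v [w [-> Hu Hv _ _]]]].
have -> : selt u v w = selt (fun=> 0) (fun=> 0) w by apply: eq_selt => // h; [exact: Hu|exact: Hv].
rewrite kar_proj1; set w' := (X in selt _ _ X).
have [E|E] := eqVneq (s * t) (s' * t').
  apply: coboundary_chi => // h; rewrite /w' !big_bool /half_char.
  have [Es Et] : s' = s /\ t' = t.
    have [ss|ss] := eqVneq s s'.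
      split=> //; move: E; rewrite -ss; case: hs => ->; rewrite ?mul1r ?mulN1r //.
      by move/oppr_inj.
    have [Es Et] := sign_opp E (or_introl ss).
    by case: ne; rewrite ?Es ?Et opprK eqxx.
  by rewrite Et; case: hs => ->; case: ht => ->; case: h => /=; field.
have E' : s' * t' = - (s * t).
  by move: E; case: hs => ->; case: ht => ->; case: hs' => ->; case: ht' => ->;
    rewrite ?(mulrN1, mulr1, opprK, eqxx).
apply: coboundaryP; rewrite E'.
(* the solution of four linear equations, whose determinant is a power of 2 *)
exists (fun h => (w' h true - s * t * w' h false) / 2%:R * N1 (d - 1)),
  (fun h : bool => (if h then - w' h false - s * t * w' h true
            else - (s * t * w' h false) - w' h true) / 2%:R) => h b.
have Hr (a y : K) : a * N1 (d - 1) * y * N1 (d - 1) = a * y * (N1 (d - 1) * N1 (d - 1)) by ring.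
rewrite Hr signz_sq.
by case: hs => ->; case: ht => ->; case: h; case: b; rewrite /arrows_coef /=; field.
Qed.

Theorem kkar_hom_dim n : kar_hom_dim U (V n) =
  if [&& n == 0, s == s' & t == t'] then 1%N
  else if [&& n == 1, s == - s' & t == - t'] then 1%N else 0%N.
Proof.
have [->|n0] := eqVneq n 0.
  rewrite (_ : 0 == 1 = false) //=.
  case: (eqVneq s s') => [Es|ns]; last by rewrite hom_dim0_ne //; left.
  case: (eqVneq t t') => [Et|nt]; last by rewrite hom_dim0_ne //; right.
  by rewrite hom_dim0_eq.
have [->|n1] := eqVneq n 1; last by rewrite hom_dim_other.
case: (eqVneq s (- s')) => [Es|ns]; last by rewrite hom_dim1_other //; left.
case: (eqVneq t (- t')) => [Et|nt]; last by rewrite hom_dim1_other //; right.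
by rewrite hom_dim1_opp.
Qed.

End HomDim.
End Kron.

(** * The two arcs of the annulus in the Fukaya category *)

Section FukayaCount.
Variables (K : fieldType) (R : realType) (S : gms_data R) (D : arcs_data S).

Definition seg_count (a : bmor D) : nat := if a is inr _ then 1 else 0.

Lemma disc_sequence_count (s : seq (bmor D)) :
  disc_sequence s -> (\sum_(a <- s) seg_count a = size s)%N /\ (3 <= size s)%N.
Proof.
move=> [n [w [[n3 _ _] ->]]]; rewrite size_map size_enum_ord; split=> //.
by rewrite big_map big_enum /= sum1_card card_ord.
Qed.

(** The inputs are the segments around a disc, at least three, one of which may
    have been prolonged or replaced by an identity: two segments remain. *)
Lemma fuk_mu_long : @short_mu K (fuk K D) seg_count.
Proof.
case=> [|a [|b [|x s]]] //= _ Hs; apply/ffunP => y; rewrite !ffunE.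
case: asboolP => [[e [z [r [/disc_sequence_count []]]]] | _].
  rewrite big_cons /= => + + _ E; move: Hs; rewrite E big_cons.
  by move: (\sum_(i <- r) _)%N => m; case: e => /= e; case: z {E} => /= z; lia.
case: asboolP => [[e [z [r [/disc_sequence_count []]]]] | //].
rewrite -cats1 big_cat size_cat /= big_seq1 => + + _ E; move: Hs.
rewrite E -cats1 big_cat /= big_seq1.
by move: (\sum_(i <- r) _)%N => m; case: e => /= e; case: z {E} => /= z; lia.
Qed.

(** The conditions under which X and Y span a Kronecker category; they are derived
    from the shape of the annulus in [adapted_corner_facts]. *)
Record corner_facts (X Y : aidx D) (c : segment D) : Prop := CornerFacts {
  corner_neq : X <> Y;
  corner_gX : gI X = X;
  corner_gY : gI Y = Y;
  corner_src : (seg_src c).1 = X /\ (seg_tgt c).1 = Y;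
  corner_gsrc : (seg_src (gseg c)).1 = X /\ (seg_tgt (gseg c)).1 = Y;
  corner_gneq : c <> gseg c;
  corner_gg : gseg (gseg c) = c;
  corner_deg : seg_deg (gseg c) = seg_deg c;
  corner_all : forall s : segment D,
    (seg_src s).1 = X \/ (seg_src s).1 = Y ->
    (seg_tgt s).1 = X \/ (seg_tgt s).1 = Y -> s = c \/ s = gseg c }.

Lemma corner_kronecker X Y c : corner_facts X Y c ->
  @kronecker K (fuk K D) X Y (inr c) (seg_deg c) seg_count.
Proof.
move=> [XY gX gY [sc tc] [sg tg] cg gg dg all].
have YX : Y <> X by move/esym.
split=> //=.
- by case=> cg'; apply: cg.
- by rewrite gg.
- by rewrite gX.
- by rewrite gY.
- by case.
- move=> [i|u] /=; first by move=> ->.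
  move=> su tu; have [E|E] := all u (or_introl su) (or_introl tu).
    by rewrite E tc in tu.
  by rewrite E tg in tu.
- move=> [i|u] /=; first by move=> ->.
  move=> su tu; have [E|E] := all u (or_intror su) (or_intror tu).
    by rewrite E sc in su.
  by rewrite E sg in su.
- move=> [i|u] /=; first by move=> -> /esym.
  move=> su tu; have [->|->] := all u (or_introl su) (or_intror tu); by [left|right].
- move=> [i|u] /=; first by move=> ->.
  move=> su tu; have [E|E] := all u (or_intror su) (or_introl tu).
    by rewrite E sc in su.
  by rewrite E sg in su.
- by case.
- by case.
- move=> a; rewrite ffunE /= eqxx expr0z -[Some _ == Some _]/(inl X == a :> bmor D).
  by rewrite eq_sym; case: ifP.
- move=> a; rewrite ffunE /= eqxx expr0z -[Some _ == Some _]/(inl Y == a :> bmor D).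
  by rewrite eq_sym; case: ifP.
- move=> b a; case: b => /=; rewrite ffunE /= ?sc ?sg eqxx expr0z -[Some _ == Some _]/(_ == a :> bmor D);
  by rewrite eq_sym; case: ifP.
- move=> b a; case: b => /=; rewrite ffunE /= ?tc ?tg eqxx ?dg -[Some _ == Some _]/(_ == a :> bmor D);
  by rewrite eq_sym; case: ifP; rewrite ?mulr1 ?mulr0.
- exact: fuk_mu_long.
Qed.

Section KarB.
Variables (c : R -> pts S) (theta : R -> R) (ad : adapted_data D).
Local Notation X := (iX ad).
Local Notation Y := (iY ad).
Local Notation s := (cseg ad).
Hypothesis HC : corner_facts X Y s.
Hypothesis Hdeg : seg_deg s = indQ theta ad - indP theta ad.
Hypothesis two0 : 2%:R != 0 :> K.

Lemma kar_eq (A : ainf K) (o : 'I_2 -> obj A) (e : 'I_2 -> int) d1 d2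
    (i1 i2 : {ffun bool * ('I_2 * 'I_2 * mor A) -> K^o}) :
  d1 = d2 -> i1 = i2 ->
  @Kar K A (@Tw K A 2 o e d1) i1 = @Kar K A (@Tw K A 2 o e d2) i2.
Proof. by move=> -> ->. Qed.

Let e (k : 'I_2) : int := if k == ord0 then indP theta ad else indQ theta ad - 1.

(** As ||c|| = q - p - 1 has the parity of p + (q - 1), the sign in the
    differential is the product of the two signs in the idempotents. *)
Lemma B_epsE (eP eQ : int) :
  B_eps theta ad K eP eQ =
  @kkar K (fuk K D) X Y (inr s) e (eP%:~R * (-1) ^ indP theta ad) (eQ%:~R * (-1) ^ (indQ theta ad - 1)).
Proof.
have N10 : (-1 : K) != 0 by rewrite oppr_eq0 oner_eq0.
have zero2 (x y : K) : 0 * x + 0 * y = 0 by rewrite !mul0r addr0.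
apply: kar_eq; apply/ffunP.
  move=> [[k l] a]; rewrite !ffunE /= mul0r.
  have [->|->] := ord2P k; have [->|->] := ord2P l; rewrite /= ?mul0r // /arrows_coef mul1r.
  congr (_ * _ + _).
  rewrite mulrACA -intrM -expfzDr //; congr (_ * _).
  rewrite Hdeg; set p := indP _ _; set q := indQ _ _.
  have -> : q - p - 1 = (p + (q - 1)) - (p + p) by ring.
  by rewrite (signzD K (p + (q - 1))) signzN (signzD K p p) signz_sq mulr1.
move=> [h [[k l] a]]; rewrite !ffunE /= /idem_coef /half_char.
have [->|->] := ord2P k; have [->|->] := ord2P l; rewrite /= ?eqxx //=.
all: try exact: esym (zero2 _ _).
  by case: ifP; case: h => _; rewrite ?mulr1 ?mulr0.
by case: ifP; case: h => _; rewrite ?mulr1 ?mulr0.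
Qed.

Lemma sign_neq : (1 == -1 :> K) = false.
Proof. by apply/negbTE; rewrite -addr_eq0 -[1 + 1]/(2%:R). Qed.

Lemma kar_B_dim (eP eQ eP' eQ' : int) (n : int)
  (heP : eP = 1 \/ eP = -1) (heQ : eQ = 1 \/ eQ = -1)
  (heP' : eP' = 1 \/ eP' = -1) (heQ' : eQ' = 1 \/ eQ' = -1) :
  is_kar (B_eps theta ad K eP eQ) /\
  kar_hom_dim (B_eps theta ad K eP eQ) (kar_shift n (B_eps theta ad K eP' eQ')) =
    if [&& n == 0, eP == eP' & eQ == eQ'] then 1%N
    else if [&& n == 1, eP == - eP' & eQ == - eQ'] then 1%N
    else 0%N.
Proof.
have N10 m : ((-1) ^ (m : int) : K) != 0 by rewrite expfz_neq0 // oppr_eq0 oner_eq0.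
have HK := corner_kronecker HC.
have He : e ord_max - e ord0 = seg_deg s - 1 by rewrite Hdeg /e /=; ring.
have sgn (z m : int) : z = 1 \/ z = -1 -> (z%:~R * (-1) ^ m : K) = 1 \/ (z%:~R * (-1) ^ m : K) = -1.
  move=> hz.
  have : (z%:~R * (-1) ^ m : K) ^+ 2 == 1.
    by rewrite expr2 mulrACA signz_sq mulr1; case: hz => ->; rewrite ?mulr1 ?mulrNN ?mulr1.
  by rewrite sqrf_eq1 => /orP[]/eqP; [left|right].
have eqs (z z' m : int) : z = 1 \/ z = -1 -> z' = 1 \/ z' = -1 ->
    (z%:~R * (-1) ^ m == z'%:~R * (-1) ^ m :> K) = (z == z').
  move=> hz hz'; rewrite (inj_eq (mulIf (N10 m))).
  have E1 : ((-1)%:~R : K) = -1 by rewrite mulrNz.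
  case: hz => ->; case: hz' => ->; rewrite ?E1 ?eqxx //; first exact: sign_neq.
  by rewrite eq_sym; exact: sign_neq.
have eqsN (z z' m : int) : z = 1 \/ z = -1 -> z' = 1 \/ z' = -1 ->
    (z%:~R * (-1) ^ m == - (z'%:~R * (-1) ^ m) :> K) = (z == - z').
  move=> hz hz'; rewrite -mulNr -mulrNz; apply: eqs => //.
  by case: hz' => ->; rewrite ?opprK; [right|left].
rewrite !B_epsE; split; first by apply: (kkar_is_kar HK) => //; exact: sgn.
rewrite (kkar_hom_dim HK) //; try exact: sgn.
by rewrite !eqs // !eqsN.
Qed.

End KarB.
End FukayaCount.

(** * Differentiability of maps of the plane *)

Section Calculus.
Variable R : realType.
Local Notation plane := (R * R)%type.

Lemma plane_eq (x y : plane) : x.1 = y.1 -> x.2 = y.2 -> x = y.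
Proof. by case: x => ? ?; case: y => ? ? /= -> ->. Qed.

Lemma is_derive_line (V W : normedModType R) (f : V -> W) (x v : V) (t : R) :
  derivable f (x + t *: v) v ->
  is_derive t (1 : R) (fun s => f (x + s *: v)) ('D_v f (x + t *: v)).
Proof.
move=> df.
have E : (fun h : R => h^-1 *: (((fun s => f (x + s *: v)) \o shift t) (h *: (1 : R)) -
            f (x + t *: v))) =
         (fun h => h^-1 *: ((f \o shift (x + t *: v)) (h *: v) - f (x + t *: v))).
  apply/funext => h /=; congr (_ *: (f _ - _)).
  by rewrite [h *: 1]mulr1 scalerDl addrCA addrA.
by split; rewrite /derivable /derive E.
Qed.

Lemma cont_fst : continuous (fst : plane -> R).
Proof. by move=> x; exact: cvg_fst. Qed.

Lemma cont_snd : continuous (snd : plane -> R).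
Proof. by move=> x; exact: cvg_snd. Qed.

Lemma derive_fst (V : normedModType R) (f : V -> plane) x v : derivable f x v ->
  is_derive x v (fun y => (f y).1) ('D_v f x).1.
Proof.
move=> df.
have : (fun h : R => (h^-1 *: ((f \o shift x) (h *: v) - f x)).1) @ 0^' --> ('D_v f x).1.
  have df' : (fun h : R => h^-1 *: ((f \o shift x) (h *: v) - f x)) @ 0^' --> 'D_v f x := df.
  exact: (cvg_comp _ _ df' (@cont_fst _)).
move=> H; split; first by apply/cvg_ex; exists ('D_v f x).1.
by apply: cvg_lim.
Qed.

Lemma derive_snd (V : normedModType R) (f : V -> plane) x v : derivable f x v ->
  is_derive x v (fun y => (f y).2) ('D_v f x).2.
Proof.
move=> df.
have : (fun h : R => (h^-1 *: ((f \o shift x) (h *: v) - f x)).2) @ 0^' --> ('D_v f x).2.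
  have df' : (fun h : R => h^-1 *: ((f \o shift x) (h *: v) - f x)) @ 0^' --> 'D_v f x := df.
  exact: (cvg_comp _ _ df' (@cont_snd _)).
move=> H; split; first by apply/cvg_ex; exists ('D_v f x).2.
by apply: cvg_lim.
Qed.

Lemma line_MVT (V : normedModType R) (g : V -> R) (x v : V) (h : R) :
  (forall s, `|s| <= `|h| -> derivable g (x + s *: v) v) ->
  exists2 s, `|s| <= `|h| & g (x + h *: v) - g x = h * 'D_v g (x + s *: v).
Proof.
move=> dg.
have der s : `|s| <= `|h| -> is_derive s (1 : R) (fun s => g (x + s *: v)) ('D_v g (x + s *: v)).
  by move=> /dg /is_derive_line.
have cont a b : (forall s, s \in `[a, b] -> `|s| <= `|h|) ->
    {within `[a, b], continuous (fun s : R => g (x + s *: v))}.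
  move=> H; apply: derivable_within_continuous => s /H/der []; by [].
have [h0|h0] := leP 0 h.
  have H s : s \in `[0, h] -> `|s| <= `|h|.
    by rewrite in_itv /= => /andP[s0 sh]; rewrite !ger0_norm.
  have [s sI E] := @MVT_segment R (fun s => g (x + s *: v)) (fun s => 'D_v g (x + s *: v)) 0 h h0
    (fun s sI => der s (H s (subset_itv_oo_cc sI))) (cont _ _ H).
  exists s; first exact: H.
  by move: E; rewrite scale0r addr0 subr0 mulrC.
have H s : s \in `[h, 0] -> `|s| <= `|h|.
  rewrite in_itv /= => /andP[hs s0]; rewrite ler0_norm // ltr0_norm //; lra.
have [s sI E] := @MVT_segment R (fun s => g (x + s *: v)) (fun s => 'D_v g (x + s *: v)) h 0 (ltW h0)
    (fun s sI => der s (H s (subset_itv_oo_cc sI))) (cont _ _ H).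
exists s; first exact: H.
move: E; rewrite scale0r addr0 => E.
by rewrite -opprB E; ring.
Qed.

Lemma differentiable_approx (V W : normedModType R) (f : V -> W) (df : {linear V -> W}) (z : V) :
  continuous df ->
  (forall eps : R, 0 < eps ->
     \forall h \near 0, `|f (h + z) - (f z + df h)| <= eps * `|h|) ->
  differentiable f z.
Proof.
move=> df_cont H.
have key : f \o shift z = cst (f z) + df +o_ 0 id.
  by apply/eqaddoP => eps e0; have := H _ e0; apply: filterS => h; rewrite !fctE.
have dE : 'd f z = df :> (V -> W) by apply: diff_unique.
by apply/diff_locallyP; rewrite dE.
Qed.

Lemma two_increments (u v e n p1 p2 q1 q2 x y z : R) :
  `|u| <= n -> `|v| <= n -> `|p1 - q1| <= e / 2 -> `|p2 - q2| <= e / 2 ->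
  x - y = u * q1 -> y - z = v * q2 -> `|x - (z + (u * p1 + v * p2))| <= e * n.
Proof.
move=> un vn d1 d2 E1 E2.
have -> : x - (z + (u * p1 + v * p2)) = u * (q1 - p1) + v * (q2 - p2).
  by rewrite !mulrBr -E1 -E2; ring.
apply: le_trans (ler_normD _ _) _; rewrite !normrM (distrC q1) (distrC q2).
have -> : e * n = n * (e / 2) + n * (e / 2) by field.
by apply: lerD; apply: ler_pM.
Qed.

(** The increment is decomposed into a vertical and a horizontal one, to which the
    mean value theorem applies. *)
Lemma C1_differentiable_scalar (g : plane -> R) (U : set plane) (z : plane) :
  open U -> U z ->
  (forall w, U w -> derivable g w (1, 0) /\ derivable g w (0, 1)) ->
  {for z, continuous (fun w => 'D_(1, 0) g w)} ->
  {for z, continuous (fun w => 'D_(0, 1) g w)} ->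
  differentiable g z.
Proof.
move=> oU Uz dU c1 c2.
pose df0 (h : plane) : R := h.1 * 'D_(1, 0) g z + h.2 * 'D_(0, 1) g z.
have df_lin : linear df0.
  by move=> k [a b] [a' b']; rewrite /df0 /= /GRing.scale /=; ring.
pose dfM := GRing.isLinear.Build R plane R *:%R df0 df_lin.
pose df : {linear plane -> R} := HB.pack df0 dfM.
have df_cont : continuous df.
  move=> w; apply: cvgD; apply: cvgMl; [exact: cont_fst|exact: cont_snd].
apply: (differentiable_approx (df := df)) => // _/posnumP[eps].
  have e2 : 0 < eps%:num / 2 by [].
  have /nbhs_ballP[d d0 Hd] : \forall w \near z, U w /\
      (`|'D_(1, 0) g z - 'D_(1, 0) g w| <= eps%:num / 2 /\
       `|'D_(0, 1) g z - 'D_(0, 1) g w| <= eps%:num / 2).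
    apply: filterI; first exact: open_nbhs_nbhs.
    apply: filterI; [move/cvgrPdist_le: c1|move/cvgrPdist_le: c2]; exact.
  near=> h.
  have hd : `|h| < d.
    near: h; apply/nbhs_ballP; exists d => // y.
    by rewrite -ball_normE /= sub0r normrN.
  have [h1 h2] : `|h.1| <= `|h| /\ `|h.2| <= `|h|.
    by rewrite prod_normE !le_max !lexx orbT.
  have inb (a b : R) : `|a| <= `|h| -> `|b| <= `|h| -> ball z d (z + (a, b)).
    move=> ha hb; rewrite -ball_normE /= opprD addNKr normrN prod_normE /= gt_max.
    by rewrite !(le_lt_trans _ hd).
  pose w := z + (0, h.2).
  have pE (a b : R) : w + a *: (1, 0) = z + (a, h.2) /\ z + b *: (0, 1) = z + (0, b).
    by split; apply: plane_eq; rewrite /= /GRing.scale /= ?mulr1 ?mulr0 ?addr0.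
  have [s1 s1h E1] : exists2 s, `|s| <= `|h.1| &
      g (w + h.1 *: (1, 0)) - g w = h.1 * 'D_(1, 0) g (w + s *: (1, 0)).
    apply: line_MVT => s sh; rewrite (pE s 0).1; apply: (dU _ _).1.
    by apply: (Hd _ (inb _ _ _ _)).1 => //; exact: le_trans sh h1.
  have [s2 s2h E2] : exists2 s, `|s| <= `|h.2| &
      g (z + h.2 *: (0, 1)) - g z = h.2 * 'D_(0, 1) g (z + s *: (0, 1)).
    apply: line_MVT => s sh; rewrite (pE 0 s).2; apply: (dU _ _).2.
    apply: (Hd _ (inb _ _ _ _)).1; rewrite ?normr0 //; exact: le_trans sh h2.
  rewrite (pE _ 0).1 (pE s1 0).1 in E1; rewrite (pE 0 _).2 (pE 0 s2).2 in E2.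
  have [_ [D1 _]] := Hd _ (inb s1 h.2 (le_trans s1h h1) h2).
  have [_ [_ D2]] := Hd _ (inb 0 s2 (ltac:(by rewrite normr0)) (le_trans s2h h2)).
  have Eh : z + (h.1, h.2) = h + z by rewrite addrC; case: (h).
  rewrite Eh in E1.
  exact: (two_increments h1 h2 D1 D2 E1 E2).
Unshelve. all: by end_near. Qed.

End Calculus.

Section Smooth.
Variable R : realType.
Local Notation plane := (R * R)%type.

Lemma near_eq_continuous (V W : topologicalType) (f g : V -> W) (z : V) :
  (\forall w \near z, f w = g w) -> {for z, continuous f} -> {for z, continuous g}.
Proof.
move=> E cf; rewrite /prop_for /continuous_at -(nbhs_singleton E).
by apply: cvg_trans cf; apply: near_eq_cvg; apply: filterS E => w ->.
Qed.

Lemma C1_differentiable (f : plane -> plane) (U : set plane) (z : plane) :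
  open U -> U z ->
  (forall w, U w -> derivable f w (1, 0) /\ derivable f w (0, 1)) ->
  {for z, continuous (fun w => 'D_(1, 0) f w)} ->
  {for z, continuous (fun w => 'D_(0, 1) f w)} ->
  differentiable f z.
Proof.
move=> oU Uz dU c1 c2.
have Uz' : \forall w \near z, U w by exact: open_nbhs_nbhs.
have fE : f = (fun w => ((f w).1, (f w).2)) by apply/funext => w; case: (f w).
rewrite fE; apply: differentiable_pair.
  apply: (C1_differentiable_scalar oU Uz) => [w /dU[d1 d2]||].
  - by split; [case: (derive_fst d1)|case: (derive_fst d2)].
  - have E : \forall w \near z, ('D_(1, 0) f w).1 = 'D_(1, 0) (fun w => (f w).1) w.
      by apply: filterS Uz' => w /dU[d1 _]; case: (derive_fst d1) => _ ->.
    apply: (near_eq_continuous E); exact: (continuous_comp c1 (@cont_fst R _)).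
  - have E : \forall w \near z, ('D_(0, 1) f w).1 = 'D_(0, 1) (fun w => (f w).1) w.
      by apply: filterS Uz' => w /dU[_ d1]; case: (derive_fst d1) => _ ->.
    apply: (near_eq_continuous E); exact: (continuous_comp c2 (@cont_fst R _)).
apply: (C1_differentiable_scalar oU Uz) => [w /dU[d1 d2]||].
- by split; [case: (derive_snd d1)|case: (derive_snd d2)].
- have E : \forall w \near z, ('D_(1, 0) f w).2 = 'D_(1, 0) (fun w => (f w).2) w.
    by apply: filterS Uz' => w /dU[d1 _]; case: (derive_snd d1) => _ ->.
  apply: (near_eq_continuous E); exact: (continuous_comp c1 (@cont_snd R _)).
- have E : \forall w \near z, ('D_(0, 1) f w).2 = 'D_(0, 1) (fun w => (f w).2) w.
    by apply: filterS Uz' => w /dU[_ d1]; case: (derive_snd d1) => _ ->.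
  apply: (near_eq_continuous E); exact: (continuous_comp c2 (@cont_snd R _)).
Qed.

Lemma smooth2_C1 (f : plane -> plane) (z : plane) : smooth2 f z ->
  \forall w \near z, [/\ smooth2 f w, differentiable f w,
    {for w, continuous (fun w => 'D_(1, 0) f w)} &
    {for w, continuous (fun w => 'D_(0, 1) f w)}].
Proof.
move=> [U [[oU Uz] CU]].
apply: (filterS (P := U)); last exact: open_nbhs_nbhs.
move=> w Uw; have [_ [dU [c1 _] [c2 _]]] := CU 1%N.
have C1 := c1 _ Uw; have C2 := c2 _ Uw.
split; [by exists U|exact: (C1_differentiable oU Uw dU C1 C2)|exact: C1|exact: C2].
Qed.

Lemma derive_plane (f : plane -> plane) (z u : plane) : differentiable f z ->
  'D_u f z = u.1 *: 'D_(1, 0) f z + u.2 *: 'D_(0, 1) f z.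
Proof.
move=> df; rewrite !deriveE // -!linearZ -linearD; congr ('d f z _).
by apply: plane_eq; rewrite /= /GRing.scale /=; ring.
Qed.

(** One-sided difference quotients suffice at the ends of the interval. *)
Lemma derive1_unique (V : normedModType R) (u w : R -> V) (a b t : R) :
  a < b -> a <= t <= b -> derivable u t 1 -> derivable w t 1 ->
  (\forall s \near t, a <= s <= b -> u s = w s) -> derive1 u t = derive1 w t.
Proof.
move=> ab /andP[at_ tb] du dw H.
have ut : u t = w t by apply: (nbhs_singleton H); rewrite at_.
apply/eqP; rewrite -subr_eq0 !derive1E -deriveB //; apply/eqP.
pose q (h : R) := h^-1 *: (((u \- w) \o shift t) (h *: (1:R)) - (u \- w) t).
have cq : q @ 0^' --> 'D_1 (u \- w) t by apply: (derivableB du dw).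
have H0 : \forall h \near (0 : R), a <= h + t <= b -> q h = 0.
  have : \forall h \near (0 : R), a <= h + t <= b -> u (h + t) = w (h + t).
    by move: H; rewrite (near_shift 0) /= subr0; apply: filterS => h.
  apply: filterS => h /[apply] E.
  by rewrite /q /= [h *: 1]mulr1 E ut !subrr scaler0.
have [tb'|bt] := ltP t b.
  have cF := cvg_dnbhs_at_right cq.
  apply: (cvg_unique (@norm_hausdorff _ V) cF); apply: cvg_near_cst.
  have H1 : \forall h \near 0^'+, a <= h + t <= b -> q h = 0.
    by rewrite near_withinE; apply: filterS H0 => h H1 _.
  near=> h; have h0 : 0 < h by near: h; exact: nbhs_right_gt.
  have : a <= h + t <= b -> q h = 0 by near: h; exact: H1.
  apply; apply/andP; split; first by rewrite ler_wpDl // ltW.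
  by rewrite -lerBrDr; near: h; apply: nbhs_right_le; rewrite subr_gt0.
have at' : a < t by apply: lt_le_trans ab bt.
have cF := cvg_dnbhs_at_left cq.
apply: (cvg_unique (@norm_hausdorff _ V) cF); apply: cvg_near_cst.
have H1 : \forall h \near 0^'-, a <= h + t <= b -> q h = 0.
  by rewrite near_withinE; apply: filterS H0 => h H1 _.
near=> h; have h0 : h < 0 by near: h; exact: nbhs_left_lt.
have : a <= h + t <= b -> q h = 0 by near: h; exact: H1.
apply; apply/andP; split; last by apply: le_trans tb; rewrite gerDr ltW.
by rewrite -lerBlDr; near: h; apply: nbhs_left_ge; rewrite subr_lt0.
Unshelve. all: by end_near. Qed.

(** The derivatives agree in the directions from z to the points of the unit ball,
    whose differences span the plane. This covers the boundary points of a convex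
    set that contains the ball. *)
Lemma derive_unique_star (f h : plane -> plane) (A : set plane) (z u : plane) :
  differentiable f z -> differentiable h z -> A z ->
  (forall w (s : R), `|w| <= 1 -> 0 <= s <= 1 -> A (z + s *: (w - z))) ->
  (\forall w \near z, A w -> f w = h w) ->
  'D_u f z = 'D_u h z.
Proof.
move=> df dh Az starA E.
have line (w : plane) : `|w| <= 1 -> 'D_(w - z) f z = 'D_(w - z) h z.
  move=> w1.
  have lf (k : plane -> plane) : differentiable k z ->
      is_derive (0 : R) (1 : R) (fun s => k (z + s *: (w - z))) ('D_(w - z) k z).
    move=> dk; have := @is_derive_line R _ _ k z (w - z) 0.
    by rewrite scale0r addr0; apply; apply: diff_derivable.
  have [d1 <-] := lf f df; have [d2 <-] := lf h dh.
  rewrite -!derive1E.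
  have I0 : (0 : R) <= (0 : R) <= 1 by rewrite lexx /= ler01.
  apply: (derive1_unique ltr01 I0 d1 d2).
  have c0 : (fun s : R => z + s *: (w - z)) @ (0 : R) --> z.
    rewrite -[X in _ --> X]addr0 -(scale0r (w - z)).
    by apply: cvgD; [exact: cvg_cst|apply: cvgZl; exact: cvg_id].
  have E1 : \forall s \near (0 : R), A (z + s *: (w - z)) ->
      f (z + s *: (w - z)) = h (z + s *: (w - z)) := c0 _ E.
  by apply: filterS E1 => s Es s01; apply: Es; apply: starA.
have lin (w : plane) : `|w| <= 1 -> 'D_w f z = 'D_w h z.
  move=> w1; have E1 := line w w1; have E0 := line 0 (ltac:(by rewrite normr0)).
  have sub (k : plane -> plane) : differentiable k z -> 'D_w k z = 'D_(w - z) k z - 'D_(0 - z) k z.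
    move=> dk; rewrite !deriveE // -linearB; congr ('d k z _).
    by rewrite sub0r opprK subrK.
  by rewrite (sub f df) (sub h dh) E1 E0.
have n1 : `|((1, 0) : plane)| <= 1 by rewrite prod_normE /= normr1 normr0 ge_max lexx ?ler01.
have n2 : `|((0, 1) : plane)| <= 1 by rewrite prod_normE /= normr1 normr0 ge_max lexx ?ler01.
by rewrite (derive_plane u df) (derive_plane u dh) (lin _ n1) (lin _ n2).
Qed.

End Smooth.

(** * Lifts of maps to the circle *)

Section Circle.
Variable R : realType.
Local Notation plane := (R * R)%type.
Local Notation circ := (@circ R).

Lemma circ_sq t : (circ t).1 ^+ 2 + (circ t).2 ^+ 2 = 1.
Proof. exact: cos2Dsin2. Qed.

Lemma circDn t (n : nat) : circ (t + n%:R) = circ t.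
Proof.
have E : 2 * pi * (t + n%:R) = 2 * pi * t + (pi *+ 2) *+ n :> R.
  by rewrite -[pi *+ 2]mulr_natl -mulr_natr; ring.
by rewrite /Defs.circ E (periodicn (@cosD2pi R)) (periodicn (@sinD2pi R)).
Qed.

Lemma circDz t (n : int) : circ (t + n%:~R) = circ t.
Proof.
case: n => n; first exact: circDn.
by rewrite NegzE mulrNz -[LHS](circDn _ n.+1) -[_ *~ _]/(n.+1%:R) subrK.
Qed.

Lemma circ_eq0 t : circ t = circ 0 -> exists n : int, t = n%:~R.
Proof.
move=> E; exists (Num.floor t); apply/eqP; rewrite -subr_eq0; apply/eqP.
set y := t - _.
have y0 : 0 <= y by rewrite subr_ge0 real_floor_le ?num_real.
have y1 : y < 1 by have := real_floorD1_gt (num_real t); rewrite /y intrD => H; lra.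
have Ey : circ y = circ 0 by rewrite /y -mulrNz circDz.
apply/eqP; rewrite eq_le y0 andbT leNgt; apply/negP => yp.
have p0 := @pi_gt0 R.
have s0 : 0 < sin (pi * y).
  by apply: sin_gt0_pi; rewrite mulr_gt0 //= gtr_pMr.
move: Ey; rewrite /Defs.circ mulr0 cos0 => -[Ec _].
have E2 : 2 * pi * y = (pi * y) *+ 2 by rewrite -mulr_natl; ring.
rewrite E2 cos_mulr2n in Ec.
have Es := cos2Dsin2 (pi * y).
have : sin (pi * y) ^+ 2 = 0 by rewrite mulr2n in Ec; lra.
by move/eqP; rewrite expf_eq0 /= gt_eqF.
Qed.

Lemma circB s t : circ s = circ t -> circ (s - t) = circ 0.
Proof.
rewrite /Defs.circ mulr0 cos0 sin0 mulrBr cosB sinB => -[-> ->].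
by rewrite -!expr2 cos2Dsin2 mulrC subrr.
Qed.

Lemma circ_eq s t : circ s = circ t -> exists n : int, s = t + n%:~R.
Proof. by move/circB/circ_eq0 => [n E]; exists n; rewrite -E addrC subrK. Qed.

Lemma int_valued_const (d : R -> R) (a b : R) : a <= b ->
  {within `[a, b], continuous d} ->
  (forall t, a <= t <= b -> exists n : int, d t = n%:~R) -> d b = d a.
Proof.
move=> ab cd Hd.
have [m Em] := Hd a (ltac:(by rewrite lexx)).
have [n En] := Hd b (ltac:(by rewrite lexx ab)).
have [mn|mn] := eqVneq m n; first by rewrite En Em mn.
pose v : R := (Num.min m n)%:~R + 2^-1.
have hv : Num.min (d a) (d b) <= v <= Num.max (d a) (d b).
  rewrite Em En /v.
  have h0 : (0 : R) < 2^-1 by lra.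
  have h1 : (2^-1 : R) < 1 by lra.
  have [lt|gt|E] := ltgtP m n; last by rewrite E eqxx in mn.
    have : (m + 1)%:~R <= n%:~R :> R by rewrite ler_int; lia.
    rewrite intrD => H.
    by rewrite ge_min le_max; apply/andP; split; apply/orP; [left|right]; lra.
  have : (n + 1)%:~R <= m%:~R :> R by rewrite ler_int; lia.
  rewrite intrD => H.
  by rewrite ge_min le_max; apply/andP; split; apply/orP; [right|left]; lra.
have [x xI xv] := IVT ab cd hv.
have [k Ek] := Hd x (ltac:(by move: xI; rewrite in_itv)).
have : (k%:~R : R) - (Num.min m n)%:~R = 2^-1 by rewrite -Ek xv /v; ring.
rewrite -intrB; move: (k - _) => j E.
have : (0 < j) && (j < 1); last by lia.
by rewrite -(ltr_int R) -(ltr_int R) E; apply/andP; split; lra.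
Qed.

End Circle.

Section Lift.
Variable R : realType.
Local Notation plane := (R * R)%type.
Local Notation circ := (@circ R).

Definition cross (u v : plane) : R := u.1 * v.2 - u.2 * v.1.
Definition dot (u v : plane) : R := u.1 * v.1 + u.2 * v.2.

(** The angle from u to v, as a fraction of a turn; correct for unit vectors
    at an acute angle. *)
Definition angle (u v : plane) : R := asin (cross u v) / (2 * pi).

Lemma cross_dot u v : u.1 ^+ 2 + u.2 ^+ 2 = 1 -> v.1 ^+ 2 + v.2 ^+ 2 = 1 ->
  cross u v ^+ 2 + dot u v ^+ 2 = 1 :> R.
Proof.
move=> Hu Hv; rewrite /cross /dot -[RHS](mulr1 1) -{1}Hu -Hv; ring.
Qed.

Lemma cross_lt1 u v : u.1 ^+ 2 + u.2 ^+ 2 = 1 -> v.1 ^+ 2 + v.2 ^+ 2 = 1 ->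
  0 < dot u v -> -1 < cross u v < 1.
Proof.
move=> Hu Hv d0; have H := cross_dot Hu Hv.
have d2 : 0 < dot u v ^+ 2 by rewrite exprn_gt0.
by rewrite -ltr_norml -(@ltr_pXn2r _ 2) ?nnegrE // expr1n -normrX ger0_norm ?sqr_ge0 //; lra.
Qed.

Lemma circ_angle t v : v.1 ^+ 2 + v.2 ^+ 2 = 1 -> 0 < dot (circ t) v ->
  circ (t + angle (circ t) v) = v.
Proof.
move=> Hv d0; have Hu := circ_sq t.
have /andP[c1 c2] := cross_lt1 Hu Hv d0.
have H := cross_dot Hu Hv.
have p0 : (2 * pi : R) != 0 by rewrite mulf_neq0 // gt_eqF // pi_gt0.
have E : 2 * pi * (t + angle (circ t) v) = 2 * pi * t + asin (cross (circ t) v) :> R.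
  have gen (P a : R) : P != 0 -> 2 * P * (t + a / (2 * P)) = 2 * P * t + a by move=> P0; field.
  by apply: gen; rewrite gt_eqF // pi_gt0.
have Es : sin (asin (cross (circ t) v)) = cross (circ t) v.
  by apply: asinK; rewrite in_itv /= (ltW c1) (ltW c2).
have Ec : cos (asin (cross (circ t) v)) = dot (circ t) v.
  rewrite cos_asin; last by rewrite (ltW c1) (ltW c2).
  have -> : 1 - cross (circ t) v ^+ 2 = dot (circ t) v ^+ 2 by lra.
  by rewrite sqrtr_sqr gtr0_norm.
rewrite {1}/Defs.circ E cosD sinD Es Ec; apply: plane_eq => /=.
  rewrite /cross /dot /=; move: (circ_sq t) => /= Hu'.
  set a := cos (2 * pi * t) in Hu' *; set b := sin (2 * pi * t) in Hu' *.
  by rewrite -[RHS]mul1r -Hu'; ring.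
rewrite /cross /dot /=; move: (circ_sq t) => /= Hu'.
set a := cos (2 * pi * t) in Hu' *; set b := sin (2 * pi * t) in Hu' *.
by rewrite -[RHS]mul1r -Hu'; ring.
Qed.

Lemma dot_near u v : u.1 ^+ 2 + u.2 ^+ 2 = 1 -> v.1 ^+ 2 + v.2 ^+ 2 = 1 ->
  `|v - u| < 2^-1 -> 0 < dot u v.
Proof.
move=> Hu Hv; rewrite prod_normE /= gt_max !ltr_norml => /andP[/andP[a1 a2] /andP[b1 b2]].
by rewrite /dot; nra.
Qed.

(** Heine's theorem; the neighbourhoods are relative to the compact set [O]. *)
Lemma uniform_modulus (O : set plane) (f : plane -> plane) (e : R) : 0 < e ->
  compact O -> {within O, continuous f} ->
  exists2 d : R, 0 < d & forall x y, O x -> O y -> `|x - y| < d -> `|f x - f y| < e.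
Proof.
move=> e0 cO /subspace_continuousP cf.
pose P (d : R) (x : plane) := O x -> forall y, O y -> `|x - y| < d -> `|f x - f y| < e.
have : \forall d \near 0^'+, O `<=` P d.
  have := cO; rewrite compact_near_coveringP => /(_ R 0^'+ P); apply => x Ox.
  have e2 : 0 < e / 2 by rewrite divr_gt0.
  have := cf x Ox; move=> /cvgrPdist_lt/(_ _ e2).
  rewrite near_withinE => /nbhs_ballP[r r0 Hr].
  have r2 : 0 < r / 2 by rewrite divr_gt0.
  exists (ball x (r / 2), [set d | d < r / 2]).
    by split; [exact: nbhsx_ballx|exact: nbhs_right_lt].
  move=> [x' d] /= [xx' dr] Ox' y Oy xy.
  rewrite -ball_normE /= in xx'.
  have h1 : `|f x - f x'| < e / 2.
    by apply: Hr => //; rewrite -ball_normE /=; apply: lt_trans xx' _; lra.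
  have h2 : `|f x - f y| < e / 2.
    apply: Hr => //; rewrite -ball_normE /=.
    rewrite -(subrK x' x) -addrA; apply: le_lt_trans (ler_normD _ _) _; lra.
  rewrite -(subrK (f x) (f x')) -addrA; apply: le_lt_trans (ler_normD _ _) _.
  by rewrite distrC; lra.
move=> H.
have H2 : \forall d \near 0^'+, O `<=` P d /\ 0 < d.
  by apply: filterI; [exact: H|exact: nbhs_right_gt].
have [d [Hd d0]] := @filter_ex _ _ (at_right_proper_filter 0) _ H2; exists d => // x y Ox Oy; exact: Hd.
Qed.

(** The segment from the centre to z is subdivided so finely, uniformly in z, that
    consecutive values of f are at an acute angle; the lift is the sum of the
    angles between them, each of which is continuous in z. *)
Theorem circle_lift (O : set plane) (f : plane -> plane) :
  compact O -> O 0 -> (forall z (s : R), O z -> 0 <= s <= 1 -> O (s *: z)) ->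
  {within O, continuous f} -> (forall z, O z -> exists t, f z = circ t) ->
  exists2 th : plane -> R, {within O, continuous th} & forall z, O z -> circ (th z) = f z.
Proof.
move=> cO O0 Ostar cf Hf.
have half0 : (0 : R) < 2^-1 by lra.
have [d d0 Hd] := uniform_modulus half0 cO cf.
have [M M0 HM] : exists2 M : R, 0 < M & forall z, O z -> `|z| <= M.
  have [M [_ HM]] := compact_bounded cO.
  exists (`|M| + 1); first by rewrite ltr_pwDr.
  by move=> z Oz; apply: (HM (`|M| + 1)) => //; rewrite ltr_pwDr // ler_norm.
have [N HN] : exists N : nat, M / d < N.+1%:R.
  exists (Num.truncn (M / d)); exact: truncnS_gt.
have [t0 Ht0] := Hf 0 O0.
pose q (j : nat) : R := j%:R / N.+1%:R.
pose th n (z : plane) := t0 + \sum_(j < n) angle (f (q j *: z)) (f (q j.+1 *: z)).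
have N0 : 0 < N.+1%:R :> R by rewrite ltr0n.
have q01 j : (j <= N.+1)%N -> 0 <= q j <= 1.
  by move=> jN; rewrite divr_ge0 ?ler0n //= ler_pdivrMr // mul1r ler_nat.
have unit z : O z -> (f z).1 ^+ 2 + (f z).2 ^+ 2 = 1.
  by move=> /Hf[t ->]; exact: circ_sq.
have step z j : O z -> (j < N.+1)%N -> 0 < dot (f (q j *: z)) (f (q j.+1 *: z)).
  move=> Oz jN; have O1 := Ostar _ _ Oz (q01 _ (ltnW jN)); have O2 := Ostar _ _ Oz (q01 _ jN).
  apply: dot_near; [exact: unit|exact: unit|].
  apply: Hd => //; rewrite -scalerBl normrZ.
  have -> : q j.+1 - q j = N.+1%:R^-1 by rewrite /q -mulrBl -natrB // subSnn mul1r.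
  rewrite ger0_norm ?invr_ge0 ?ler0n // mulrC ltr_pdivrMr //.
  by apply: le_lt_trans (HM _ Oz) _; rewrite mulrC -ltr_pdivrMr.
have thE z n : O z -> (n <= N.+1)%N -> circ (th n z) = f (q n *: z).
  move=> Oz; elim: n => [|n IH] nN.
    by rewrite /th big_ord0 addr0 /q mul0r scale0r.
  rewrite /th big_ord_recr /= addrA -/(th n z) -IH ?(ltnW nN) //.
  apply: circ_angle; first exact: unit (Ostar _ _ Oz (q01 _ nN)).
  by rewrite IH ?(ltnW nN) //; exact: step.
exists (th N.+1); last first.
  by move=> z Oz; rewrite thE // /q divff ?gt_eqF // scale1r.
apply/subspace_continuousP => z Oz.
have cq (j : nat) : (j <= N.+1)%N -> (fun z => f (q j *: z)) @ within O (nbhs z) --> f (q j *: z).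
  move=> jN; have Oq := Ostar _ _ Oz (q01 _ jN).
  move/subspace_continuousP: cf => /(_ _ Oq); apply: cvg_comp.
  move=> U; rewrite /= /within /= => HU.
  have cs : (fun z : plane => q j *: z) @ z --> q j *: z by apply: cvgZr; exact: cvg_id.
  have := cs _ HU; rewrite /nbhs /=; apply: filterS => y /= Hy Oy; apply: Hy.
  exact: Ostar Oy (q01 _ jN).
have ang j : (j < N.+1)%N ->
    (fun z => angle (f (q j *: z)) (f (q j.+1 *: z))) @ within O (nbhs z) -->
    angle (f (q j *: z)) (f (q j.+1 *: z)).
  move=> jN; apply: cvgMl.
  have cc : (fun z => cross (f (q j *: z)) (f (q j.+1 *: z))) @ within O (nbhs z) -->
      cross (f (q j *: z)) (f (q j.+1 *: z)).
    have [jN0 jN1] : (j <= N.+1)%N /\ (j.+1 <= N.+1)%N by rewrite jN ltnW.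
    have c1 i : (i <= N.+1)%N -> (fun z => (f (q i *: z)).1) @ within O (nbhs z) --> (f (q i *: z)).1.
      by move=> iN; apply: cvg_comp (cq _ iN) _; exact: cont_fst.
    have c2 i : (i <= N.+1)%N -> (fun z => (f (q i *: z)).2) @ within O (nbhs z) --> (f (q i *: z)).2.
      by move=> iN; apply: cvg_comp (cq _ iN) _; exact: cont_snd.
    by apply: cvgB; apply: cvgM; [exact: c1|exact: c2|exact: c2|exact: c1].
  apply: cvg_comp cc _.
  apply: continuous_asin; apply: cross_lt1.
  - apply: unit; exact: Ostar Oz (q01 _ (ltnW jN)).
  - apply: unit; exact: Ostar Oz (q01 _ jN).
  - exact: step.
suff ctn n : (n <= N.+1)%N -> th n @ within O (nbhs z) --> th n z by exact: ctn.
elim: n => [_|n IH nN].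
  have -> : th 0%N = fun=> t0 by apply/funext => w; rewrite /th big_ord0 addr0.
  exact: cvg_cst.
have -> : th n.+1 = fun w => th n w + angle (f (q n *: w)) (f (q n.+1 *: w)).
  by apply/funext => w; rewrite /th big_ord_recr /= addrA.
by apply: cvgD; [exact: IH (ltnW nN)|exact: ang].
Qed.

End Lift.

(** * The octagon and polar coordinates *)

Section Octagon.
Variable R : realType.
Local Notation plane := (R * R)%type.
Local Notation O := (@octagon R).

Lemma octagon_convex (z w : plane) (s : R) : O z -> O w -> 0 <= s <= 1 ->
  O (z + s *: (w - z)).
Proof.
move=> [z1 z2 z3] [w1 w2 w3] /andP[s0 s1].
have key (x y : R) : `|x + s * (y - x)| <= (1 - s) * `|x| + s * `|y|.
  have -> : x + s * (y - x) = (1 - s) * x + s * y by ring.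
  apply: le_trans (ler_normD _ _) _; rewrite !normrM (ger0_norm s0) ger0_norm ?subr_ge0 //.
have k1 := key z.1 w.1; have k2 := key z.2 w.2.
have a1 := normr_ge0 z.1; have a2 := normr_ge0 z.2.
by split; rewrite /= /GRing.scale /=; nra.
Qed.

Lemma octagon0 : O 0.
Proof. by split; rewrite /= normr0 ?addr0. Qed.

Lemma octagon_scale z (s : R) : O z -> 0 <= s <= 1 -> O (s *: z).
Proof.
move=> Oz s01; have := octagon_convex octagon0 Oz s01.
by rewrite subr0 add0r.
Qed.

Lemma octagon_ball (w : plane) : `|w| <= 1 -> O w.
Proof.
rewrite prod_normE /= ge_max => /andP[w1 w2].
by split; rewrite /=; lra.
Qed.

Lemma compact_octagon : compact O.
Proof.
have cl : closed [set z : plane | `|z.1| + `|z.2| <= 3].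
  apply: (@closed_comp _ _ (fun z : plane => `|z.1| + `|z.2|) [set x | x <= 3]); last exact: closed_le.
  move=> z _; apply: cvgD; apply: cvg_norm; [exact: cont_fst|exact: cont_snd].
have cp : compact (`[-2, 2]%classic `*` `[-2, 2]%classic : set plane).
  by apply: compact_setX; exact: segment_compact.
have -> : O = (`[-2, 2]%classic `*` `[-2, 2]%classic : set plane) `&`
    [set z : plane | `|z.1| + `|z.2| <= 3].
  apply/seteqP; split=> [z [z1 z2 z3]|z [[]]] /=.
    by split=> //; split=> /=; rewrite in_itv /= -ler_norml.
  by rewrite /= !in_itv /= -!ler_norml.
exact: compact_closedI.
Qed.

End Octagon.

Section Polar.
Variable R : realType.
Local Notation plane := (R * R)%type.

(** Polar coordinates with the half-turn as the unit of angle, which is the period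
    of the projective line. *)
Definition ray (k s : R) : plane := (k * cos (pi * s), k * sin (pi * s)).

Lemma cross_ray k s k' s' : cross (ray k s) (ray k' s') = k * k' * sin (pi * (s' - s)).
Proof. by rewrite /cross /ray /= mulrBr sinB; ring. Qed.

Lemma rayDz k s (n : int) : ray k (s + (2 * n)%:~R) = ray k s.
Proof.
have E : pi * (s + (2 * n)%:~R) = 2 * pi * (s / 2 + n%:~R) :> R.
  have gen (p m : R) : p * (s + 2 * m) = 2 * p * (s / 2 + m) by field.
  by rewrite intrM gen.
have E2 : pi * s = 2 * pi * (s / 2) :> R.
  have gen (p : R) : p * s = 2 * p * (s / 2) by field.
  exact: gen.
by have := circDz (s / 2) n; rewrite /Defs.circ /ray E E2 => -[-> ->].
Qed.

Lemma ray_exists (v : plane) : v != 0 -> exists k s, 0 < k /\ v = ray k s.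
Proof.
move=> v0; pose k := Num.sqrt (v.1 ^+ 2 + v.2 ^+ 2).
have kpos : 0 < v.1 ^+ 2 + v.2 ^+ 2.
  rewrite lt_neqAle addr_ge0 ?sqr_ge0 // andbT eq_sym paddr_eq0 ?sqr_ge0 // !sqrf_eq0.
  by apply: contraNN v0 => /andP[/eqP v1 /eqP v2]; apply/eqP; apply: plane_eq.
have k0 : 0 < k by rewrite sqrtr_gt0.
have k2 : k ^+ 2 = v.1 ^+ 2 + v.2 ^+ 2 by rewrite sqr_sqrtr // ltW.
have p0 : (pi : R) != 0 by rewrite gt_eqF // pi_gt0.
have xb : -1 <= v.1 / k <= 1.
  rewrite -ler_norml normrM normfV (gtr0_norm k0) ler_pdivrMr // mul1r.
  have : `|v.1| ^+ 2 <= k ^+ 2 by rewrite k2 real_normK ?num_real // lerDl sqr_ge0.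
  by rewrite ler_pXn2r // ?nnegrE ?normr_ge0 // ltW.
pose a := acos (v.1 / k).
have ca : cos a = v.1 / k by apply: acosK; rewrite in_itv.
have sa : sin a = `|v.2| / k.
  rewrite sin_acos //.
  have -> : 1 - (v.1 / k) ^+ 2 = (v.2 / k) ^+ 2.
    rewrite !expr_div_n k2; have := kpos; move: (v.1 ^+ 2) (v.2 ^+ 2) => x y xy.
    by field; rewrite gt_eqF.
  by rewrite sqrtr_sqr normrM normfV (gtr0_norm k0).
have kn : k != 0 by rewrite gt_eqF.
have [v2|v2] := leP 0 v.2.
  exists k, (a / pi); split=> //; apply: plane_eq; rewrite /= (mulrC pi) divfK // ?ca ?sa.
    by rewrite mulrC divfK.
  by rewrite mulrC ger0_norm // divfK.
exists k, (- a / pi); split=> //; apply: plane_eq; rewrite /= (mulrC pi) divfK // ?cosN ?sinN ?ca ?sa.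
  by rewrite mulrC divfK.
by rewrite ltr0_norm // mulNr opprK mulrC divfK.
Qed.

Lemma sin_pos_lt1 (x : R) : 0 < x < 2 -> 0 < sin (pi * x) -> x < 1.
Proof.
move=> /andP[x0 x2] s0; rewrite ltNge; apply/negP => x1.
have p0 := @pi_gt0 R.
have : 0 <= sin (pi * (x - 1)).
  have h1 : pi * (x - 1) <= pi * 1 by rewrite ler_pM2l //; lra.
  have h0 : 0 <= pi * (x - 1) by rewrite mulr_ge0 ?subr_ge0 // ltW.
  by rewrite mulr1 in h1; apply: sin_ge0_pi; rewrite h0 h1.
have -> : pi * (x - 1) = pi * x - pi :> R by ring.
by rewrite sinB cospi sinpi; lra.
Qed.

Lemma ray_turn (w : plane) k s : 0 < k -> 0 < cross (ray k s) w ->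
  exists k' s', [/\ 0 < k', w = ray k' s' & s < s' < s + 1].
Proof.
move=> k0 c0.
have w0 : w != 0 by apply: contraTneq c0 => ->; rewrite /cross /= !mulr0 subrr ltxx.
have [k' [s1 [k1 Ew]]] := ray_exists w0.
pose m := Num.floor ((s1 - s) / 2).
pose y := s1 - s - (2 * m)%:~R.
have y0 : 0 <= y.
  have := real_floor_le (num_real ((s1 - s) / 2)); rewrite -/m /y intrM => H; lra.
have y2 : y < 2.
  have := real_floorD1_gt (num_real ((s1 - s) / 2)); rewrite -/m /y intrM intrD => H; lra.
pose s' := s + y.
have Ew' : w = ray k' s'.
  rewrite Ew -(rayDz _ _ (- m)) /s' /y; congr (ray _ _).
  by rewrite mulrN intrN; ring.
have sy : 0 < sin (pi * y).
  move: c0; rewrite Ew' cross_ray /s' addrAC subrr add0r.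
  by rewrite pmulr_rgt0 // mulr_gt0.
have yn0 : 0 < y by rewrite lt_neqAle y0 andbT; apply: contraTneq sy => <-; rewrite mulr0 sin0 ltxx.
have y1 : y < 1 by apply: sin_pos_lt1 => //; rewrite yn0.
by exists k', s'; split=> //; apply/andP; split; rewrite /s'; lra.
Qed.

End Polar.

(** * Tangent directions of a parametrised region *)

Section Charts.
Variables (R : realType) (S : atlas R) (HS : is_surface S).
Local Notation plane := (R * R)%type.
Local Notation T := (pts S).

Lemma chart_ex (x : T) : exists a, dom a x.
Proof. by case: HS => _ [[_ H _ _ _] _]. Qed.

(** The inverse of a chart is continuous, because a chart maps open sets to
    relatively open subsets of the half-plane. *)
Lemma chart_cvg (X : Type) (F : set_system X) (FF : Filter F) (h : X -> T) (y : T) a :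
  dom a y -> (\forall w \near F, dom a (h w)) ->
  chart a (h w) @[w --> F] --> chart a y -> h @ F --> y.
Proof.
move=> ay nF cv V; rewrite nbhsE => -[V0 [oV0 V0y] V0V].
case: HS => _ [[od _ inj _ img] _].
have [Q1 [oQ1 E1]] := img a (V0 `&` dom a) (openI oV0 (od a)) (@subIsetr _ _ _).
have [Q2 [oQ2 E2]] := img a (dom a) (od a) (@subset_refl _ _).
have Q1y : Q1 (chart a y).
  have : (chart a @` (V0 `&` dom a)) (chart a y) by exists y.
  by rewrite E1 => -[].
have n1 : \forall w \near F, Q1 (chart a (h w)).
  by apply: cv; apply: open_nbhs_nbhs.
rewrite nbhs_simpl /=; apply: filterS2 nF n1 => w dw Q1w; apply: V0V.
have Hw : (chart a @` dom a) (chart a (h w)) by exists (h w).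
rewrite E2 in Hw.
have : (Q1 `&` @halfplane R) (chart a (h w)) by split=> //; case: Hw.
rewrite -E1 => -[v [V0v dv] Ev].
by rewrite -(inj a v (h w) dv dw Ev).
Qed.

Lemma transition a b (x : T) : dom a x -> dom b x -> exists f, map_rep idfun a b x f.
Proof.
case: HS => _ [_ H] ax bx; have [f [Hf _]] := H a b x ax bx.
by exists f.
Qed.

Local Notation O := (@octagon R).

Lemma smooth2_diff (f : plane -> plane) z : smooth2 f z -> differentiable f z.
Proof. by move=> /smooth2_C1/nbhs_singleton[]. Qed.

Lemma smooth2_cont (f : plane -> plane) z : smooth2 f z -> {for z, continuous f}.
Proof. by move=> /smooth2_diff; exact: differentiable_continuous. Qed.

Section Region.
Variable r : plane -> T.

Lemma region_chart a f z : region_rep O r z a f -> chart a (r z) = f z.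
Proof. by case=> Oz _ _ /nbhs_singleton[]. Qed.

Lemma region_cvg a f z : region_rep O r z a f -> r @ within O (nbhs z) --> r z.
Proof.
move=> Hf; case: (Hf) => Oz az sf nf.
apply: (@chart_cvg _ _ _ _ _ a) => //.
  by rewrite near_withinE; apply: filterS nf => w Hw /Hw[].
rewrite (region_chart Hf).
have cf : f @ within O (nbhs z) --> f z.
  by apply: cvg_trans (smooth2_cont sf); apply: cvg_app; exact: cvg_within.
apply: cvg_trans cf; apply: near_eq_cvg.
by rewrite near_withinE; apply: filterS nf => w Hw /Hw[].
Qed.

(** The chain rule up to the boundary. There the coordinate expressions agree on
    the octagon only, whose convexity makes their derivatives well defined. *)
Lemma region_transition a b f h z : region_rep O r z a f -> region_rep O r z b h ->
  exists2 phi, map_rep idfun a b (r z) phi &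
    forall u, 'D_u h z = 'D_('D_u f z) phi (chart a (r z)).
Proof.
move=> Hf Hh; case: (Hf) => Oz az sf nf; case: (Hh) => _ bz sh nh.
have [phi Hphi] := transition az bz; exists phi; first exact: Hphi.
move=> u.
case: (Hphi) => _ _ sphi nphi.
have df := smooth2_diff sf; have dh := smooth2_diff sh; have dphi := smooth2_diff sphi.
rewrite (region_chart Hf) in dphi *.
have dc : differentiable (phi \o f) z by exact: differentiable_comp.
have agree : \forall w \near z, O w -> h w = (phi \o f) w.
  have nr : \forall w \near z, O w -> dom b (r w) /\ chart b (r w) = phi (chart a (r w)).
    exact: (region_cvg Hf nphi).
  apply: filterS3 nf nh nr => w Hw1 Hw2 Hw3 Ow.
  have [_ <-] := Hw2 Ow; have [_ ->] := Hw3 Ow; by have [_ ->] := Hw1 Ow.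
rewrite (derive_unique_star u dh dc Oz _ agree); last first.
  by move=> w s w1 s01; apply: octagon_convex => //; exact: octagon_ball.
have H1 : 'D_u (phi \o f) z = 'd (phi \o f) z u := deriveE u dc.
have H2 : 'D_('D_u f z) phi (f z) = 'd phi (f z) ('D_u f z) := deriveE _ dphi.
have H3 : 'D_u f z = 'd f z u := deriveE u df.
have H4 : 'd (phi \o f) z u = 'd phi (f z) ('d f z u) :=
  congr1 (fun k : plane -> plane => k u) (diff_comp df dphi).
rewrite H1 H4 H2 H3.
reflexivity.
Qed.

End Region.
End Charts.

Section Directions.
Variables (R : realType) (S : gms_data R) (HS : is_gms S).
Local Notation plane := (R * R)%type.
Local Notation T := (pts S).
Local Notation O := (@octagon R).
Variable r : plane -> T.
Hypothesis Hr : forall z a, O z -> dom a (r z) ->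
  exists f, region_rep O r z a f /\ 0 < Defs.jacobian f z.

Let Hsurf : is_surface S. Proof. by case: HS. Qed.

Lemma jacobian_cross (f : plane -> plane) z u v : differentiable f z ->
  cross ('D_u f z) ('D_v f z) = Defs.jacobian f z * cross u v.
Proof.
move=> df; have E1 := derive_plane u df; have E2 := derive_plane v df.
rewrite E1 E2 /Defs.jacobian.
move: ('D_(1, 0) f z) ('D_(0, 1) f z) => a b.
by rewrite /cross /= /GRing.scale /=; ring.
Qed.

Lemma derive_neq0 (f : plane -> plane) z u : differentiable f z -> 0 < Defs.jacobian f z ->
  u != 0 -> 'D_u f z != 0.
Proof.
move=> df j0; apply: contraNneq => E.
have H v : cross u v = 0.
  have := jacobian_cross u v df; rewrite E.
  have -> : cross 0 ('D_v f z) = 0 :> R by move: ('D_v f z) => w; rewrite /cross /= !mul0r subrr.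
  by move=> /esym/eqP; rewrite mulf_eq0 (gt_eqF j0) orFb => /eqP.
have := H (1, 0); have := H (0, 1); rewrite /cross /= !mulr1 !mulr0 subr0 sub0r => u1 u2.
by apply/eqP; apply: plane_eq => //=; apply/eqP; rewrite -oppr_eq0 u2.
Qed.

Definition is_dir (z u q : plane) := exists a f,
  [/\ region_rep O r z a f, 0 < Defs.jacobian f z & q = tau a (r z) ('D_u f z)].

(** The direction of the image of u at z, seen in the circle through the
    trivialization; it depends on no choice ([dirv_rep]). *)
Definition dirv (u z : plane) : plane := xget 0 (is_dir z u).

Lemma dirv_rep z u b h : region_rep O r z b h -> u != 0 ->
  dirv u z = tau b (r z) ('D_u h z).
Proof.
move=> Hh u0.
have Oz : O z by case: Hh.
have [a az] := chart_ex Hsurf (r z).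
have [f [Hf jf]] := Hr Oz az.
have ex : is_dir z u (tau a (r z) ('D_u f z)) by exists a, f.
have [a' [f' [Hf' jf' E0]]] : is_dir z u (dirv u z) := xgetPex 0 (ex_intro _ _ ex).
rewrite E0 {E0}.
have sf' : smooth2 f' z by case: Hf'.
have df' := smooth2_diff sf'.
have [phi Hphi E] := region_transition Hsurf Hf' Hh.
rewrite E; case: HS => _ _ _ [Ht _ _ _] _.
by rewrite (Ht a' b (r z) phi _ Hphi (derive_neq0 df' jf' u0)).
Qed.

Lemma near_region z a f : region_rep O r z a f ->
  \forall w \near z, O w -> region_rep O r w a f.
Proof.
move=> [Oz az sf nf].
have nf' : \forall w \near z, \forall w' \near w, O w' -> dom a (r w') /\ chart a (r w') = f w'.
  exact: near_join nf.
apply: filterS3 (smooth2_C1 sf) nf nf' => w [sw _ _ _] Hw nw Ow.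
by split=> //; have [] := Hw Ow.
Qed.

Lemma dirv_continuous u : u != 0 -> {within O, continuous (dirv u)}.
Proof.
move=> u0; apply/subspace_continuousP => z Oz.
have [a az] := chart_ex Hsurf (r z).
have [f [Hf jf]] := Hr Oz az.
have [_ _ sf nf] := Hf.
have nr := near_region Hf.
have df := smooth2_diff sf.
pose dd w : plane := u.1 *: 'D_(1, 0) f w + u.2 *: 'D_(0, 1) f w.
have ddE : 'D_u f z = dd z by exact: derive_plane.
have [_ _ c1 c2] := nbhs_singleton (smooth2_C1 sf).
have cd : dd @ z --> dd z by apply: cvgD; apply: cvgZr; [exact: c1|exact: c2].
have dd0 : dd z != 0 by rewrite -ddE; exact: derive_neq0.
have nd0 : \forall w \near z, dd w != 0 by exact: (cvgr_neq0 _ cd).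
have nE : \forall w \near z, O w -> tau a (r w) (dd w) = dirv u w.
  apply: filterS2 nr (smooth2_C1 sf) => w Hw [_ dw _ _] Ow.
  by rewrite (dirv_rep (Hw Ow) u0) (derive_plane _ dw).
suff H : (fun w => dirv u w) @ within O (nbhs z) --> dirv u z by exact: H.
have E : dirv u z = tau a (r z) (dd z) by rewrite (dirv_rep Hf u0) ddE.
rewrite E.
have key : (fun w => tau a (r w) (dd w)) @ within O (nbhs z) --> tau a (r z) (dd z).
  case: HS => _ _ _ [_ _ ct _] _.
  have /subspace_continuousP/(_ (r z, dd z)) := ct a; move=> /(_ (conj az dd0)) ct'.
  have cpair : (fun w => (r w, dd w)) @ within O (nbhs z) -->
      within [set y : T * plane | dom a y.1 /\ y.2 != 0] (nbhs (r z, dd z)).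
    have c0 : (fun w => (r w, dd w)) @ within O (nbhs z) --> (r z, dd z).
      have cd' : dd @ within O (nbhs z) --> dd z.
        by apply: cvg_trans cd; apply: cvg_app; exact: cvg_within.
      exact: cvg_pair (region_cvg Hsurf Hf) cd'.
    move=> U HU.
    have H1 : \forall w \near z, O w -> dom a (r w) /\ dd w != 0 -> U (r w, dd w) := c0 _ HU.
    apply: filterS3 H1 nf nd0 => w Hw1 Hw2 Hw3 Ow; apply: Hw1 => //; split=> //.
    by have [] := Hw2 Ow.
  exact: (cvg_comp _ _ cpair ct').
apply: cvg_trans key; apply: near_eq_cvg; rewrite near_withinE.
by apply: filterS nE => w Hw Ow; rewrite Hw.
Qed.

End Directions.

(** * Simultaneous lifts of four directions *)

Section Directions.
Variables (R : realType) (S : gms_data R) (HS : is_gms S).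
Local Notation plane := (R * R)%type.
Local Notation T := (pts S).
Local Notation O := (@octagon R).

Let Hsurf : is_surface S. Proof. by case: HS. Qed.

Lemma tau_circ a (x : T) v : dom a x -> v != 0 -> exists t, tau a x v = circ t.
Proof.
move=> ax v0; have [k [s [k0 ->]]] := ray_exists v0.
case: HS => _ _ _ [_ H _ _] _; have [h [_ _ _ Hh]] := H a x ax.
by exists (h s); rewrite -(Hh k s) // gt_eqF.
Qed.

Lemma tau_scale a (x : T) v (k : R) : dom a x -> v != 0 -> k != 0 -> tau a x (k *: v) = tau a x v.
Proof.
move=> ax v0 k0; have [m [s [m0 ->]]] := ray_exists v0.
case: HS => _ _ _ [_ H _ _] _; have [h [_ _ _ Hh]] := H a x ax.
have mn0 : m != 0 by rewrite gt_eqF.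
rewrite /ray (Hh m s mn0) -(Hh (k * m) s (mulf_neq0 k0 mn0)).
by congr (tau a x _); apply: plane_eq; rewrite /= /GRing.scale /= mulrA.
Qed.

Variable r : plane -> T.
Hypothesis Hr : forall z a, O z -> dom a (r z) ->
  exists f, region_rep O r z a f /\ 0 < Defs.jacobian f z.
Local Notation dirv := (@dirv R S r).

(** The directions of the loop, of the corner segments next to Y, of the sides and
    of the diagonal, in the cyclic order of the lines. *)
Definition udir (i : nat) : plane :=
  match i with 0%N => (1, 0) | 1%N => (1, 1) | 2%N => (0, 1) | _ => (-1, 1) end.

Lemma udir_neq0 i : udir i != 0.
Proof.
apply/eqP => /(congr1 (fun v : plane => v.1 ^+ 2 + v.2 ^+ 2)).
by case: i => [|[|[|i]]] /=; lra.
Qed.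

Lemma udir_cross i j : (i < j <= 3)%N -> 0 < cross (udir i) (udir j).
Proof.
move: i j => [|[|[|i]]] [|[|[|[|j]]]] H; try (by exfalso; lia); rewrite /cross /=; lra.
Qed.

Lemma dirv_circ i z : O z -> exists t, dirv (udir i) z = circ t.
Proof.
move=> Oz; have [a az] := chart_ex Hsurf (r z).
have [f [Hf jf]] := Hr Oz az.
rewrite (dirv_rep HS Hr Hf (udir_neq0 i)); apply: (tau_circ az).
have df : differentiable f z by case: Hf => _ _ /smooth2_diff.
exact: derive_neq0 df jf (udir_neq0 i).
Qed.

(** The parametrisation preserves the orientation, hence the cyclic order of the
    four lines, and so does the trivialization. *)
Lemma four_turns z : O z -> exists t0 t1 t2 t3,
  [/\ t0 < t1, t1 < t2, t2 < t3 & t3 < t0 + 1] /\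
  [/\ dirv (udir 0) z = circ t0, dirv (udir 1) z = circ t1,
      dirv (udir 2) z = circ t2 & dirv (udir 3) z = circ t3].
Proof.
move=> Oz; have [a az] := chart_ex Hsurf (r z).
have [f [Hf jf]] := Hr Oz az.
have df : differentiable f z by case: Hf => _ _ /smooth2_diff.
pose V i := 'D_(udir i) f z.
have cr i j : 0 < cross (udir i) (udir j) -> 0 < cross (V i) (V j).
  by move=> H; rewrite /V (jacobian_cross _ _ df) mulr_gt0.
have V0 : V 0%N != 0 := derive_neq0 df jf (udir_neq0 0).
have [k0 [s0 [k00 E0]]] := ray_exists V0.
have c01 : 0 < cross (V 0%N) (V 1%N) by apply: cr; apply: udir_cross.
have c12 : 0 < cross (V 1%N) (V 2%N) by apply: cr; apply: udir_cross.
have c23 : 0 < cross (V 2%N) (V 3%N) by apply: cr; apply: udir_cross.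
have c02 : 0 < cross (V 0%N) (V 2%N) by apply: cr; apply: udir_cross.
have c03 : 0 < cross (V 0%N) (V 3%N) by apply: cr; apply: udir_cross.
rewrite E0 in c01 c02 c03.
have [k1 [s1 [k10 E1 /andP[s01 s01']]]] := ray_turn k00 c01.
rewrite E1 in c12.
have [k2 [s2 [k20 E2 /andP[s12 s12']]]] := ray_turn k10 c12.
rewrite E2 in c23 c02.
have [k3 [s3 [k30 E3 /andP[s23 s23']]]] := ray_turn k20 c23.
rewrite E3 in c03.
have lt1 k s : 0 < k -> 0 < s - s0 < 2 -> 0 < cross (ray k0 s0) (ray k s) -> s - s0 < 1.
  move=> kp b; rewrite cross_ray pmulr_rgt0 ?mulr_gt0 //; exact: sin_pos_lt1.
have b2 : 0 < s2 - s0 < 2 by clear -s01 s01' s12 s12'; apply/andP; split; lra.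
have s02 : s2 - s0 < 1 := lt1 k2 s2 k20 b2 c02.
have b3 : 0 < s3 - s0 < 2 by clear -s01 s01' s12 s12' s23 s23' s02; apply/andP; split; lra.
have s03 : s3 - s0 < 1 := lt1 k3 s3 k30 b3 c03.
case: HS => _ _ _ [_ H _ _] _; have [h [_ hmono h1 Hh]] := H a (r z) az.
have dE i k s : 0 < k -> V i = ray k s -> dirv (udir i) z = circ (h s).
  move=> k_0 E; rewrite (dirv_rep HS Hr Hf (udir_neq0 i)) -/(V i) E.
  by apply: Hh; rewrite gt_eqF.
exists (h s0), (h s1), (h s2), (h s3); split; last first.
  by split; [exact: dE E0|exact: dE E1|exact: dE E2|exact: dE E3].
have s30 : s3 < s0 + 1 by rewrite -ltrBlDl.
by split; [exact: hmono|exact: hmono|exact: hmono|rewrite -h1; exact: hmono].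
Qed.

Lemma int_not_between (k : int) : ~ (0 < (k%:~R : R) < 1).
Proof.
move=> /andP[k0 k1]; have : (0 < k) && (k < 1); last by lia.
by rewrite -(ltr_int R) -(ltr_int R) k0 k1.
Qed.

Lemma cyclic_between (t : nat -> R) i j :
  t 0%N < t 1%N -> t 1%N < t 2%N -> t 2%N < t 3%N -> t 3%N < t 0%N + 1 ->
  (i < j <= 3)%N -> 0 < t j - t i < 1.
Proof.
move=> h1 h2 h3 h4; move: i j => [|[|[|i]]] [|[|[|[|j]]]] H; try (by exfalso; lia);
  by apply/andP; split; lra.
Qed.

(** Adding integers puts the lifts in order at the centre. By [four_turns] the
    difference of two of them is never an integer, so that the order persists
    along the segments from the centre. *)
Lemma direction_lifts : exists th : nat -> plane -> R,
  [/\ forall i, {within O, continuous (th i)},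
      forall i z, O z -> circ (th i z) = dirv (udir i) z &
      forall i j z, (i < j <= 3)%N -> O z -> th i z < th j z < th i z + 1].
Proof.
have lift i : exists th : plane -> R,
    {within O, continuous th} /\ forall z, O z -> circ (th z) = dirv (udir i) z.
  have [th c1 c2] := circle_lift (@compact_octagon R) (@octagon0 R) (@octagon_scale R)
    (dirv_continuous HS Hr (udir_neq0 i)) (@dirv_circ i).
  by exists th.
have [th0 Hth0] := choice lift.
have [t0 [t1 [t2 [t3 [[l01 l12 l23 l30] [E0 E1 E2 E3]]]]]] := four_turns (@octagon0 R).
pose t i := match i with 0%N => t0 | 1%N => t1 | 2%N => t2 | _ => t3 end.
have Et i : (i <= 3)%N -> dirv (udir i) 0 = circ (t i) by case: i => [|[|[|[|]]]].
have [n Hn] : exists n : nat -> int, forall i, (i <= 3)%N -> t i = th0 i 0 + (n i)%:~R.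
  have : forall i, exists n : int, (i <= 3)%N -> t i = th0 i 0 + n%:~R.
    move=> i; case: (leqP i 3) => [i3|]; last by exists 0.
    have [m Em] : exists m : int, t i = th0 i 0 + m%:~R.
      by apply: circ_eq; rewrite -Et // (Hth0 i).2 //; exact: octagon0.
    by exists m.
  by move=> /choice[n Hn]; exists n.
pose th i z := th0 i z + (n i)%:~R.
have thc i : {within O, continuous (th i)}.
  have /subspace_continuousP c0 := (Hth0 i).1.
  by apply/subspace_continuousP => z Oz; apply: cvgD; [exact: c0|exact: cvg_cst].
have thE i z : O z -> circ (th i z) = dirv (udir i) z.
  by move=> Oz; rewrite circDz (Hth0 i).2.
exists th; split=> // i j z /andP[ij j3] Oz.
pose d s := th j (s *: z) - th i (s *: z).
have d0 : 0 < d 0 < 1.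
  have i3 : (i <= 3)%N by apply: leq_trans (ltnW ij) j3.
  rewrite /d /th scale0r -!Hn //.
  by apply: (@cyclic_between t); rewrite ?ij.
have dn s : 0 <= s <= 1 -> forall k : int, d s <> k%:~R.
  move=> s01 k Ed; have Os := octagon_scale Oz s01.
  have [u0 [u1 [u2 [u3 [[m01 m12 m23 m30] [F0 F1 F2 F3]]]]]] := four_turns Os.
  pose u l := match l with 0%N => u0 | 1%N => u1 | 2%N => u2 | _ => u3 end.
  have Eu l : (l <= 3)%N -> dirv (udir l) (s *: z) = circ (u l) by case: l => [|[|[|[|]]]].
  have i3 : (i <= 3)%N by apply: leq_trans (ltnW ij) j3.
  have [a Ea] : exists a : int, u i = th i (s *: z) + a%:~R.
    by apply: circ_eq; rewrite -Eu // thE.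
  have [b Eb] : exists b : int, u j = th j (s *: z) + b%:~R.
    by apply: circ_eq; rewrite -Eu // thE.
  have : u j - u i = (k + b - a)%:~R.
    by rewrite Ea Eb intrB intrD -Ed /d; ring.
  have : 0 < u j - u i < 1.
    by apply: (@cyclic_between u); rewrite ?ij.
  by move=> + E; rewrite E; exact: int_not_between.
have dc : {within `[0, 1], continuous d}.
  apply/subspace_continuousP => s; rewrite /= in_itv /= => s01.
  have Os := octagon_scale Oz s01.
  have cs : (fun s : R => s *: z) @ within `[0, 1] (nbhs s) --> within O (nbhs (s *: z)).
    have c0 : (fun s : R => s *: z) @ s --> s *: z by apply: cvgZl; exact: cvg_id.
    move=> U HU; have H1 : \forall s' \near s, O (s' *: z) -> U (s' *: z) := c0 _ HU.
    rewrite nbhs_simpl /= /within /=; apply: filterS H1 => s' Hs'.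
    by rewrite in_itv /= => s01'; apply: Hs'; exact: octagon_scale.
  by apply: cvgB; [move/subspace_continuousP: (thc j) => /(_ _ Os)|
                   move/subspace_continuousP: (thc i) => /(_ _ Os)]; exact: cvg_comp.
have d1 : 0 < d 1 < 1.
  have /andP[d00 d01] := d0.
  apply/andP; split; rewrite ltNge; apply/negP => H.
    have [s] := @IVT R d 0 1 0 ler01 dc (ltac:(by rewrite ge_min le_max H (ltW d00) orbT)).
    by rewrite in_itv /= => s01 E; case: (dn s s01 0).
  have [s] := @IVT R d 0 1 1 ler01 dc (ltac:(by rewrite ge_min le_max H (ltW d01) orbT)).
  by rewrite in_itv /= => s01 E; case: (dn s s01 1).
by move: d1; rewrite /d scale1r => /andP[h1 h2]; apply/andP; split; lra.
Qed.

End Directions.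

(** * Gradings of curves along straight lines *)

Lemma is_derive1_comp_vec (R : realType) (V : normedModType R) (f : R -> V) (al : R -> R) (t : R) :
  derivable f (al t) 1 -> derivable al t 1 ->
  is_derive t (1 : R) (f \o al) (derive1 al t *: derive1 f (al t)).
Proof.
move=> df dal; have Df := (derivable1_diffP _ _).1 df; have Dal := (derivable1_diffP _ _).1 dal.
have Dc : differentiable (f \o al) t := differentiable_comp Dal Df.
split; first exact: diff_derivable Dc.
have H1 : 'D_1 (f \o al) t = 'd (f \o al) t 1 := @deriveE R R V (f \o al) t (1 : R) Dc.
have H2 : 'd (f \o al) t 1 = 'd f (al t) ('d al t 1) :=
  congr1 (fun k : R -> V => k 1) (diff_comp Dal Df).
have H3 : 'd al t 1 = 1 *: derive1 al t := congr1 (fun k : R -> R => k 1) (deriv1E dal).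
have H4 (x : R) : 'd f (al t) x = x *: derive1 f (al t) :=
  congr1 (fun k : R -> V => k x) (deriv1E df).
by rewrite H1 H2 H4 H3 scale1r.
Qed.

Lemma real_derivable_cont (R : realType) (f : R -> R) t : derivable f t 1 -> f @ t --> f t.
Proof. by move=> /derivable1_diffP/differentiable_continuous. Qed.

Section Curves.
Variables (R : realType) (S : gms_data R) (HS : is_gms S).
Local Notation plane := (R * R)%type.
Local Notation T := (pts S).
Local Notation O := (@octagon R).
Variable r : plane -> T.
Hypothesis Hr : forall z a, O z -> dom a (r z) ->
  exists f, region_rep O r z a f /\ 0 < Defs.jacobian f z.
Local Notation dirv := (@dirv R S r).
Let Hsurf : is_surface S. Proof. by case: HS. Qed.

(** In this section the curve [C], reparametrised by [al], follows the line through
    [z0] in the direction [u], reparametrised by [be], in the region. *)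
Section OneCurve.
Variables (I : set R) (C : R -> T) (theta al be : R -> R) (z0 u : plane) (a b : R).
Hypotheses (ab : a < b) (HC : immersed_curve I C) (Hth : is_grading (@tau R S) I C theta)
  (u0 : u != 0) (dal : forall t, derivable al t 1) (dbe : forall t, derivable be t 1)
  (al0 : forall t, a <= t <= b -> derive1 al t != 0)
  (be0 : forall t, a <= t <= b -> derive1 be t != 0)
  (HI : forall t, a <= t <= b -> I (al t))
  (HO : forall t, a <= t <= b -> O (z0 + be t *: u))
  (Heq : forall t, a <= t <= b -> C (al t) = r (z0 + be t *: u)).

Lemma line_cont (t : R) : (fun s => z0 + be s *: u) @ t --> z0 + be t *: u.
Proof.
apply: cvgD; first exact: cvg_cst.
by apply: cvgZl; exact: real_derivable_cont.
Qed.

(** The two expressions of the curve in a chart agree on the interval only, which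
    determines their velocities; these are proportional, and the trivialization
    only sees the line that they span. *)
Lemma curve_dir t : a <= t <= b -> circ (theta (al t)) = dirv u (z0 + be t *: u).
Proof.
move=> tab.
set y := z0 + be t *: u.
have Oy : O y := HO tab.
have [c cy] := chart_ex Hsurf (r y).
have [F [HF jF]] := Hr Oy cy.
have cC : dom c (C (al t)) by rewrite Heq.
have [f [Hf f0]] := HC (HI tab) cC.
have vel : is_velocity I C (al t) c (derive1 f (al t)) by exists f.
have Hd := Hth.2 _ _ _ vel.
have [_ _ sf nf] := Hf; have [_ _ sF nF] := HF.
have df : derivable f (al t) 1 := (nbhs_singleton sf) 0%N.
have dF := smooth2_diff sF.
pose l (s : R) : plane := F (z0 + s *: u).
have ldv : is_derive (be t) (1 : R) l ('D_u F y) by apply: is_derive_line; exact: diff_derivable dF.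
have [dl El] := ldv.
have [d1 E1] := is_derive1_comp_vec df (@dal t).
have [d2 E2] := is_derive1_comp_vec dl (@dbe t).
have agree : \forall s \near t, a <= s <= b -> (f \o al) s = (l \o be) s.
  have n1 : \forall s \near t, I (al s) -> dom c (C (al s)) /\ chart c (C (al s)) = f (al s).
    exact: (real_derivable_cont (@dal t) nf).
  have n2 : \forall s \near t, O (z0 + be s *: u) ->
      dom c (r (z0 + be s *: u)) /\ chart c (r (z0 + be s *: u)) = F (z0 + be s *: u).
    exact: (line_cont nF).
  apply: filterS2 n1 n2 => s Hs1 Hs2 sab.
  have [_ E1'] := Hs1 (HI sab); have [_ E2'] := Hs2 (HO sab).
  by rewrite (Heq sab) E2' in E1'.
have E := derive1_unique ab tab d1 d2 agree.
rewrite !derive1E in E; rewrite E1 E2 in E.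
rewrite [X in _ = _ *: X]derive1E El in E.
have al_n0 := al0 tab; have be_n0 := be0 tab.
have Ef : derive1 f (al t) = ((derive1 al t)^-1 * derive1 be t) *: 'D_u F y.
  by rewrite -scalerA -E scalerA (mulVf al_n0) scale1r.
rewrite -Hd Ef (Heq tab) -/y (tau_scale HS cy).
- by rewrite (dirv_rep HS Hr HF u0).
- exact: derive_neq0 dF jF u0.
- exact: mulf_neq0 (invr_neq0 al_n0) be_n0.
Qed.

(** Two lifts of the same direction differ by an integer that varies
    continuously. *)
Lemma curve_lift (th : plane -> R) : {within O, continuous th} ->
  (forall z, O z -> circ (th z) = dirv u z) ->
  exists n : int, forall t, a <= t <= b -> theta (al t) = th (z0 + be t *: u) + n%:~R.
Proof.
move=> cth Hthz.
pose d t := theta (al t) - th (z0 + be t *: u).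
have dn t : a <= t <= b -> exists n : int, d t = n%:~R.
  move=> tab; have [n En] := circ_eq (etrans (curve_dir tab) (esym (Hthz _ (HO tab)))).
  by exists n; rewrite /d En addrAC subrr add0r.
have aI : a <= a <= b by rewrite lexx ltW.
have [n En] := dn a aI; exists n => t tab.
have /andP[at_ tb] := tab.
suff Ed : d t = d a by rewrite -En -Ed /d addrC subrK.
apply: int_valued_const => //; last first.
  by move=> s /andP[as_ st]; apply: dn; rewrite as_ (le_trans st tb).
apply/subspace_continuousP => s; rewrite /= in_itv /= => /andP[as_ st].
have sab : a <= s <= b by rewrite as_ (le_trans st tb).
have sub x : x \in `[a, t] -> a <= x <= b.
  by rewrite in_itv /= => /andP[-> xt]; exact: le_trans xt tb.
have c1 : al @ within `[a, t] (nbhs s) --> within I (nbhs (al s)).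
  move=> U HU; have H1 : \forall x \near s, I (al x) -> U (al x) := real_derivable_cont (@dal s) HU.
  rewrite nbhs_simpl /= /within /=; apply: filterS H1 => x Hx xI; apply: Hx.
  by apply: HI; exact: sub.
have c2 : (fun x => z0 + be x *: u) @ within `[a, t] (nbhs s) --> within O (nbhs (z0 + be s *: u)).
  move=> U HU; have H1 : \forall x \near s, O (z0 + be x *: u) -> U (z0 + be x *: u) := line_cont HU.
  rewrite nbhs_simpl /= /within /=; apply: filterS H1 => x Hx xI; apply: Hx.
  by apply: HO; exact: sub.
have /subspace_continuousP/(_ _ (HI sab)) ct := Hth.1.
have /subspace_continuousP/(_ _ (HO sab)) ch := cth.
apply: cvgB; [exact: (cvg_comp _ _ c1 ct)|exact: (cvg_comp _ _ c2 ch)].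
Qed.

End OneCurve.
End Curves.

(** * The involution on arcs and marked segments *)

Section Interval.
Variable R : realType.
Local Notation unitI := (@unitI R).

Lemma unitI_itv : unitI = `[0, 1]%classic :> set R.
Proof. by apply/seteqP; split=> t; rewrite /= in_itv. Qed.

Lemma unitI_bool (b : bool) : unitI b%:R.
Proof. by case: b; rewrite /unitI /= ?lexx ler01. Qed.

Lemma unit_mono (f : R -> R) : {within unitI, continuous f} ->
  (forall s t, unitI s -> unitI t -> f s = f t -> s = t) ->
  (forall s t, unitI s -> unitI t -> s < t -> f s < f t) \/
  (forall s t, unitI s -> unitI t -> s < t -> f t < f s).
Proof.
rewrite {1}unitI_itv => cf inj.
have inj' : {in `[0, 1] &, injective f}.
  by move=> s t sI tI; apply: inj; rewrite unitI_itv.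
have [H|H] := itv_continuous_inj_mono cf inj'; [left|right] => s t sI tI st.
  by apply: H => //; move: sI tI; rewrite unitI_itv.
by apply: H => //; move: sI tI; rewrite unitI_itv.
Qed.

Lemma increasing_involution (f : R -> R) :
  (forall t, unitI t -> unitI (f t) /\ f (f t) = t) ->
  (forall s t, unitI s -> unitI t -> s < t -> f s < f t) ->
  forall t, unitI t -> f t = t.
Proof.
move=> inv mono t tI; have [fI ff] := inv t tI.
have [lt|gt|//] := ltgtP (f t) t.
  by have := mono _ _ fI tI lt; rewrite ff => /(lt_trans lt); rewrite ltxx.
by have := mono _ _ tI fI gt; rewrite ff => /(lt_trans gt); rewrite ltxx.
Qed.

Lemma diffeo_within (f : R -> R) : (forall t, derivable f t 1) -> {within unitI, continuous f}.
Proof.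
move=> df; apply/subspace_continuousP => t _.
by apply: cvg_trans (real_derivable_cont (df t)); apply: cvg_app; exact: cvg_within.
Qed.

(** By Rolle's theorem a reparametrisation is injective, hence monotone. *)
Lemma reparam_ends (f : R -> R) : (forall t, derivable f t 1) ->
  (forall t, unitI t -> derive1 f t != 0) -> f @` unitI = unitI ->
  exists e : bool, forall b : bool, f b%:R = (b (+) e)%:R.
Proof.
move=> df f0 fim.
have inj s t : unitI s -> unitI t -> f s = f t -> s = t.
  wlog st : s t / s < t => [W|] sI tI E.
    by have [lt|gt|//] := ltgtP s t; [exact: (W s t)|apply/esym/(W t s)].
  have cf : {within `[s, t], continuous f}.
    by apply: continuous_subspaceT => y; exact: real_derivable_cont.
  have [c cst [_ Ec]] := @Rolle _ f s t st (fun x _ => df x) cf E.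
  have cI : unitI c.
    move: cst sI tI; rewrite in_itv /= => /andP[sc ct] /andP[s0 _] /andP[_ t1].
    by rewrite /Defs.unitI /= (le_trans s0 (ltW sc)) (le_trans (ltW ct) t1).
  by have := @f0 c cI; rewrite derive1E Ec eqxx.
have fI t : unitI t -> unitI (f t) by move=> tI; rewrite -fim; exists t.
have I0 := unitI_bool false; have I1 := unitI_bool true.
have [s0 s0I Es0] : (f @` unitI) 0 by rewrite fim.
have [s1 s1I Es1] : (f @` unitI) 1 by rewrite fim.
have le_end (s : R) : unitI s -> (s = 0 \/ 0 < s) /\ (s = 1 \/ s < 1).
  move=> /andP[s_0 s_1]; split.
    by move: s_0; rewrite le_eqVlt => /orP[/eqP <-|]; [left|right].
  by move: s_1; rewrite le_eqVlt => /orP[/eqP <-|]; [left|right].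
have /andP[f00 f01] := fI _ I0; have /andP[f10 f11] := fI _ I1.
have [mono|mono] := unit_mono (diffeo_within df) inj.
  exists false => b; rewrite addbF; case: b => /=.
    have [_ [E|lt]] := le_end _ s1I; first by move: Es1; rewrite E.
    by have := mono _ _ s1I I1 lt; rewrite Es1 => H; move: f11; rewrite leNgt H.
  have [[E|lt] _] := le_end _ s0I; first by move: Es0; rewrite E.
  by have := mono _ _ I0 s0I lt; rewrite Es0 => H; move: f00; rewrite leNgt H.
exists true => b; rewrite addbT; case: b => /=.
  have [_ [E|lt]] := le_end _ s0I; first by move: Es0; rewrite E.
  by have := mono _ _ s0I I1 lt; rewrite Es0 => H; move: f10; rewrite leNgt H.
have [[E|lt] _] := le_end _ s1I; first by move: Es1; rewrite E.
by have := mono _ _ I0 s1I lt; rewrite Es1 => H; move: f01; rewrite leNgt H.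
Qed.

End Interval.

Section Involution.
Variables (R : realType) (S : gms_data R) (HS : is_gms S).
Local Notation plane := (R * R)%type.
Local Notation T := (pts S).
Local Notation unitI := (@unitI R).
Let Hsurf : is_surface S. Proof. by case: HS. Qed.

Lemma invgK (x : T) : invg (invg x) = x.
Proof. by case: HS => _ _ _ _ [[_ H _ _ _] _]. Qed.

Lemma invg_cont : continuous (@invg R S).
Proof.
move=> x.
have [a ax] := chart_ex Hsurf x; have [b bx] := chart_ex Hsurf (invg x).
have [f [[_ _ sf nf] _]] : exists f, map_rep (@invg R S) a b x f /\ 0 < Defs.jacobian f (chart a x).
  by case: HS => _ _ _ _ [[H _ _ _ _] _]; exact: H.
have ca : chart a @ x --> chart a x.
  have od : open (dom a) by case: Hsurf => _ [[H _ _ _ _] _].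
  have : {within dom a, continuous (chart a)} by case: Hsurf => _ [[_ _ _ H _] _].
  move=> /subspace_continuousP/(_ _ ax) H U HU.
  have H1 : \forall y \near x, dom a y -> U (chart a y) := H _ HU.
  have H2 : \forall y \near x, dom a y by exact: open_nbhs_nbhs.
  by rewrite nbhs_simpl /=; apply: filterS2 H1 H2 => y Hy; exact: Hy.
apply: (@chart_cvg _ _ Hsurf _ _ _ _ _ b bx); first by apply: filterS nf => y [].
have [_ ->] := nbhs_singleton nf.
have H : f (chart a y) @[y --> x] --> f (chart a x) by exact: (cvg_comp _ _ ca (smooth2_cont sf)).
apply: cvg_trans H; apply: near_eq_cvg.
by apply: filterS nf => y [_ ->].
Qed.

Lemma mseg_rep (k : 'I_(nM S)) : immersed_curve unitI (mseg k).
Proof.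
move=> t a tI at_; case: HS => _ [_ _ H _ _] _ _ _.
have [f [Hf f0]] := H k t a tI at_; exists f; split=> //.
by apply: contraTneq f0 => ->; rewrite /= ltxx.
Qed.

Lemma mseg_inj (k l : 'I_(nM S)) s t : unitI s -> unitI t -> mseg k s = mseg l t :> T -> k = l /\ s = t.
Proof. by case: HS => _ [_ _ _ H _] _ _ _; exact: H. Qed.

Lemma mseg_cont (k : 'I_(nM S)) : {within unitI, continuous (mseg k : R -> T)}.
Proof.
apply/subspace_continuousP => t tI.
have [a at_] := chart_ex Hsurf (mseg k t).
have [f [[_ _ sf nf] _]] := mseg_rep tI at_.
apply: (@chart_cvg _ _ Hsurf _ _ _ _ _ a at_).
  by rewrite near_withinE; apply: filterS nf => s Hs /Hs[].
have [_ ->] := nbhs_singleton nf tI.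
have cf : f @ within unitI (nbhs t) --> f t.
  have df : derivable f t 1 := (nbhs_singleton sf) 0%N.
  have cf : f @ t --> f t by move/derivable1_diffP: df; exact: differentiable_continuous.
  by apply: cvg_trans cf; apply: cvg_app; exact: cvg_within.
apply: cvg_trans cf; apply: near_eq_cvg.
by rewrite near_withinE; apply: filterS nf => s Hs /Hs[_ ->].
Qed.

(** On a marked segment, the involution would be an increasing involution of an
    interval, hence the identity. *)
Lemma no_invariant_segment (k : 'I_(nM S)) p q p' q' :
  unitI p -> unitI q -> unitI p' -> unitI q' -> p < q -> p' < q' ->
  invg (mseg k p) = mseg k p' -> invg (mseg k q) = mseg k q' -> p = p'.
Proof.
move=> pI qI p'I q'I pq p'q' Ep Eq.
have [l Hl] : exists l, (@invg R S) @` (mseg k @` unitI) = mseg l @` unitI.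
  by case: HS => _ _ _ _ [[_ _ _ H _] _]; exact: H.
have lk : l = k.
  have : ((@invg R S) @` (mseg k @` unitI)) (mseg k p').
    by exists (mseg k p) => //; exists p.
  by rewrite Hl => -[s sI /(mseg_inj sI p'I)[]].
rewrite lk in Hl.
have ex t : exists s, unitI t -> unitI s /\ invg (mseg k t) = mseg k s.
  have [tI|tI] := pselect (unitI t); last by exists 0.
  have : ((@invg R S) @` (mseg k @` unitI)) (invg (mseg k t)).
    by exists (mseg k t) => //; exists t.
  by rewrite Hl => -[s sI E]; exists s.
have [f Hf] := choice ex.
have fI t : unitI t -> unitI (f t) by move=> /Hf[].
have fE t : unitI t -> invg (mseg k t) = mseg k (f t) by move=> /Hf[].
have ff t : unitI t -> f (f t) = t.
  move=> tI; have := fE _ (fI _ tI); rewrite -(fE _ tI) invgK => E.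
  by have [_ /esym] := mseg_inj tI (fI _ (fI _ tI)) E.
have inj s t : unitI s -> unitI t -> f s = f t -> s = t.
  by move=> sI tI E; rewrite -(ff _ sI) E ff.
(* the marked segment is embedded, as the image of a compact interval *)
have cf : {within unitI, continuous f}.
  apply/subspace_continuousP => t tI U; rewrite nbhsE => -[V [oV Vt] VU].
  pose C := ~` V `&` unitI.
  have cC : compact C.
    rewrite /C setIC; apply: compact_closedI; last exact: open_closedC.
    by rewrite unitI_itv; exact: segment_compact.
  have clK : closed (mseg k @` C : set T).
    apply: compact_closed; first by case: Hsurf => [[H _ _ _] _]; exact: H.
    apply: continuous_compact => //.
    have CI : C `<=` unitI by move=> s [].
    exact: (continuous_subspaceW CI (@mseg_cont k)).
  have nK : (~` (mseg k @` C : set T)) (invg (mseg k t)).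
    move=> [s [sV sI]]; rewrite (fE _ tI) => /(mseg_inj sI (fI _ tI))[_ E].
    by apply: sV; rewrite E.
  have cg : (fun s => invg (mseg k s)) @ within unitI (nbhs t) --> invg (mseg k t).
    have /subspace_continuousP/(_ _ tI) cm := @mseg_cont k.
    exact: (cvg_comp _ _ cm (@invg_cont _)).
  have nb : nbhs (invg (mseg k t)) (~` (mseg k @` C : set T)).
    by apply: open_nbhs_nbhs; split=> //; exact: closed_openC.
  have H1 : \forall s \near t, unitI s -> ~ (mseg k @` C : set T) (invg (mseg k s)) := cg _ nb.
  rewrite nbhs_simpl /= /within /=; apply: filterS H1 => s Hs sI; apply: VU.
  apply: contrapT => nV; apply: (Hs sI); exists (f s); last by rewrite -fE.
  by split=> //; exact: fI.
have fp : f p = p' by have [_] := mseg_inj (fI _ pI) p'I (etrans (esym (fE _ pI)) Ep).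
have fq : f q = q' by have [_] := mseg_inj (fI _ qI) q'I (etrans (esym (fE _ qI)) Eq).
have [mono|mono] := unit_mono cf inj; last first.
  by have := mono _ _ pI qI pq; rewrite fp fq => /(lt_trans p'q'); rewrite ltxx.
by rewrite -fp (increasing_involution _ mono pI) // => t tI; split; [exact: fI|exact: ff].
Qed.

Variables (D : arcs_data S) (HD : full_system D) (HG : invariant_system D).

Lemma arc_inj (i j : aidx D) s t : unitI s -> unitI t -> Defs.arc i s = Defs.arc j t -> i = j /\ s = t.
Proof. by case: HD => [[_ _ _ H _] _]; exact: H. Qed.

(** The involution turns an invariant arc around: otherwise it would fix the
    arc pointwise, and have infinitely many fixed points. *)
Lemma swap_ends (i : aidx D) : gI i = i -> forall b : bool,
  invg (Defs.arc i b%:R) = Defs.arc i (~~ b)%:R.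
Proof.
move=> gi; have [[f [df _ f0 fim fE]] _] := HG i; rewrite gi in fE.
have fI t : unitI t -> unitI (f t) by move=> tI; rewrite -fim; exists t.
have ff t : unitI t -> f (f t) = t.
  move=> tI; have := fE _ (fI _ tI); rewrite -(fE _ tI) invgK => E.
  by have [_ /esym] := arc_inj tI (fI _ (fI _ tI)) E.
have [[|] Hb] := reparam_ends df f0 fim.
  by move=> b; rewrite fE ?Hb ?addbT //; exact: unitI_bool.
exfalso.
have inj s t : unitI s -> unitI t -> f s = f t -> s = t.
  by move=> sI tI E; rewrite -(ff _ sI) E ff.
have I0 := @unitI_bool R false; have I1 := @unitI_bool R true.
have [mono|mono] := unit_mono (diffeo_within df) inj; last first.
  by have := mono _ _ I0 I1 ltr01; rewrite !Hb /= => /(lt_trans ltr01); rewrite ltxx.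
have fid := increasing_involution (fun t tI => conj (fI t tI) (ff t tI)) mono.
pose s (n : nat) : R := n.+1%:R^-1.
have sI n : unitI (s n).
  by rewrite /s /Defs.unitI /= invr_ge0 ler0n invf_le1 ?ltr0n // ler1n.
have sinj : injective (fun n => Defs.arc i (s n)).
  move=> m n /(arc_inj (sI m) (sI n))[_ /invr_inj /eqP].
  by rewrite eqr_nat => /eqP[].
have fin : finite_set [set x : T | invg x = x] by case: HS => _ _ _ _ [[]].
apply: infinite_nat.
have E : ((fun n => Defs.arc i (s n)) @` [set: nat] #= [set: nat])%card.
  by apply: inj_card_eq => m n _ _; exact: sinj.
rewrite -(eq_finite_set E); apply: sub_finite_set fin => _ [n _ <-] /=.
by rewrite (fE _ (sI n)) fid.
Qed.

Lemma gend_swap (i : aidx D) b : gI i = i -> gend (i, b) = (i, ~~ b).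
Proof.
move=> gi; rewrite /gend /= gi; congr (_, _).
rewrite (swap_ends gi b); case: b => /=.
  apply/asboolP => E; have [_ /eqP] := arc_inj (@unitI_bool R false) (@unitI_bool R true) E.
  by rewrite eq_sym oner_eq0.
exact/asboolP.
Qed.

End Involution.

(** * The ends of the two arcs *)

Section Aux.
Variable R : realType.
Local Notation plane := (R * R)%type.
Local Notation O := (@octagon R).

Lemma octagon_pt (x y : R) : -2 <= x <= 2 -> -2 <= y <= 2 ->
  -3 <= x + y <= 3 -> -3 <= x - y <= 3 -> O (x, y).
Proof.
move=> /andP[x1 x2] /andP[y1 y2] /andP[a1 a2] /andP[b1 b2]; split; rewrite /=.
- by rewrite ler_norml x1 x2.
- by rewrite ler_norml y1 y2.
- have [x0|x0] := leP 0 x; have [y0|y0] := leP 0 y.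
  + by rewrite (ger0_norm x0) (ger0_norm y0).
  + by rewrite (ger0_norm x0) (ltr0_norm y0).
  + by rewrite (ltr0_norm x0) (ger0_norm y0); lra.
  + by rewrite (ltr0_norm x0) (ltr0_norm y0); lra.
Qed.

Lemma affine_derive (f : R -> R) (k m t : R) : derivable f t 1 ->
  derivable (fun s => k * f s + m) t 1 /\ derive1 (fun s => k * f s + m) t = k * derive1 f t.
Proof.
move=> df; have Hf := derivableP df.
have [H1 H2] : is_derive t (1 : R) (fun s => k * f s + m) (k *: 'D_1 f t + 0).
  exact: (is_deriveD (is_deriveZ k Hf) (is_derive_cst m t 1)).
by split; [exact: H1|rewrite !derive1E H2 addr0].
Qed.

Lemma ceil0z (x : R) (n : int) : -1 < x <= 0 -> Num.ceil (x + n%:~R) = n.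
Proof.
move=> /andP[x1 x0]; apply: ceil_def; rewrite intrB; apply/andP; split; lra.
Qed.

Lemma ceil1z (x : R) (n : int) : 0 < x <= 1 -> Num.ceil (x + n%:~R) = n + 1.
Proof.
move=> /andP[x1 x0]; apply: ceil_def; rewrite intrB intrD; apply/andP; split; lra.
Qed.

Lemma one_neq_opp1 : (1 : R) <> -1. Proof. lra. Qed.
Lemma diag_ends_neq : (3 / 2 : R) <> 3 / 2 - 3 * 1. Proof. lra. Qed.

Lemma tl_start : (0 - 2, 0 + 1) = (-2, 1) :> plane. Proof. by rewrite sub0r add0r. Qed.
Lemma tl_middle : (1 / 2 - 2, 1 / 2 + 1) = (- (3 / 2), 3 / 2) :> plane.
Proof. by congr (_, _); field. Qed.
Lemma br_start : (2 - 0, -1 - 0) = (2, -1) :> plane. Proof. by rewrite !subr0. Qed.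
Lemma br_middle : (2 - 1 / 2, -1 - 1 / 2) = (3 / 2, - (3 / 2)) :> plane.
Proof. by congr (_, _); field. Qed.
Lemma unitI_half : @unitI R (1 / 2). Proof. by rewrite /unitI /=; lra. Qed.
Lemma unitI0 : @unitI R 0. Proof. exact: (@unitI_bool R false). Qed.

Lemma oct_left : O (-2, 0). Proof. by apply: octagon_pt; lra. Qed.

Lemma diag_pt (t : R) : @unitI R t -> O (3 * t - 3 / 2, 3 / 2 - 3 * t) /\
  `|(3 * t - 3 / 2, 3 / 2 - 3 * t : R).1| <> 2.
Proof.
move=> /andP[t0 t1]; split; first by apply: octagon_pt; lra.
move=> /= E; have : `|3 * t - 3 / 2| <= 3 / 2 by rewrite ler_norml; lra.
by rewrite E; lra.
Qed.

Lemma oct_left_bottom : O (-2, -1). Proof. by apply: octagon_pt; lra. Qed.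
Lemma oct_left_top : O (-2, 1). Proof. by apply: octagon_pt; lra. Qed.
Lemma oct_diag_top : O (- (3 / 2), 3 / 2). Proof. by apply: octagon_pt; lra. Qed.
Lemma oct_diag_end : O (3 * 1 - 3 / 2, 3 / 2 - 3 * 1). Proof. by apply: octagon_pt; lra. Qed.

End Aux.

Section Adapted.
Variables (R : realType) (S : gms_data R) (HS : is_gms S)
  (c : R -> pts S) (P Q : pts S)
  (D : arcs_data S) (HD : full_system D) (HG : invariant_system D)
  (ad : adapted_data D) (Had : adapted c P Q ad).
Local Notation plane := (R * R)%type.
Local Notation T := (pts S).
Local Notation unitI := (@unitI R).
Local Notation O := (@octagon R).
Local Notation r := (rect ad).
Local Notation X := (iX ad).
Local Notation Y := (iY ad).
Local Notation bx := (seg_src (cseg ad)).2.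
Local Notation bY := (seg_tgt (cseg ad)).2.

Lemma gX : gI X = X. Proof. by case: Had => [[]]. Qed.
Lemma gY : gI Y = Y. Proof. by case: Had => [[]]. Qed.
Let Hlr (y : R) : `|y| <= 1 -> r (-2, y) = r (2, y).
Proof. by case: Had => [[_ _ _ H _] _ _ _ _]; exact: H. Qed.
Let rinj z w : O z -> O w -> r z = r w -> z = w \/ [/\ z.2 = w.2, `|z.1| = 2 & w.1 = - z.1].
Proof. by case: Had => [[_ _ _ _ H] _ _ _ _]; exact: H. Qed.

Lemma rect_inj_snd z w : O z -> O w -> r z = r w -> z.2 = w.2.
Proof. by move=> Oz Ow /(rinj Oz Ow)[->|[]]. Qed.

Lemma rect_inj_inner z w : O z -> O w -> `|z.1| <> 2 -> r z = r w -> z = w.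
Proof. by move=> Oz Ow z1 /(rinj Oz Ow)[->|[]]. Qed.

Lemma rectX_left : exists f : R -> R, [/\ forall t, derivable f t 1,
  forall t, unitI t -> derive1 f t != 0, f @` unitI = unitI &
  forall t, unitI t -> Defs.arc X t = r (-2, 2 * f t - 1)].
Proof. by case: Had => [_ [[f [df _ f0 fim fE]] _ _ _] _ _ _]; exists f. Qed.

Lemma rectY_diag : exists f : R -> R, [/\ forall t, derivable f t 1,
  forall t, unitI t -> derive1 f t != 0, f @` unitI = unitI &
  forall t, unitI t -> Defs.arc Y t = r (3 * f t - 3 / 2, 3 / 2 - 3 * f t)].
Proof. by case: Had => [_ [_ [f [df _ f0 fim fE]] _ _] _ _ _]; exists f. Qed.

Lemma corner_top_left : exists k (f : R -> R), [/\ forall t, derivable f t 1,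
  forall t, unitI t -> 0 < derive1 f t, forall t, unitI t -> unitI (f t) &
  forall t, unitI t -> r (t - 2, t + 1) = mseg k (f t)].
Proof.
case: Had => [_ _ [[k [f [df _ f0 fim fE]]] _ _ _] _ _]; exists k, f; split=> // t tI.
by apply: fim; exists t.
Qed.

Lemma corner_bottom_right : exists k (f : R -> R), [/\ forall t, derivable f t 1,
  forall t, unitI t -> 0 < derive1 f t, forall t, unitI t -> unitI (f t) &
  forall t, unitI t -> r (2 - t, -1 - t) = mseg k (f t)].
Proof.
case: Had => [_ _ [_ _ [k [f [df _ f0 fim fE]]] _] _ _]; exists k, f; split=> // t tI.
by apply: fim; exists t.
Qed.

Lemma segment_increasing (f : R -> R) : (forall t, derivable f t 1) ->
  (forall t, unitI t -> 0 < derive1 f t) -> f 0 < f (1 / 2).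
Proof.
move=> df f0.
have cf : {within `[0, 1], continuous f}.
  by apply: continuous_subspaceT => y; exact: real_derivable_cont.
have d1 : forall x, x \in `]0, 1[ -> derivable f x 1 by move=> x _; exact: df.
have d2 : forall x, x \in `]0, 1[ -> 0 < derive1 f x.
  move=> x; rewrite in_itv /= => /andP[x0 x1]; apply: f0.
  by rewrite /Defs.unitI /= !ltW.
by apply: (gtr0_derive1_lt_cc d1 d2 cf); rewrite ?in_itv /=; lra.
Qed.

(** One end of each arc is given, which determines the other one; the lower end of
    X is found on the right-hand side, to which the left one is glued. *)
Lemma sides_diagonal_ends : [/\ Defs.arc X bx%:R = r (-2, 1) , Defs.arc X (~~ bx)%:R = r (2, -1),
  Defs.arc Y bY%:R = r (- (3 / 2), 3 / 2) & Defs.arc Y (~~ bY)%:R = r (3 / 2, - (3 / 2))].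
Proof.
have [eX eY] : Defs.arc X bx%:R = r (-2, 1) /\ Defs.arc Y bY%:R = r (- (3 / 2), 3 / 2).
  by case: Had => [_ _ _ _ [_ _ _ _ ]].
have [f [df f0 fim fE]] := rectX_left; have [h [dh h0 him hE]] := rectY_diag.
have [e He] := reparam_ends df f0 fim; have [e' He'] := reparam_ends dh h0 him.
split=> //.
  rewrite fE; last exact: unitI_bool.
  have := fE _ (@unitI_bool R bx); rewrite !He eX.
  have -> : (~~ bx) (+) e = ~~ (bx (+) e) by rewrite addNb.
  case: (bx (+) e) => /= E.
    by rewrite mulr0 sub0r Hlr // normrN normr1.
  rewrite mulr0 sub0r in E.
  by have := rect_inj_snd (oct_left_top R) (oct_left_bottom R) E; move/one_neq_opp1.
rewrite hE; last exact: unitI_bool.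
have := hE _ (@unitI_bool R bY); rewrite !He' eY.
have -> : (~~ bY) (+) e' = ~~ (bY (+) e') by rewrite addNb.
case: (bY (+) e') => /= E; last by congr (r (_, _)); field.
by have := rect_inj_snd (oct_diag_top R) (oct_diag_end R) E; move/diag_ends_neq.
Qed.

Lemma end_pos (i : aidx D) (b : bool) k t : unitI t -> Defs.arc i b%:R = mseg k t ->
  acomp i b = k /\ apos i b = t.
Proof.
move=> tI E; have [pI Ep] : unitI (apos i b) /\ Defs.arc i b%:R = mseg (acomp i b) (apos i b).
  by case: HD => [[_ H _ _ _] _]; exact: H.
by apply: (mseg_inj HS pI tI); rewrite -Ep.
Qed.

(** The corner at the top left is parametrised from the top of the side X, at time
    0, to the left end of the top; the diagonal Y ends at its middle, at time
    1 / 2. The corner at the bottom right is its image by the central symmetry. *)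
Lemma corner_positions : exists k k' (f f' : R -> R),
  [/\ [/\ forall t, derivable f t 1, forall t, unitI t -> 0 < derive1 f t,
        forall t, unitI t -> unitI (f t) & forall t, unitI t -> r (t - 2, t + 1) = mseg k (f t)],
      [/\ forall t, derivable f' t 1, forall t, unitI t -> 0 < derive1 f' t,
        forall t, unitI t -> unitI (f' t) & forall t, unitI t -> r (2 - t, -1 - t) = mseg k' (f' t)],
      (acomp X bx = k /\ apos X bx = f 0) /\ (acomp Y bY = k /\ apos Y bY = f (1 / 2)) &
      (acomp X (~~ bx) = k' /\ apos X (~~ bx) = f' 0) /\
      (acomp Y (~~ bY) = k' /\ apos Y (~~ bY) = f' (1 / 2))].
Proof.
have [k [f Hf]] := corner_top_left; have [k' [f' Hf']] := corner_bottom_right.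
exists k, k', f, f'; split=> //.
  case: Hf => df f0 fI fE; have [e1 _ e2 _] := sides_diagonal_ends.
  split; apply: end_pos; [exact: fI (unitI0 R)| |exact: fI (unitI_half R)|].
    by rewrite e1 -(fE _ (unitI0 R)) tl_start.
  by rewrite e2 -(fE _ (unitI_half R)) tl_middle.
case: Hf' => df f0 fI fE; have [_ e1 _ e2] := sides_diagonal_ends.
split; apply: end_pos; [exact: fI (unitI0 R)| |exact: fI (unitI_half R)|].
  by rewrite e1 -(fE _ (unitI0 R)) br_start.
by rewrite e2 -(fE _ (unitI_half R)) br_middle.
Qed.

(** P lies on X but not on the diagonal. *)
Lemma iX_neq_iY : X <> Y.
Proof.
move=> E; have [f [df f0 fim fE]] := rectY_diag.
have [sI aP] : unitI (sP ad) /\ Defs.arc X (sP ad) = r (-2, 0).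
  by case: Had => [_ _ _ _ [[-> _] [? _ ->] _ _ _]].
have fs : unitI (f (sP ad)) by rewrite -fim; exists (sP ad).
rewrite E (fE _ sI) in aP.
have [oc ne] := diag_pt fs.
have := rect_inj_inner oc (oct_left R) ne aP => /(congr1 fst) /= E1.
by apply: ne; rewrite /= E1 normrN normr_nat.
Qed.

Lemma cseg_src : seg_src (cseg ad) = (X, bx).
Proof.
have : (seg_src (cseg ad)).1 = X by case: Had => [_ _ _ _ [_ _ _ [-> _] _]].
by case: (seg_src (cseg ad)) => i b /= ->.
Qed.

Lemma cseg_tgt : seg_tgt (cseg ad) = (Y, bY).
Proof.
have : (seg_tgt (cseg ad)).1 = Y by case: Had => [_ _ _ _ [_ _ _ [_ ->] _]].
by case: (seg_tgt (cseg ad)) => i b /= ->.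
Qed.

Lemma gseg_ends : seg_src (gseg (cseg ad)) = (X, ~~ bx) /\ seg_tgt (gseg (cseg ad)) = (Y, ~~ bY).
Proof.
have [k [k' [f [f' [_ [df f0 _ _] _ [[c1 p1] [c2 p2]]]]]]] := corner_positions.
have valid : (ecomp (X, ~~ bx) == ecomp (Y, ~~ bY)) && (epos (X, ~~ bx) < epos (Y, ~~ bY)).
  by rewrite /ecomp /epos /= c1 c2 p1 p2 eqxx; exact: segment_increasing.
have E : val (gseg (cseg ad)) = ((X, ~~ bx), (Y, ~~ bY)).
  by rewrite /gseg cseg_src cseg_tgt (gend_swap HS HD HG _ gX) (gend_swap HS HD HG _ gY) insubdK.
by rewrite /seg_src /seg_tgt E.
Qed.

(** The involution carries the ends of X and Y at one corner to those at the other
    one, in the same order. *)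
Lemma components_neq : acomp X bx <> acomp X (~~ bx).
Proof.
have [k [k' [f [f' [[df f0 fI fE] [df' f0' fI' fE'] [[c1 p1] [c2 p2]] [[c1' p1'] [c2' p2']]]]]]] := corner_positions.
rewrite c1 c1' => kk'; rewrite -kk' in fE' c1' c2'.
have [e1 e1' e2 e2'] := sides_diagonal_ends.
have I0 := unitI0 R; have Ih := unitI_half R.
have m1 : mseg k (f 0) = Defs.arc X bx%:R :> T by rewrite e1 -(fE _ I0) tl_start.
have m2 : mseg k (f (1 / 2)) = Defs.arc Y bY%:R :> T by rewrite e2 -(fE _ Ih) tl_middle.
have m1' : mseg k (f' 0) = Defs.arc X (~~ bx)%:R :> T by rewrite e1' -(fE' _ I0) br_start.
have m2' : mseg k (f' (1 / 2)) = Defs.arc Y (~~ bY)%:R :> T by rewrite e2' -(fE' _ Ih) br_middle.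
have E : f 0 = f' 0.
  apply: (@no_invariant_segment _ _ HS k _ _ _ _ (fI _ I0) (fI _ Ih) (fI' _ I0) (fI' _ Ih)
    (segment_increasing df f0) (segment_increasing df' f0')).
    by rewrite m1 m1'; exact: swap_ends gX _.
  by rewrite m2 m2'; exact: swap_ends gY _.
have := m1; rewrite E m1' => /(arc_inj HD (unitI_bool R _) (unitI_bool R _))[_ /eqP].
by rewrite eqr_nat; case: (bx).
Qed.

Lemma segments_between (s : segment D) :
  (seg_src s).1 = X \/ (seg_src s).1 = Y -> (seg_tgt s).1 = X \/ (seg_tgt s).1 = Y ->
  s = cseg ad \/ s = gseg (cseg ad).
Proof.
have [k [k' [f [f' [[df f0 _ _] [df' f0' _ _] [[c1 p1] [c2 p2]] [[c1' p1'] [c2' p2']]]]]]] := corner_positions.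
have kk' : k <> k' by rewrite -c1 -c1'; exact: components_neq.
have lt1 := segment_increasing df f0; have lt2 := segment_increasing df' f0'.
have [g1 g2] := gseg_ends.
have kind (e : arc_end D) : e.1 = X \/ e.1 = Y ->
   [\/ e = (X, bx), e = (Y, bY), e = (X, ~~ bx) | e = (Y, ~~ bY)].
  case: e => i b /= [->|->].
    have [->|] := eqVneq b bx; first by constructor 1.
    by move=> H; constructor 3; congr (_, _); move: H; case: b; case: (bx).
  have [->|] := eqVneq b bY; first by constructor 2.
  by move=> H; constructor 4; congr (_, _); move: H; case: b; case: (bY).
have /andP[/eqP comp pos] := valP s.
rewrite -[(val s).1]/(seg_src s) -[(val s).2]/(seg_tgt s) in comp pos.
have valE (s' : segment D) : seg_src s = seg_src s' -> seg_tgt s = seg_tgt s' -> s = s'.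
  move=> E1 E2; apply: val_inj; move: E1 E2; rewrite /seg_src /seg_tgt.
  by case: (val s) => ? ?; case: (val s') => ? ? /= -> ->.
move=> /kind Hs /kind Ht.
case: Hs => Es; case: Ht => Et; rewrite Es Et /ecomp /epos /= ?c1 ?c2 ?c1' ?c2' ?p1 ?p2 ?p1' ?p2' in comp pos.
- by rewrite ltxx in pos.
- left; exact: valE (etrans Es (esym cseg_src)) (etrans Et (esym cseg_tgt)).
- by case: (kk' comp).
- by case: (kk' comp).
- by rewrite ltNge (ltW lt1) in pos.
- by rewrite ltxx in pos.
- by case: (kk' comp).
- by case: (kk' comp).
- by case: (kk' (esym comp)).
- by case: (kk' (esym comp)).
- by rewrite ltxx in pos.
- right; exact: valE (etrans Es (esym g1)) (etrans Et (esym g2)).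
- by case: (kk' (esym comp)).
- by case: (kk' (esym comp)).
- by rewrite ltNge (ltW lt2) in pos.
- by rewrite ltxx in pos.
Qed.

End Adapted.

(** * The degrees of the corner segments *)

Section Aux2.
Variable R : realType.
Local Notation plane := (R * R)%type.
Local Notation O := (@octagon R).

Lemma oct_gamma (x : R) : -2 <= x <= 2 -> O (0 + x *: (1, 0)) /\ 0 + x *: (1, 0) = (x, 0) :> plane.
Proof.
move=> /andP[x1 x2]; have -> : 0 + x *: (1, 0) = (x, 0) :> plane.
  by apply: plane_eq; rewrite /= /GRing.scale /=; ring.
by split=> //; apply: octagon_pt; lra.
Qed.

Lemma oct_side (a : bool) (x : R) : 0 <= x <= 1 ->
  let s : R := (-1) ^+ a * 2 in
  O ((s, 0) + (2 * x + -1) *: (0, 1)) /\ (s, 0) + (2 * x + -1) *: (0, 1) = (s, 2 * x - 1) :> plane.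
Proof.
move=> /andP[x1 x2] s; have -> : (s, 0) + (2 * x + -1) *: (0, 1) = (s, 2 * x - 1) :> plane.
  by apply: plane_eq; rewrite /= /GRing.scale /=; ring.
by split=> //; rewrite /s; case: a {s}; apply: octagon_pt; rewrite ?expr1 ?expr0; lra.
Qed.

Lemma oct_diag (x : R) : 0 <= x <= 1 ->
  O (0 + (-3 * x + 3 / 2) *: (-1, 1)) /\
  0 + (-3 * x + 3 / 2) *: (-1, 1) = (3 * x - 3 / 2, 3 / 2 - 3 * x) :> plane.
Proof.
move=> /andP[x1 x2].
have -> : 0 + (-3 * x + 3 / 2) *: (-1, 1) = (3 * x - 3 / 2, 3 / 2 - 3 * x) :> plane.
  by apply: plane_eq; rewrite /= /GRing.scale /=; ring.
by split=> //; apply: octagon_pt; lra.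
Qed.

Lemma oct_tl (t : R) : 0 <= t <= 1 ->
  O ((-2, 1) + t *: (1, 1)) /\ (-2, 1) + t *: (1, 1) = (t - 2, t + 1) :> plane.
Proof.
move=> /andP[x1 x2].
have -> : (-2, 1) + t *: (1, 1) = (t - 2, t + 1) :> plane.
  by apply: plane_eq; rewrite /= /GRing.scale /=; ring.
by split=> //; apply: octagon_pt; lra.
Qed.

Lemma oct_br (t : R) : 0 <= t <= 1 ->
  O ((2, -1) + (-1 * t + 0) *: (1, 1)) /\
  (2, -1) + (-1 * t + 0) *: (1, 1) = (2 - t, -1 - t) :> plane.
Proof.
move=> /andP[x1 x2].
have -> : (2, -1) + (-1 * t + 0) *: (1, 1) = (2 - t, -1 - t) :> plane.
  by apply: plane_eq; rewrite /= /GRing.scale /=; ring.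
by split=> //; apply: octagon_pt; lra.
Qed.

Lemma id_derive1 (t : R) : derivable (id : R -> R) t 1 /\ derive1 (id : R -> R) t != 0.
Proof. by split; [exact: derivable_id|rewrite derive1_id oner_eq0]. Qed.

End Aux2.

Section Degrees.
Variables (R : realType) (S : gms_data R) (HS : is_gms S)
  (c : R -> pts S) (theta : R -> R) (Hloop : graded_loop c theta)
  (P Q : pts S) (D : arcs_data S) (HD : full_system D)
  (ad : adapted_data D) (Had : adapted c P Q ad).
Local Notation plane := (R * R)%type.
Local Notation T := (pts S).
Local Notation unitI := (@unitI R).
Local Notation O := (@octagon R).
Local Notation r := (rect ad).
Local Notation X := (iX ad).
Local Notation Y := (iY ad).
Local Notation bx := (seg_src (cseg ad)).2.
Local Notation bY := (seg_tgt (cseg ad)).2.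

Let Hr : forall z a, O z -> dom a (r z) ->
  exists f, region_rep O r z a f /\ 0 < Defs.jacobian f z.
Proof. by case: Had => [[_ _ H _ _] _ _ _ _]. Qed.
Let arc_imm (i : aidx D) : immersed_curve unitI (Defs.arc i).
Proof. by case: HD => [[/(_ i)[[H _ _ _ _] _] _ _ _ _] _]. Qed.
Let arc_grd (i : aidx D) : is_grading (@tau R S) unitI (Defs.arc i) (arcg i).
Proof. by case: HD => [[/(_ i)[_ H] _ _ _ _] _]. Qed.
Let mseg_grd k : is_grading (@tau R S) unitI (mseg k) (msegg D k).
Proof. by case: HD => [[_ _ H _ _] _]. Qed.

Section Lifts.
Variables (th : nat -> plane -> R)
  (cth : forall i, {within O, continuous (th i)})
  (thE : forall i z, O z -> circ (th i z) = dirv r (udir R i) z).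

(** This lemma and the following ones are [curve_lift] for the loop, the sides, the
    diagonal and the two corners. *)
Lemma gamma_lift (rho : R -> R) : (forall x, derivable rho x 1) ->
  (forall x, `|x| <= 2 -> 0 < derive1 rho x) -> (forall x, `|x| <= 2 -> c (rho x) = r (x, 0)) ->
  exists n : int, forall x, -2 <= x <= 2 -> theta (rho x) = th 0 (x, 0) + n%:~R.
Proof.
move=> drho rho0 Erho.
have cc : immersed_curve [set: R] c by case: Hloop => [[_ H _ _ _] _].
have ct : is_grading (@tau R S) [set: R] c theta by case: Hloop => _ [].
have nx (x : R) : -2 <= x <= 2 -> `|x| <= 2 by rewrite ler_norml.
have h4 : (-2 : R) < 2 by lra.
have [|||||n Hn] := @curve_lift R S HS r Hr [set: R] c theta rho id 0 (udir R 0) (-2) 2 h4 cc ct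
  (udir_neq0 R 0) drho (fun t => (id_derive1 t).1) _ _ _ _ _ (th 0%N) (@cth 0%N) (@thE 0%N).
- by move=> t /nx/rho0; rewrite lt0r => /andP[].
- by move=> t _; exact: (id_derive1 t).2.
- by [].
- by move=> t /oct_gamma[].
- by move=> t tI; have [_ ->] := oct_gamma tI; rewrite Erho //; exact: nx.
by exists n => x xI; rewrite Hn // /=; have [_ ->] := oct_gamma xI.
Qed.

Lemma side_lift (a : bool) (f : R -> R) : (forall t, derivable f t 1) ->
  (forall t, unitI t -> derive1 f t != 0) -> (forall t, unitI t -> unitI (f t)) ->
  (forall t, unitI t -> Defs.arc X t = r ((-1) ^+ a * 2, 2 * f t - 1)) ->
  exists n : int, forall t, unitI t -> arcg X t = th 2 ((-1) ^+ a * 2, 2 * f t - 1) + n%:~R.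
Proof.
move=> df f0 fI fE.
have [|||||n Hn] := @curve_lift R S HS r Hr unitI (Defs.arc X) (arcg X) id (fun t => 2 * f t + -1)
  ((-1) ^+ a * 2, 0) (udir R 2) 0 1 ltr01 (@arc_imm X) (@arc_grd X)
  (udir_neq0 R 2) (fun t => (id_derive1 t).1) (fun t => (affine_derive 2 (-1) (df t)).1)
  _ _ _ _ _ (th 2%N) (@cth 2%N) (@thE 2%N).
- by move=> t _; exact: (id_derive1 t).2.
- by move=> t tI; rewrite (affine_derive 2 (-1) (df t)).2 mulf_neq0 ?f0.
- by [].
- by move=> t tI; have [] := oct_side a (fI t tI).
- by move=> t tI; have [_ ->] := oct_side a (fI t tI); exact: fE.
by exists n => t tI; rewrite Hn //; have [_ ->] := oct_side a (fI t tI).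
Qed.

Lemma diag_lift (f : R -> R) : (forall t, derivable f t 1) ->
  (forall t, unitI t -> derive1 f t != 0) -> (forall t, unitI t -> unitI (f t)) ->
  (forall t, unitI t -> Defs.arc Y t = r (3 * f t - 3 / 2, 3 / 2 - 3 * f t)) ->
  exists n : int, forall t, unitI t ->
    arcg Y t = th 3 (3 * f t - 3 / 2, 3 / 2 - 3 * f t) + n%:~R.
Proof.
move=> df f0 fI fE.
have [|||||n Hn] := @curve_lift R S HS r Hr unitI (Defs.arc Y) (arcg Y) id
  (fun t => -3 * f t + 3 / 2) 0 (udir R 3) 0 1 ltr01 (@arc_imm Y) (@arc_grd Y)
  (udir_neq0 R 3) (fun t => (id_derive1 t).1) (fun t => (affine_derive (-3) (3 / 2) (df t)).1)
  _ _ _ _ _ (th 3%N) (@cth 3%N) (@thE 3%N).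
- by move=> t _; exact: (id_derive1 t).2.
- by move=> t tI; rewrite (affine_derive (-3) (3 / 2) (df t)).2 mulf_neq0 ?f0 // oppr_eq0.
- by [].
- by move=> t tI; have [] := oct_diag (fI t tI).
- by move=> t tI; have [_ ->] := oct_diag (fI t tI); exact: fE.
by exists n => t tI; rewrite Hn //; have [_ ->] := oct_diag (fI t tI).
Qed.

Lemma corner_lift_tl k (f : R -> R) : (forall t, derivable f t 1) ->
  (forall t, unitI t -> 0 < derive1 f t) -> (forall t, unitI t -> unitI (f t)) ->
  (forall t, unitI t -> r (t - 2, t + 1) = mseg k (f t)) ->
  exists n : int, forall t, unitI t -> msegg D k (f t) = th 1 (t - 2, t + 1) + n%:~R.
Proof.
move=> df f0 fI fE.
have [|||||n Hn] := @curve_lift R S HS r Hr unitI (mseg k) (msegg D k) f id (-2, 1)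
  (udir R 1) 0 1 ltr01 (@mseg_rep _ _ HS k) (@mseg_grd k)
  (udir_neq0 R 1) df (fun t => (id_derive1 t).1)
  _ _ _ _ _ (th 1%N) (@cth 1%N) (@thE 1%N).
- by move=> t /f0; rewrite lt0r => /andP[].
- by move=> t _; exact: (id_derive1 t).2.
- exact: fI.
- by move=> t /oct_tl[].
- by move=> t tI; have [_ ->] := oct_tl tI; rewrite fE.
by exists n => t tI; rewrite Hn //; have [_ ->] := oct_tl tI.
Qed.

Lemma corner_lift_br k (f : R -> R) : (forall t, derivable f t 1) ->
  (forall t, unitI t -> 0 < derive1 f t) -> (forall t, unitI t -> unitI (f t)) ->
  (forall t, unitI t -> r (2 - t, -1 - t) = mseg k (f t)) ->
  exists n : int, forall t, unitI t -> msegg D k (f t) = th 1 (2 - t, -1 - t) + n%:~R.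
Proof.
move=> df f0 fI fE.
have [|||||n Hn] := @curve_lift R S HS r Hr unitI (mseg k) (msegg D k) f (fun t => -1 * id t + 0) (2, -1)
  (udir R 1) 0 1 ltr01 (@mseg_rep _ _ HS k) (@mseg_grd k)
  (udir_neq0 R 1) df (fun t => (affine_derive (-1) 0 (id_derive1 t).1).1)
  _ _ _ _ _ (th 1%N) (@cth 1%N) (@thE 1%N).
- by move=> t /f0; rewrite lt0r => /andP[].
- move=> t _; rewrite (affine_derive (-1) 0 (id_derive1 t).1).2.
  by rewrite mulf_neq0 ?oppr_eq0 ?oner_eq0 //; exact: (id_derive1 t).2.
- exact: fI.
- by move=> t /oct_br[].
- by move=> t tI; have [_ ->] := oct_br tI; rewrite fE.
by exists n => t tI; rewrite Hn //; have [_ ->] := oct_br tI.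
Qed.

End Lifts.

End Degrees.

Section Aux3.
Variable R : realType.
Local Notation plane := (R * R)%type.

(** The index of two curves whose directions have lifts in this order, for gradings
    that are shifted by m and n. *)
Lemma ceil_below (a b : R) (m n : int) : a < b < a + 1 ->
  Num.ceil ((a + m%:~R) - (b + n%:~R)) = m - n.
Proof.
move=> /andP[ab ba].
have -> : (a + m%:~R) - (b + n%:~R) = (a - b) + (m - n)%:~R by rewrite intrB; ring.
by apply: ceil0z; apply/andP; split; lra.
Qed.

Lemma ceil_above (a b : R) (m n : int) : a < b < a + 1 ->
  Num.ceil ((b + m%:~R) - (a + n%:~R)) = m - n + 1.
Proof.
move=> /andP[ab ba].
have -> : (b + m%:~R) - (a + n%:~R) = (b - a) + (m - n)%:~R by rewrite intrB; ring.
by apply: ceil1z; apply/andP; split; lra.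
Qed.

Lemma periodic_int (f : R -> R) : (forall t, f (t + 1) = f t) -> forall t (z : int), f (t + z%:~R) = f t.
Proof.
move=> f1.
have fn t n : f (t + n%:R) = f t.
  by elim: n => [|n IH]; rewrite ?addr0 // -natr1 addrA f1.
move=> t [n|n]; first exact: fn.
by rewrite NegzE mulrNz -[LHS](fn _ n.+1) -[_ *~ _]/(n.+1%:R) subrK.
Qed.

Lemma side_left : (-1) ^+ true * 2 = -2 :> R. Proof. by rewrite expr1 mulN1r. Qed.
Lemma side_right : (-1) ^+ false * 2 = 2 :> R. Proof. by rewrite expr0 mul1r. Qed.
Lemma side_norm (x : R) : 0 <= x <= 1 -> `|2 * x - 1| <= 1.
Proof. by move=> /andP[x0 x1]; rewrite ler_norml; lra. Qed.
Lemma norm_lt2 (x : R) : `|x| <= 3 / 2 -> `|x| <> 2. Proof. by move=> + E; rewrite E; lra. Qed.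
Lemma left_itv : -2 <= (-2 : R) <= 2. Proof. by apply/andP; split; lra. Qed.
Lemma right_itv : -2 <= (2 : R) <= 2. Proof. by apply/andP; split; lra. Qed.
Lemma center_itv : -2 <= (0 : R) <= 2. Proof. by apply/andP; split; lra. Qed.
Lemma norm_itv (x : R) : -2 <= x <= 2 -> `|x| <= 2. Proof. by rewrite ler_norml. Qed.
Lemma oct_right : @octagon R (2, 0). Proof. by apply: octagon_pt; lra. Qed.
Lemma oct_center : @octagon R (0, 0). Proof. by apply: octagon_pt; lra. Qed.
Lemma oct_right_bottom : @octagon R (2, -1). Proof. by apply: octagon_pt; lra. Qed.
Lemma oct_diag_bottom : @octagon R (3 / 2, - (3 / 2)). Proof. by apply: octagon_pt; lra. Qed.
Lemma center_inner : `|((0, 0) : plane).1| <> 2.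
Proof. by apply: norm_lt2; rewrite /= normr0; lra. Qed.
Lemma diag_top_inner : `|((- (3 / 2), 3 / 2) : plane).1| <> 2.
Proof. by apply: norm_lt2; rewrite /= normrN ger0_norm; lra. Qed.
Lemma diag_bottom_inner : `|((3 / 2, - (3 / 2)) : plane).1| <> 2.
Proof. by apply: norm_lt2; rewrite /= ger0_norm; lra. Qed.
End Aux3.

Section Final.
Variables (R : realType) (S : gms_data R) (HS : is_gms S)
  (c : R -> pts S) (theta : R -> R)
  (Hloop : graded_loop c theta) (Hsimple : simple_loop c)
  (P Q : pts S)
  (D : arcs_data S) (HD : full_system D) (HG : invariant_system D)
  (ad : adapted_data D) (Had : adapted c P Q ad).
Local Notation plane := (R * R)%type.
Local Notation T := (pts S).
Local Notation unitI := (@unitI R).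
Local Notation O := (@octagon R).
Local Notation r := (rect ad).
Local Notation X := (iX ad).
Local Notation Y := (iY ad).
Local Notation bx := (seg_src (cseg ad)).2.
Local Notation bY := (seg_tgt (cseg ad)).2.

(** A simple loop returns to a point after whole periods only. *)
Lemma loop_theta s t : c s = c t -> theta s = theta t.
Proof.
move=> /Hsimple[z E]; have -> : t = s + z%:~R by rewrite -E addrC subrK.
by rewrite periodic_int //; case: Hloop => _ [].
Qed.

(** Let n_c, n_X, n_Y, n_m be the differences between the gradings of the loop, of
    X, of Y and of the marked segment and the lifts th_0, th_2, th_3, th_1. The order
    of the lifts gives p = n_c - n_X and q = n_c - n_Y, and the indices at the ends
    of the segment c are n_X - n_m + 1 and n_Y - n_m + 1. For gc, the same is done
    on the right-hand side of the octagon, where X and P appear a second time. *)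
Lemma corner_degrees :
  seg_deg (cseg ad) = indQ theta ad - indP theta ad /\
  seg_deg (gseg (cseg ad)) = indQ theta ad - indP theta ad.
Proof.
have Hr : forall z a, O z -> dom a (r z) ->
    exists f, region_rep O r z a f /\ 0 < Defs.jacobian f z by case: Had => [[]].
have Hlr (y : R) : `|y| <= 1 -> r (-2, y) = r (2, y).
  by case: Had => [[_ _ _ H _] _ _ _ _]; exact: H.
have [th [cth thE thlt]] := direction_lifts HS Hr.
have [rho [drho rho0 rho2 Erho]] : exists rho : R -> R,
    [/\ forall x, derivable rho x 1, forall x, `|x| <= 2 -> 0 < derive1 rho x, rho 2 = rho (-2) + 1 &
     forall x, `|x| <= 2 -> c (rho x) = r (x, 0)].
  by case: Had => [_ _ _ [rho [? _ ? ? ?]] _]; exists rho.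
have [ng Hg] := gamma_lift HS Hloop Had cth thE drho rho0 Erho.
have [f [df f0 fim fE]] := rectX_left Had; have [h [dh h0 him hE]] := rectY_diag Had.
have fI t : unitI t -> unitI (f t) by move=> tI; rewrite -fim; exists t.
have hI t : unitI t -> unitI (h t) by move=> tI; rewrite -him; exists t.
have fEl t : unitI t -> Defs.arc X t = r ((-1) ^+ true * 2, 2 * f t - 1).
  by move=> tI; rewrite side_left fE.
have fEr t : unitI t -> Defs.arc X t = r ((-1) ^+ false * 2, 2 * f t - 1).
  by move=> tI; rewrite side_right fE // Hlr //; apply: side_norm; exact: fI.
have [nX HX] := side_lift HS HD Had cth thE df f0 fI fEl.
have [nX' HX'] := side_lift HS HD Had cth thE df f0 fI fEr.
have [nY HY] := diag_lift HS HD Had cth thE dh h0 hI hE.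
have [k [k' [m [m' [[dm m0 mI mE] [dm' m0' mI' mE'] [[c1 p1] [c2 p2]] [[c1' p1'] [c2' p2']]]]]]] :=
  corner_positions HS HD Had.
have [nm Hm] := corner_lift_tl HS HD Had cth thE dm m0 mI mE.
have [nm' Hm'] := corner_lift_br HS HD Had cth thE dm' m0' mI' mE'.
have [EP EQ ctP [sPI aP] [ctQ [sQI aQ]]] : [/\ P = r (-2, 0), Q = r (0, 0), c (tP ad) = P,
    unitI (sP ad) /\ Defs.arc X (sP ad) = P & c (tQ ad) = Q /\
    (unitI (sQ ad) /\ Defs.arc Y (sQ ad) = Q)].
  by case: Had => [_ _ _ _ [[? ?] [? ? ?] [? ? ?] _ _]].
have [e1 e1' e2 e2'] := sides_diagonal_ends Had.
have I0 := unitI0 R; have Ih := unitI_half R.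
have octS (a : bool) t : unitI t -> O ((-1) ^+ a * 2, 2 * f t - 1).
  by move=> tI; have [+ E] := oct_side a (fI t tI); rewrite E.
have octD t : unitI t -> O (3 * h t - 3 / 2, 3 / 2 - 3 * h t).
  by move=> tI; have [] := diag_pt (hI t tI).
have fP : 2 * f (sP ad) - 1 = 0.
  have E : r ((-1) ^+ true * 2, 2 * f (sP ad) - 1) = r (-2, 0) by rewrite -fEl // aP EP.
  exact: (rect_inj_snd Had (octS true _ sPI) (oct_left R) E).
have hQ : (3 * h (sQ ad) - 3 / 2, 3 / 2 - 3 * h (sQ ad)) = (0, 0).
  have E : r (0, 0) = r (3 * h (sQ ad) - 3 / 2, 3 / 2 - 3 * h (sQ ad)) by rewrite -hE // aQ EQ.
  exact: (esym (rect_inj_inner Had (oct_center R) (octD _ sQI) (center_inner (R := R)) E)).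
have gP : theta (tP ad) = th 0%N (-2, 0) + ng%:~R.
  by rewrite -Hg ?left_itv //; apply: loop_theta; rewrite ctP EP Erho // norm_itv ?left_itv.
have gP' : theta (tP ad) = th 0%N (2, 0) + ng%:~R.
  rewrite -Hg ?right_itv //; apply: loop_theta; rewrite ctP EP Erho ?norm_itv ?right_itv //.
  by apply: Hlr; rewrite normr0 ler01.
have gQ : theta (tQ ad) = th 0%N (0, 0) + ng%:~R.
  by rewrite -Hg ?center_itv //; apply: loop_theta; rewrite ctQ EQ Erho // norm_itv ?center_itv.
have iP : indP theta ad = ng - nX.
  by rewrite /indP /ind gP HX // fP side_left; apply: ceil_below; apply: thlt => //; exact: oct_left.
have iP' : indP theta ad = ng - nX'.
  by rewrite /indP /ind gP' HX' // fP side_right; apply: ceil_below; apply: thlt => //; exact: oct_right.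
have iQ : indQ theta ad = ng - nY.
  by rewrite /indQ /ind gQ HY // hQ; apply: ceil_below; apply: thlt => //; exact: oct_center.
have bI (b : bool) : unitI b%:R := unitI_bool R b.
have dX : end_index (X, bx) = nX - nm + 1.
  rewrite /end_index /ecomp /epos /ind /= c1 p1 HX // Hm // tl_start.
  have -> : ((-1) ^+ true * 2, 2 * f bx%:R - 1) = (-2, 1) :> plane.
    congr (_, _); first exact: side_left.
    have E : r ((-1) ^+ true * 2, 2 * f bx%:R - 1) = r (-2, 1) by rewrite -fEl // e1.
    exact: (rect_inj_snd Had (octS true _ (bI _)) (oct_left_top R) E).
  by apply: ceil_above; apply: thlt => //; exact: oct_left_top.
have dY : end_index (Y, bY) = nY - nm + 1.
  rewrite /end_index /ecomp /epos /ind /= c2 p2 HY // Hm // tl_middle.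
  have -> : (3 * h bY%:R - 3 / 2, 3 / 2 - 3 * h bY%:R) = (- (3 / 2), 3 / 2) :> plane.
    have E : r (- (3 / 2), 3 / 2) = r (3 * h bY%:R - 3 / 2, 3 / 2 - 3 * h bY%:R) by rewrite -hE // e2.
    exact: (esym (rect_inj_inner Had (oct_diag_top R) (octD _ (bI _)) (diag_top_inner (R := R)) E)).
  by apply: ceil_above; apply: thlt => //; exact: oct_diag_top.
have dX' : end_index (X, ~~ bx) = nX' - nm' + 1.
  rewrite /end_index /ecomp /epos /ind /= c1' p1' HX' // Hm' // br_start.
  have -> : ((-1) ^+ false * 2, 2 * f (~~ bx)%:R - 1) = (2, -1) :> plane.
    congr (_, _); first exact: side_right.
    have E : r ((-1) ^+ false * 2, 2 * f (~~ bx)%:R - 1) = r (2, -1) by rewrite -fEr // e1'.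
    exact: (rect_inj_snd Had (octS false _ (bI _)) (oct_right_bottom R) E).
  by apply: ceil_above; apply: thlt => //; exact: oct_right_bottom.
have dY' : end_index (Y, ~~ bY) = nY - nm' + 1.
  rewrite /end_index /ecomp /epos /ind /= c2' p2' HY // Hm' // br_middle.
  have -> : (3 * h (~~ bY)%:R - 3 / 2, 3 / 2 - 3 * h (~~ bY)%:R) = (3 / 2, - (3 / 2)) :> plane.
    have E : r (3 / 2, - (3 / 2)) = r (3 * h (~~ bY)%:R - 3 / 2, 3 / 2 - 3 * h (~~ bY)%:R) by rewrite -hE // e2'.
    exact: (esym (rect_inj_inner Had (oct_diag_bottom R) (octD _ (bI _)) (diag_bottom_inner (R := R)) E)).
  by apply: ceil_above; apply: thlt => //; exact: oct_diag_bottom.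
have dXs : end_index (seg_src (cseg ad)) = nX - nm + 1 := etrans (congr1 _ (cseg_src Had)) dX.
have dYs : end_index (seg_tgt (cseg ad)) = nY - nm + 1 := etrans (congr1 _ (cseg_tgt Had)) dY.
have [g1 g2] := gseg_ends HS HD HG Had.
have dXs' : end_index (seg_src (gseg (cseg ad))) = nX' - nm' + 1 := etrans (congr1 _ g1) dX'.
have dYs' : end_index (seg_tgt (gseg (cseg ad))) = nY - nm' + 1 := etrans (congr1 _ g2) dY'.
split.
  by rewrite /seg_deg dXs dYs iQ iP; ring.
by rewrite /seg_deg dXs' dYs' iQ iP'; ring.
Qed.

Lemma adapted_corner_facts : corner_facts X Y (cseg ad).
Proof.
have [g1 g2] := gseg_ends HS HD HG Had.
have [d1 d2] := corner_degrees.
have gXX := gX Had; have gYY := gY Had.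
split.
- exact: iX_neq_iY Had.
- exact: gXX.
- exact: gYY.
- by rewrite (cseg_src Had) (cseg_tgt Had).
- by rewrite g1 g2.
- move=> /(congr1 (@seg_src _ _ _)); rewrite g1 => /(congr1 snd) /= E.
  by move: E; case: (bx).
- have s1 : gend (X, ~~ bx) = (X, bx) by rewrite (gend_swap HS HD HG _ gXX) negbK.
  have s2 : gend (Y, ~~ bY) = (Y, bY) by rewrite (gend_swap HS HD HG _ gYY) negbK.
  have E : (gend (seg_src (gseg (cseg ad))), gend (seg_tgt (gseg (cseg ad)))) = val (cseg ad).
    rewrite g1 g2 s1 s2 -(cseg_src Had) -(cseg_tgt Had) /seg_src /seg_tgt.
    by case: (val (cseg ad)).
  by apply: val_inj; rewrite {1}/gseg insubdK E //; exact: (valP (cseg ad)).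
- by rewrite d1 d2.
- by move=> s; exact: (segments_between HS HD HG Had).
Qed.

End Final.

Theorem proposition4p17 (R : realType) (K : closedFieldType)
  (charK : 2%N \notin [pchar K])
  (S : gms_data R) (HS : is_gms S)
  (c : R -> pts S) (theta : R -> R)
  (Hloop : graded_loop c theta) (Hsimple : simple_loop c)
  (Hstable : @invg R S @` range c = range c)
  (Hhtp : freely_homotopic (fun t => invg (c t)) (fun t => c (- t)))
  (P Q : pts S) (HPQ : P <> Q)
  (Hfix : range c `&` [set x | invg x = x] = [set P; Q])
  (D : arcs_data S) (HD : full_system D) (HG : invariant_system D)
  (ad : adapted_data D) (Had : adapted c P Q ad)
  (eP eQ eP' eQ' : int)
  (heP : eP = 1 \/ eP = -1) (heQ : eQ = 1 \/ eQ = -1)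
  (heP' : eP' = 1 \/ eP' = -1) (heQ' : eQ' = 1 \/ eQ' = -1)
  (l : int) :
  is_kar (B_eps theta ad K eP eQ) /\
  kar_hom_dim (B_eps theta ad K eP eQ)
              (kar_shift l (B_eps theta ad K eP' eQ')) =
    if [&& l == 0, eP == eP' & eQ == eQ'] then 1%N
    else if [&& l == 1, eP == - eP' & eQ == - eQ'] then 1%N
    else 0%N.
Proof.
apply: kar_B_dim => //.
- exact: (adapted_corner_facts HS Hloop Hsimple HD HG Had).
- exact: (corner_degrees HS Hloop Hsimple HD HG Had).1.
Qed.
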